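(* Let $(D,V)$ be an admissible pair on a separable Hilbert space $H$. Then there exist a regular Hermite–Biehler function $E$ with no real zeros and a constant $\alpha\in\mathbb{R}$ such that $e^{i\alpha z}\mathcal{W}H=\mathcal{H}(E)$ as Hilbert spaces, i.e. the map $f\mapsto e^{i\alpha z}f$ is a unitary map of $\mathcal{W}H$ onto $\mathcal{H}(E)$.
   Context: Let $H$ be a separable complex Hilbert space. A pair $(D,V)$ of operators is called admissible if: (i) $D:\mathscr{D}(D)\subset H\to H$ is a densely defined closed linear operator; (ii) $\dim\ker D=1$; (iii) $D$ has a self-adjoint restriction with compact resolvent; (iv) $V:H\to H$ is a compact operator with $\sigma(V)=\{0\}$; (v) $\operatorname{Ran}V\subset\mathscr{D}(D)$ and $DV=I$. Fix $0\neq\phi_0\in\ker D$ and put $\phi_\lambda=(I-\lambda V)^{-1}\phi_0$ for $\lambda\in\mathbb{C}$ (then $\phi_\lambda$ spans $\ker(D-\lambda I)$). The generalized Fourier transform is $(\mathcal{W}x)(\lambda)=\langle x,\phi_{\bar\lambda}\rangle_H$ for $x\in H$, $\lambda\in\mathbb{C}$; each $\mathcal{W}x$ is entire, $\mathcal{W}$ is injective, and $\mathcal{W}H$ is regarded as a Hilbert space of entire functions with norm $\|\mathcal{W}x\|:=\|x\|_H$, so that $\mathcal{W}:H\to\mathcal{W}H$ is unitary. A Hermite–Biehler (HB) function is an entire function $E$ with $|E(z)|>|E(\bar z)|$ for all $z$ in the upper half-plane $\mathbb{C}_+$. For entire $f$ write $f^\#(z)=\overline{f(\bar z)}$. The de Branges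 space $\mathcal{H}(E)$ is the Hilbert space of entire functions $f$ with $f/E\in H^2(\mathbb{C}_+)$ and $f^\#/E\in H^2(\mathbb{C}_+)$, with norm $\|f\|^2=\int_{\mathbb{R}}|f(t)/E(t)|^2\,dt$. $E$ is called regular if $1/((z+i)E(z))\in H^2(\mathbb{C}_+)$. *)

(* Defs.v *)
From mathcomp Require Import all_boot all_order all_algebra.
From mathcomp Require Import all_classical all_reals all_analysis.
From mathcomp Require Import complex.
Set Implicit Arguments. Unset Strict Implicit. Unset Printing Implicit Defensive.
Import Order.TTheory GRing.Theory Num.Theory.
Local Open Scope classical_set_scope.
Local Open Scope ring_scope.
Local Open Scope complex_scope.

Section Defs.
Variable R : realType.
Local Notation C := R[i].

Definition cmod2 (z : C) : R := (complex.Re z) ^+ 2 + (complex.Im z) ^+ 2.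
Definition cmod (z : C) : R := Num.sqrt (cmod2 z).

Definition cdiff_at (f : C -> C) (z : C) : Prop :=
  exists d : C, forall eps : R, 0 < eps -> exists delta : R, 0 < delta /\
    forall h : C, h != 0 -> cmod h < delta -> cmod ((f (z + h) - f z) / h - d) < eps.

Definition entire (f : C -> C) : Prop := forall z, cdiff_at f z.

Definition upper_half (z : C) : Prop := 0 < complex.Im z.

Definition holo_upper (f : C -> C) : Prop := forall z, upper_half z -> cdiff_at f z.

Definition in_H2_upper (F : C -> C) : Prop :=
  holo_upper F /\
  exists M : R, forall y : R, 0 < y ->
    (\int[lebesgue_measure]_(x in [set: R]) (cmod2 (F (x +i* y)))%:E <= M%:E)%E.

Definition sharp (f : C -> C) : C -> C := fun z => conjc (f (conjc z)).

Definition hermite_biehler (E : C -> C) : Prop :=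
  entire E /\ forall z, upper_half z -> cmod (E (conjc z)) < cmod (E z).

Definition regular_HB (E : C -> C) : Prop :=
  in_H2_upper (fun z => ((z + 'i) * E z)^-1).

Definition in_deBranges (E f : C -> C) : Prop :=
  entire f /\ in_H2_upper (fun z => f z / E z) /\ in_H2_upper (fun z => sharp f z / E z).

Definition deBranges_norm2 (E f : C -> C) : \bar R :=
  (\int[lebesgue_measure]_(t in [set: R]) (cmod2 (f (t%:C) / E (t%:C)))%:E)%E.

Definition cexp (z : C) : C :=
  (expR (complex.Re z) * cos (complex.Im z)) +i* (expR (complex.Re z) * sin (complex.Im z)).
Definition exp_ialpha (alpha : R) (z : C) : C := cexp ('i * alpha%:C * z).

Variable H : lmodType C.
Variable ip : H -> H -> C.

Definition hnorm (x : H) : R := Num.sqrt (complex.Re (ip x x)).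

Definition inner_product : Prop :=
  (forall a x y z, ip (a *: x + y) z = a * ip x z + ip y z) /\
  (forall x y, ip y x = conjc (ip x y)) /\
  (forall x, complex.Im (ip x x) = 0 /\ 0 <= complex.Re (ip x x)) /\
  (forall x, ip x x = 0 -> x = 0).

Definition hconv (u : nat -> H) (l : H) : Prop :=
  forall eps : R, 0 < eps -> exists N, forall n, (N <= n)%N -> hnorm (u n - l) < eps.

Definition hcauchy (u : nat -> H) : Prop :=
  forall eps : R, 0 < eps -> exists N, forall n m, (N <= n)%N -> (N <= m)%N ->
    hnorm (u n - u m) < eps.

Definition hdense (S : set H) : Prop :=
  forall x eps, 0 < eps -> exists y, S y /\ hnorm (x - y) < eps.

Definition separable_hilbert : Prop :=
  inner_product /\
  (forall u, hcauchy u -> exists l, hconv u l) /\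
  exists d : nat -> H, hdense (range d).

Definition subspace (S : set H) : Prop :=
  S 0 /\ forall (a : C) x y, S x -> S y -> S (a *: x + y).

Definition linear_on (dom : set H) (T : H -> H) : Prop :=
  subspace dom /\ forall (a : C) x y, dom x -> dom y -> T (a *: x + y) = a *: T x + T y.

Definition densely_defined (dom : set H) (T : H -> H) : Prop :=
  linear_on dom T /\ hdense dom.

Definition closed_op (dom : set H) (T : H -> H) : Prop :=
  forall (u : nat -> H) x y, (forall n, dom (u n)) -> hconv u x -> hconv (T \o u) y ->
    dom x /\ T x = y.

Definition bounded_op (T : H -> H) : Prop :=
  (forall (a : C) x y, T (a *: x + y) = a *: T x + T y) /\
  exists M : R, forall x, hnorm (T x) <= M * hnorm x.

Definition compact_op (T : H -> H) : Prop :=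
  bounded_op T /\
  forall u : nat -> H, (exists M : R, forall n, hnorm (u n) <= M) ->
    exists (s : nat -> nat) (l : H), (forall n, (s n < s n.+1)%N) /\ hconv (fun n => T (u (s n))) l.

Definition in_resolvent_bounded (T : H -> H) (lam : C) : Prop :=
  exists S : H -> H, bounded_op S /\
    forall x, S (T x - lam *: x) = x /\ T (S x) - lam *: S x = x.

Definition spectrum_bounded (T : H -> H) : set C := ~` (in_resolvent_bounded T).

Definition self_adjoint (dom : set H) (T : H -> H) : Prop :=
  densely_defined dom T /\
  (forall y, dom y <-> exists z, forall x, dom x -> ip (T x) y = ip x z) /\
  (forall x y, dom x -> dom y -> ip (T x) y = ip x (T y)).

Definition compact_resolvent (dom : set H) (T : H -> H) : Prop :=
  exists (mu : C) (Rm : H -> H), compact_op Rm /\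
    (forall x, dom (Rm x) /\ T (Rm x) - mu *: Rm x = x) /\
    (forall y, dom y -> Rm (T y - mu *: y) = y).

Definition ker_op (dom : set H) (T : H -> H) : set H := [set x | dom x /\ T x = 0].

Definition admissible (dom : set H) (D V : H -> H) : Prop :=
  (* (i) *) densely_defined dom D /\ closed_op dom D /\
  (exists phi, ker_op dom D phi /\ phi != 0 /\
      forall x, ker_op dom D x -> exists c : C, x = c *: phi) /\
  (exists dom0 : set H, dom0 `<=` dom /\ self_adjoint dom0 D /\ compact_resolvent dom0 D) /\
  (* (iv) *) compact_op V /\ spectrum_bounded V = [set 0] /\
  (* (v) *) (forall x, dom (V x)) /\ (forall x, D (V x) = x).

(* generalized Fourier transform, given phi lam = (I - lam V)^{-1} phi0 *)
Definition gen_fourier (phi : C -> H) (x : H) : C -> C := fun lam => ip x (phi (conjc lam)).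

End Defs.

(* Main.v *)
(* Green's formula for the self-adjoint restriction of [D] produces entire
   functions [a], [b] with
     (l - m^* ) <phi_l, phi_m> = b(l) (a m)^* - a(l) (b m)^*,
   where [a] has no zeros off the real axis and [1 / a] grows there at most like
   |z|^2 (1 + 1 / |Im z|).  Taking m = l^* gives a / a^# = b / b^#, a zero-free
   entire function.  The growth of [1 / a] makes a multiple of a(z)(z + i)^2
   bounded below on horizontal half-planes, so Harnack's inequality for its
   logarithm bounds the logarithmic derivative of a / a^# off the real axis, and
   a Liouville theorem allowing a polynomial singularity at the real axis makes
   that derivative constant: a = c exp(i t z) a^# with |c| = 1.  Hence, for
   alpha = t / 2 and k^2 = c, the functions A = k exp(i alpha z) a^# and
   B = k exp(i alpha z) b^# are real entire, and E = sqrt(pi) (A - i B) has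
   the reproducing kernel of exp(i alpha z) WH as its de Branges kernel.  The
   reproducing formula makes the map isometric on the span of the [phi_l], which
   is dense because [V] is quasinilpotent, and Riesz representation makes it
   onto. *)
Require Import Defs.
From mathcomp Require Import all_boot all_order all_algebra.
From mathcomp Require Import all_classical all_reals all_analysis.
From mathcomp Require Import measurable_realfun complex ring lra.
Set Implicit Arguments. Unset Strict Implicit. Unset Printing Implicit Defensive.
Import Order.TTheory GRing.Theory Num.Theory numFieldNormedType.Exports.
Local Open Scope classical_set_scope.
Local Open Scope ring_scope.
Local Open Scope complex_scope.
Local Notation Re := complex.Re.
Local Notation Im := complex.Im.

Local Notation "z ^*" := (conjc z) : ring_scope.

(** * Complex differentiation *)

(** [V] is merely quasinilpotent, so no bound on the growth of [phi_l] or of [a] is at hand and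
    Hadamard factorisation cannot be used. Self-adjointness bounds [1 / a] instead: [phi_l] minus
    [a(l)] times a fixed eigenvector solves [(D - l) r = (l - mu) a(l) phi_mu] in the self-adjoint
    domain, so a small [a(l)] would make [phi_l] small, against [phi_l - l V phi_l = phi_0].
    Harnack's inequality turns this one-sided information into a two-sided one. The Hardy space
    theory stays elementary because [E] has no zeros in the closed upper half-plane: every quotient
    [f / E] is holomorphic up to the real axis, and Goursat's theorem on rectangles, with vertical
    sides chosen by Tonelli's theorem, replaces boundary limits. Regularity of [E] comes from one
    identity: with [y = V^* phi_0] the function [W phi_0 - z W y] is the constant [|phi_0|^2]. After
    multiplication by [exp(i alpha z)] either it or its reflection is bounded below on the upper
    half-plane, according to the sign of [alpha]. *)

Section ComplexModulus.
Variable R : realType.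
Local Notation C := R[i].
Implicit Types (z w : C) (r : R).

Lemma cmodE z : cmod z = Normc.normc z.
Proof. by case: z. Qed.

Lemma cmod_ge0 z : 0 <= cmod z.
Proof. exact: sqrtr_ge0. Qed.

Lemma cmod20 z : 0 <= cmod2 z.
Proof. by rewrite addr_ge0 ?sqr_ge0. Qed.

Lemma cmod_sqr z : cmod z ^+ 2 = cmod2 z.
Proof. by rewrite sqr_sqrtr // cmod20. Qed.

Lemma cmodM z w : cmod (z * w) = cmod z * cmod w.
Proof. by rewrite !cmodE Normc.normcM. Qed.

Lemma cmodV z : cmod z^-1 = (cmod z)^-1.
Proof. by rewrite !cmodE Normc.normcV. Qed.

Lemma cmodN z : cmod (- z) = cmod z.
Proof. by rewrite !cmodE normcN. Qed.

Lemma cmodD z w : cmod (z + w) <= cmod z + cmod w.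
Proof. by rewrite !cmodE le_normcD. Qed.

Lemma cmodB z w : cmod (z - w) <= cmod z + cmod w.
Proof. by rewrite -(cmodN w) cmodD. Qed.

Lemma cmodBC z w : cmod (z - w) = cmod (w - z).
Proof. by rewrite -cmodN opprB. Qed.

Lemma cmod0 : cmod (0 : C) = 0.
Proof. by rewrite cmodE Normc.normc0. Qed.

Lemma cmod1 : cmod (1 : C) = 1.
Proof. by rewrite cmodE Normc.normc1. Qed.

Lemma cmod_eq0 z : (cmod z == 0) = (z == 0).
Proof.
apply/eqP/eqP => [|->]; last exact: cmod0.
by rewrite cmodE; apply: Normc.eq0_normc.
Qed.

Lemma cmod_gt0 z : (0 < cmod z) = (z != 0).
Proof. by rewrite lt_def cmod_ge0 andbT cmod_eq0. Qed.

Lemma cmod_real r : cmod (r%:C) = `|r|.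
Proof. by rewrite /cmod /cmod2 /= expr0n addr0 sqrtr_sqr. Qed.

Lemma cmod_conj z : cmod (z^*) = cmod z.
Proof. by case: z => a b; rewrite /cmod /cmod2 /= sqrrN. Qed.

Lemma cmodX z n : cmod (z ^+ n) = cmod z ^+ n.
Proof. by elim: n => [|n IH]; rewrite ?expr0 ?cmod1 // !exprS cmodM IH. Qed.

Lemma cmod_i : cmod ('i : C) = 1.
Proof. by rewrite /cmod /cmod2 /= expr0n add0r expr1n sqrtr1. Qed.

Lemma normRe_le z : `|Re z| <= cmod z.
Proof. by rewrite -sqrtr_sqr ler_sqrt ?lerDl ?sqr_ge0 ?cmod20. Qed.

Lemma normIm_le z : `|Im z| <= cmod z.
Proof. by rewrite -sqrtr_sqr ler_sqrt ?lerDr ?sqr_ge0 ?cmod20. Qed.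

Lemma Re_le z : Re z <= cmod z.
Proof. exact: le_trans (ler_norm _) (normRe_le z). Qed.

Lemma Im_le z : Im z <= cmod z.
Proof. exact: le_trans (ler_norm _) (normIm_le z). Qed.

Lemma cmod_le z : cmod z <= `|Re z| + `|Im z|.
Proof.
rewrite -(@ler_pXn2r _ 2) ?nnegrE ?cmod_ge0 ?addr_ge0 //.
rewrite cmod_sqr sqrrD /cmod2 !real_normK ?num_real //.
have : 0 <= `|Re z| * `|Im z| by rewrite mulr_ge0.
lra.
Qed.

Lemma cReD z w : Re (z + w) = Re z + Re w. Proof. by case: z; case: w. Qed.
Lemma cImD z w : Im (z + w) = Im z + Im w. Proof. by case: z; case: w. Qed.
Lemma cReN z : Re (- z) = - Re z. Proof. by case: z. Qed.
Lemma cImN z : Im (- z) = - Im z. Proof. by case: z. Qed.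
Lemma cReB z w : Re (z - w) = Re z - Re w. Proof. by rewrite cReD cReN. Qed.
Lemma cImB z w : Im (z - w) = Im z - Im w. Proof. by rewrite cImD cImN. Qed.
Lemma cReM z w : Re (z * w) = Re z * Re w - Im z * Im w.
Proof. by case: z; case: w. Qed.
Lemma cImM z w : Im (z * w) = Re z * Im w + Im z * Re w.
Proof. by case: z => a b; case: w => c d /=; ring. Qed.
Lemma cReJ z : Re (z^*) = Re z. Proof. by case: z. Qed.
Lemma cImJ z : Im (z^*) = - Im z. Proof. by case: z. Qed.
Definition ReImE := (cReD, cImD, cReN, cImN, cReM, cImM, cReJ, cImJ).

Lemma complex_ext z w : Re z = Re w -> Im z = Im w -> z = w.
Proof. by case: z; case: w => a b c d /= -> ->. Qed.

Lemma mulJ z : z * z^* = (cmod2 z)%:C.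
Proof. by apply: complex_ext; rewrite !ReImE /cmod2 /=; ring. Qed.

Lemma cmod2M z w : cmod2 (z * w) = cmod2 z * cmod2 w.
Proof. by rewrite -!cmod_sqr cmodM exprMn. Qed.

Lemma cmod2D z w : cmod2 (z + w) <= 2 * cmod2 z + 2 * cmod2 w.
Proof.
rewrite /cmod2 !ReImE.
have := sqr_ge0 (Re z - Re w); have := sqr_ge0 (Im z - Im w).
by rewrite !sqrrB !sqrrD; lra.
Qed.

Lemma conjD z w : (z + w)^* = z^* + w^*. Proof. exact: rmorphD. Qed.
Lemma conjN z : (- z)^* = - z^*. Proof. exact: rmorphN. Qed.
Lemma conjB z w : (z - w)^* = z^* - w^*. Proof. exact: rmorphB. Qed.
Lemma conjM z w : (z * w)^* = z^* * w^*. Proof. exact: rmorphM. Qed.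
Lemma conjV z : (z^-1)^* = (z^*)^-1. Proof. exact: conjc_inv. Qed.
Lemma conj_inj : injective (@conjc R).
Proof. exact: can_inj (@conjcK R). Qed.

End ComplexModulus.

Section Continuity.
Variable R : realType.
Local Notation C := R[i].
Implicit Types (f g : C -> C) (z w : C).

Definition ccont f z := forall e : R, 0 < e ->
  exists2 d : R, 0 < d & forall w, cmod (w - z) < d -> cmod (f w - f z) < e.

Lemma ccont_cst c z : ccont (fun=> c) z.
Proof. by move=> e e0; exists 1 => // w _; rewrite subrr cmod0. Qed.

Lemma ccont_id z : ccont id z.
Proof. by move=> e e0; exists e. Qed.

Lemma ccontD f g z : ccont f z -> ccont g z -> ccont (fun w => f w + g w) z.
Proof.
move=> cf cg e e0; have e2 : 0 < e / 2 by lra.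
have [d1 d10 h1] := cf _ e2; have [d2 d20 h2] := cg _ e2.
exists (Num.min d1 d2); first by rewrite lt_min d10.
move=> w; rewrite lt_min => /andP[/h1 a /h2 b].
rewrite [X in cmod X](_ : _ = (f w - f z) + (g w - g z)); last by ring.
by apply: le_lt_trans (cmodD _ _) _; lra.
Qed.

Lemma ccontN f z : ccont f z -> ccont (fun w => - f w) z.
Proof.
move=> cf e /cf[d d0 h]; exists d => // w /h.
by rewrite -opprD cmodN.
Qed.

Lemma ccontB f g z : ccont f z -> ccont g z -> ccont (fun w => f w - g w) z.
Proof. by move=> cf cg; apply: ccontD => //; apply: ccontN. Qed.

Lemma ccont_conj f z : ccont f z -> ccont (fun w => (f w)^*) z.
Proof.
by move=> cf e /cf[d d0 h]; exists d => // w /h; rewrite -conjB cmod_conj.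
Qed.

Lemma ccont_comp f g z : ccont g z -> ccont f (g z) -> ccont (fun w => f (g w)) z.
Proof.
move=> cg cf e /cf[d d0 h]; have [d' d'0 h'] := cg _ d0.
by exists d' => // w /h' /h.
Qed.

Lemma ccont_bounded f z : ccont f z ->
  exists2 d : R, 0 < d & forall w, cmod (w - z) < d -> cmod (f w) <= cmod (f z) + 1.
Proof.
move=> /(_ 1 ltr01)[d d0 h]; exists d => // w /h hw.
rewrite -[f w](subrK (f z)) addrC.
by apply: le_trans (cmodD _ _) _; rewrite lerD2l ltW.
Qed.

Lemma ccontM f g z : ccont f z -> ccont g z -> ccont (fun w => f w * g w) z.
Proof.
move=> cf cg e e0.
have [d0 d00 h0] := ccont_bounded cf.
set M := cmod (f z) + 1; set N := cmod (g z) + 1.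
have M0 : 0 < M by rewrite ltr_wpDl ?cmod_ge0.
have N0 : 0 < N by rewrite ltr_wpDl ?cmod_ge0.
have [d1 d10 h1] := cf (e / (2 * N)) ltac:(by rewrite divr_gt0 ?mulr_gt0).
have [d2 d20 h2] := cg (e / (2 * M)) ltac:(by rewrite divr_gt0 ?mulr_gt0).
exists (Num.min d0 (Num.min d1 d2)); first by rewrite !lt_min d00 d10.
move=> w; rewrite !lt_min => /and3P[/h0 a0 /h1 a1 /h2 a2].
rewrite [X in cmod X](_ : _ = f w * (g w - g z) + (f w - f z) * g z); last by ring.
apply: le_lt_trans (cmodD _ _) _; rewrite !cmodM.
have b2 : cmod (f w) * cmod (g w - g z) <= M * (e / (2 * M)).
  by apply: ler_pM; rewrite ?cmod_ge0 // ltW.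
have b1 : cmod (f w - f z) * cmod (g z) <= cmod (f w - f z) * N.
  by rewrite ler_wpM2l ?cmod_ge0 // /N lerDl.
have b3 : cmod (f w - f z) * N < e / (2 * N) * N by rewrite ltr_pM2r.
have E1 : M * (e / (2 * M)) = e / 2 by field; rewrite gt_eqF.
have E2 : e / (2 * N) * N = e / 2 by field; rewrite gt_eqF.
lra.
Qed.

Lemma ccont_neq0 f z : ccont f z -> f z != 0 ->
  exists2 d : R, 0 < d & forall w, cmod (w - z) < d -> cmod (f z) / 2 < cmod (f w).
Proof.
move=> cf f0; have f0' : 0 < cmod (f z) by rewrite cmod_gt0.
have [d d0 h] := cf (cmod (f z) / 2) ltac:(lra).
exists d => // w /h; rewrite cmodBC => a.
have := cmodD (f z - f w) (f w); rewrite subrK; lra.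
Qed.

Lemma ccontV f z : ccont f z -> f z != 0 -> ccont (fun w => (f w)^-1) z.
Proof.
move=> cf f0 e e0; have f0' : 0 < cmod (f z) by rewrite cmod_gt0.
have [d1 d10 h1] := ccont_neq0 cf f0.
set m := cmod (f z) in f0' h1 *.
have [d2 d20 h2] := cf (e * (m * m / 2)) ltac:(by rewrite !mulr_gt0).
exists (Num.min d1 d2); first by rewrite lt_min d10.
move=> w; rewrite lt_min => /andP[/h1 a1 /h2 a2].
have fw0 : f w != 0 by rewrite -cmod_gt0; apply: lt_trans a1; lra.
rewrite [X in cmod X](_ : _ = - (f w - f z) / (f w * f z)); last first.
  by field; rewrite fw0 f0.
rewrite cmodM cmodN cmodV cmodM -/m ltr_pdivrMr; last first.
  by rewrite mulr_gt0 ?cmod_gt0.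
apply: lt_le_trans a2 _; rewrite ler_pM2l //.
by nra.
Qed.

Lemma ccont_div f g z : ccont f z -> ccont g z -> g z != 0 ->
  ccont (fun w => f w / g w) z.
Proof. by move=> cf cg g0; apply: ccontM => //; apply: ccontV. Qed.

Lemma ccontX f z n : ccont f z -> ccont (fun w => f w ^+ n) z.
Proof.
move=> cf; elim: n => [|n IH]; first exact: ccont_cst.
by under eq_fun do rewrite exprS; apply: ccontM.
Qed.

Lemma ccont_near f g z r : 0 < r -> (forall w, cmod (w - z) < r -> f w = g w) ->
  ccont f z -> ccont g z.
Proof.
move=> r0 fg cf e /cf[d d0 h]; exists (Num.min r d); first by rewrite lt_min r0.
move=> w; rewrite lt_min => /andP[/fg <- /h]; rewrite -(fg z) //.
by rewrite subrr cmod0.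
Qed.

(** This is the tool for passing to the limit in inequalities, also when [z] is a parameter rather
    than a point of the half-plane. The right-hand side is written as a real part so that [ccont]
    covers it. *)
Lemma ccont_le f (g : C -> C) z r : ccont f z -> ccont g z -> 0 < r ->
  (forall t : R, 0 < t < r -> cmod (f (z + t%:C)) <= Re (g (z + t%:C))) ->
  cmod (f z) <= Re (g z).
Proof.
move=> cf cg r0 h; rewrite leNgt; apply/negP => lt.
pose e := (cmod (f z) - Re (g z)) / 2.
have e0 : 0 < e by rewrite /e; lra.
have [d1 d10 h1] := cf _ e0; have [d2 d20 h2] := cg _ e0.
pose t := Num.min r (Num.min d1 d2) / 2.
have m0 : 0 < Num.min r (Num.min d1 d2) by rewrite !lt_min r0 d10.
have t0 : 0 < t by rewrite /t; lra.
have tm : t < Num.min r (Num.min d1 d2) by rewrite /t; lra.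
have tE : cmod (z + t%:C - z) = t by rewrite addrC addKr cmod_real gtr0_norm.
have := tm; rewrite !lt_min => /and3P[tr t1 t2].
have := h1 (z + t%:C); have := h2 (z + t%:C).
rewrite tE => /(_ t2) b2 /(_ t1) b1.
have b0 := h t ltac:(by rewrite t0 tr).
have c1 := cmodD (f z - f (z + t%:C)) (f (z + t%:C)).
rewrite subrK cmodBC in c1.
have c2 := Re_le (g (z + t%:C) - g z); rewrite cReB in c2.
rewrite /e in b1 b2; lra.
Qed.

End Continuity.

Section Derivative.
Variable R : realType.
Local Notation C := R[i].
Implicit Types (f g : C -> C) (z w : C).

(* Caratheodory's form of complex differentiability: it turns every rule of
   calculus into continuity of an explicit quotient. *)
Definition cderiv f z d :=
  exists q, [/\ ccont q z, q z = d & forall w, f w - f z = (w - z) * q w].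

Lemma cdiff_atP f z : cdiff_at f z <-> exists d, cderiv f z d.
Proof.
split=> [[d hd]|[d [q [cq qz hq]]]]; exists d.
  exists (fun w => if w == z then d else (f w - f z) / (w - z)); split.
  - move=> e e0; have [r [r0 h]] := hd _ e0; exists r => // w wr.
    rewrite eqxx; case: eqVneq => [_|wz]; first by rewrite subrr cmod0.
    by have := h (w - z); rewrite subr_eq0 subrKC; apply.
  - by rewrite eqxx.
  - move=> w; case: eqVneq => [->|wz]; first by rewrite !subrr mul0r.
    by rewrite mulrC divfK // subr_eq0.
move=> e /cq[r r0 h]; exists r; split=> // k k0 kr.
by rewrite hq addrAC subrr add0r mulrC mulKf // -qz; apply: h; rewrite addrAC subrr add0r.
Qed.

Lemma cderiv_cst c z : cderiv (fun=> c) z 0.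
Proof.
exists (fun=> 0); split => [|//|w]; first exact: ccont_cst.
by rewrite subrr mulr0.
Qed.

Lemma cderiv_id z : cderiv id z 1.
Proof.
exists (fun=> 1); split => [|//|w]; first exact: ccont_cst.
by rewrite mulr1.
Qed.

Lemma cderiv_cont f z d : cderiv f z d -> ccont f z.
Proof.
move=> [q [cq _ hq]]; have -> : f = fun w => f z + (w - z) * q w.
  by apply/funext => w; rewrite -hq; ring.
apply: ccontD; first exact: ccont_cst.
by apply: ccontM cq; apply: ccontB; [exact: ccont_id|exact: ccont_cst].
Qed.

Lemma cderivD f g z a b : cderiv f z a -> cderiv g z b ->
  cderiv (fun w => f w + g w) z (a + b).
Proof.
move=> [q [cq <- hq]] [p [cp <- hp]]; exists (fun w => q w + p w).
split=> [|//|w]; first exact: ccontD.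
by rewrite mulrDr -hq -hp; ring.
Qed.

Lemma cderivM f g z a b : cderiv f z a -> cderiv g z b ->
  cderiv (fun w => f w * g w) z (a * g z + f z * b).
Proof.
move=> df dg; have cf := cderiv_cont df.
case: df dg => [q [cq <- hq]] [p [cp <- hp]].
exists (fun w => q w * g z + f w * p w); split=> [|//|w].
  apply: ccontD; last exact: ccontM.
  by apply: ccontM => //; exact: ccont_cst.
have -> : (w - z) * (q w * g z + f w * p w) =
  ((w - z) * q w) * g z + f w * ((w - z) * p w) by ring.
by rewrite -hq -hp; ring.
Qed.

Lemma cderivN f z a : cderiv f z a -> cderiv (fun w => - f w) z (- a).
Proof.
move=> [q [cq <- hq]]; exists (fun w => - q w); split=> [|//|w].
  exact: ccontN.
by rewrite mulrN -hq; ring.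
Qed.

Lemma cderivB f g z a b : cderiv f z a -> cderiv g z b ->
  cderiv (fun w => f w - g w) z (a - b).
Proof. by move=> df dg; apply: cderivD => //; apply: cderivN. Qed.

Lemma cderivZ f z a c : cderiv f z a -> cderiv (fun w => c * f w) z (c * a).
Proof.
move=> df; have := cderivM (cderiv_cst c z) df; rewrite mul0r add0r; exact.
Qed.

Lemma cderivV f z a : cderiv f z a -> f z != 0 ->
  cderiv (fun w => (f w)^-1) z (- a / f z ^+ 2).
Proof.
move=> df f0; have cf := cderiv_cont df.
case: df => [q [cq <- hq]].
(* At a zero of [f] the inverse is 0 by convention, and the Caratheodory identity is required for
   all [w], so the difference quotient itself is used there; near [z] this branch does not occur. *)
exists (fun w => if f w == 0 then ((f w)^-1 - (f z)^-1) / (w - z)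
                 else - q w / (f w * f z)); split=> [||w].
- have [d d0 h] := ccont_neq0 cf f0.
  apply: (@ccont_near _ (fun w => - q w / (f w * f z)) _ _ d) => //.
    move=> w /h; case: eqVneq => [->|//]; rewrite cmod0.
    by move=> lt; exfalso; have := cmod_ge0 (f z); lra.
  apply: ccont_div; last by rewrite mulf_neq0.
    exact: ccontN.
  by apply: ccontM => //; exact: ccont_cst.
- by rewrite (negbTE f0) expr2.
- case: (eqVneq (f w) 0) => [fw|fw].
    have wz : w - z != 0.
      by rewrite subr_eq0; apply: contra_neq f0 => <-.
    by rewrite mulrC divfK.
  have -> : (w - z) * (- q w / (f w * f z)) = - ((w - z) * q w) / (f w * f z).
    by ring.
  by rewrite -hq; field; rewrite fw f0.
Qed.

Lemma cderiv_div f g z a b : cderiv f z a -> cderiv g z b -> g z != 0 ->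
  cderiv (fun w => f w / g w) z ((a * g z - f z * b) / g z ^+ 2).
Proof.
move=> df dg g0; have := cderivM df (cderivV dg g0).
congr (cderiv _ _ _); by field.
Qed.

Lemma cderiv_comp f g z a b : cderiv g z b -> cderiv f (g z) a ->
  cderiv (fun w => f (g w)) z (a * b).
Proof.
move=> dg; have cg := cderiv_cont dg.
case: dg => [p [cp <- hp]] [q [cq <- hq]].
exists (fun w => q (g w) * p w); split=> [|//|w].
  by apply: ccontM => //; apply: (@ccont_comp _ q g).
by rewrite hq hp; ring.
Qed.

Lemma cderivX f z a n : cderiv f z a ->
  cderiv (fun w => f w ^+ n.+1) z (n.+1%:R * f z ^+ n * a).
Proof.
move=> df; elim: n => [|n IH].
  rewrite expr0 !mul1r; under eq_fun do rewrite expr1; exact: df.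
under eq_fun do rewrite exprS.
have := cderivM df IH; congr (cderiv _ _ _).
by rewrite !exprS -[in RHS]natr1; ring.
Qed.

Lemma cderiv_near f g z d r : 0 < r ->
  (forall w, cmod (w - z) < r -> f w = g w) -> cderiv f z d -> cderiv g z d.
Proof.
move=> r0 fg [q [cq qz hq]].
have fz : f z = g z by apply: fg; rewrite subrr cmod0.
exists (fun w => if cmod (w - z) < r then q w else (g w - g z) / (w - z)).
split=> [||w].
- by apply: (ccont_near r0 _ cq) => w ->.
- by rewrite subrr cmod0 r0.
- case: ifPn => [wr|]; first by rewrite -hq fg // fz.
  rewrite -leNgt => rw; rewrite mulrC divfK //.
  by rewrite -cmod_gt0; apply: lt_le_trans rw.
Qed.

Lemma cderiv_sharp f z d : cderiv f (z^*) d -> cderiv (sharp f) z (d^*).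
Proof.
move=> [q [cq <- hq]]; exists (sharp q); split=> [|//|w].
  apply: ccont_conj => e /cq[r r0 h]; exists r => // w wr; apply: h.
  by rewrite -conjB cmod_conj.
rewrite /sharp -conjB hq conjM; congr (_ * _).
by case: w z {cq hq} => [a b] [c e]; apply: complex_ext; rewrite !ReImE /=; ring.
Qed.

Lemma cderiv_uniq f z a b : cderiv f z a -> cderiv f z b -> a = b.
Proof.
move=> [q [cq <- hq]] [p [cp <- hp]].
have c0 : ccont (fun w => q w - p w) z by exact: ccontB.
have : cmod (q z - p z) <= Re (0 : C).
  apply: (@ccont_le _ _ (fun=> 0) _ 1 c0 (ccont_cst _ _) ltr01) => t /andP[t0 _].
  suff -> : q (z + t%:C) - p (z + t%:C) = 0 by rewrite cmod0.
  apply: (mulfI (x := z + t%:C - z)).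
    by rewrite addrC addKr -cmod_gt0 cmod_real gtr0_norm.
  by rewrite mulrBr -hp -hq mulr0 subrr.
rewrite /= => h; apply/eqP; rewrite -subr_eq0 -cmod_eq0.
by rewrite eq_le h cmod_ge0.
Qed.

End Derivative.

(** * Contour integrals and Cauchy's theorem *)

Section ComplexIntegral.
Variable R : realType.
Local Notation C := R[i].
Local Notation mu := (@lebesgue_measure R).
Local Notation measurable := (@measurable _ (measurableTypeR R)).
Implicit Types (g k : R -> C) (D : set R).

Definition cint D g : C :=
  (\int[mu]_(x in D) Re (g x)) +i* (\int[mu]_(x in D) Im (g x)).

Definition cintg D g :=
  mu.-integrable D (EFin \o (fun x => Re (g x))) /\
  mu.-integrable D (EFin \o (fun x => Im (g x))).

Lemma eq_cintg D g k : measurable D -> {in D, g =1 k} -> cintg D g -> cintg D k.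
Proof.
by move=> mD gk [h1 h2]; split; [move: h1|move: h2];
  apply: (eq_integrable mD) => x xD /=; rewrite gk.
Qed.

Lemma eq_cint D g k : {in D, g =1 k} -> cint D g = cint D k.
Proof.
by move=> gk; congr Complex; apply: eq_Rintegral => x xD; rewrite gk.
Qed.

Lemma cintgD D g k : measurable D -> cintg D g -> cintg D k ->
  cintg D (fun x => g x + k x).
Proof.
move=> mD [g1 g2] [k1 k2]; split.
- have := integrableD mD g1 k1; apply: (eq_integrable mD) => x _ /=.
  by rewrite cReD EFinD.
- have := integrableD mD g2 k2; apply: (eq_integrable mD) => x _ /=.
  by rewrite cImD EFinD.
Qed.

Lemma cintgZ D c g : measurable D -> cintg D g -> cintg D (fun x => c * g x).
Proof.
move=> mD [g1 g2]; split.
- have := integrableB mD (integrableZl mD (Re c) g1) (integrableZl mD (Im c) g2).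
  by apply: (eq_integrable mD) => x _ /=; rewrite cReM EFinB !EFinM.
- have := integrableD mD (integrableZl mD (Re c) g2) (integrableZl mD (Im c) g1).
  by apply: (eq_integrable mD) => x _ /=; rewrite cImM EFinD !EFinM.
Qed.

Lemma cintgN D g : measurable D -> cintg D g -> cintg D (fun x => - g x).
Proof.
move=> mD ig; have := cintgZ (-1) mD ig.
by apply: (eq_cintg mD) => x _; rewrite mulN1r.
Qed.

Lemma cintgB D g k : measurable D -> cintg D g -> cintg D k ->
  cintg D (fun x => g x - k x).
Proof. by move=> mD ig ik; apply: cintgD => //; apply: cintgN. Qed.

Lemma cintg_conj D g : measurable D -> cintg D g -> cintg D (fun x => (g x)^*).
Proof.
move=> mD [g1 g2]; split.
- by move: g1; apply: (eq_integrable mD) => x _ /=; rewrite cReJ.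
- have := integrableN g2; apply: (eq_integrable mD) => x _ /=.
  by rewrite cImJ.
Qed.

Lemma cintD D g k : measurable D -> cintg D g -> cintg D k ->
  cint D (fun x => g x + k x) = cint D g + cint D k.
Proof.
move=> mD [g1 g2] [k1 k2]; apply: complex_ext; rewrite !ReImE /= -RintegralD //;
  by apply: eq_Rintegral => x _; rewrite !ReImE.
Qed.

Lemma cintZ D c g : measurable D -> cintg D g ->
  cint D (fun x => c * g x) = c * cint D g.
Proof.
move=> mD [g1 g2]; have z1 r : mu.-integrable D (EFin \o (fun x => r * Re (g x))).
  by have := integrableZl mD r g1; apply: (eq_integrable mD) => x _ /=; rewrite EFinM.
have z2 r : mu.-integrable D (EFin \o (fun x => r * Im (g x))).
  by have := integrableZl mD r g2; apply: (eq_integrable mD) => x _ /=; rewrite EFinM.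
apply: complex_ext; rewrite !ReImE /= -!RintegralZl // -?RintegralB -?RintegralD //;
  by apply: eq_Rintegral => x _; rewrite !ReImE.
Qed.

Lemma cintN D g : measurable D -> cintg D g ->
  cint D (fun x => - g x) = - cint D g.
Proof.
move=> mD ig; rewrite -mulN1r -cintZ //.
by apply: eq_cint => x _; rewrite mulN1r.
Qed.

Lemma cintB D g k : measurable D -> cintg D g -> cintg D k ->
  cint D (fun x => g x - k x) = cint D g - cint D k.
Proof. by move=> mD ig ik; rewrite cintD ?cintN //; apply: cintgN. Qed.

Lemma cint_conj D g : measurable D -> cintg D g ->
  cint D (fun x => (g x)^*) = (cint D g)^*.
Proof.
move=> mD [g1 g2]; apply: complex_ext; rewrite !ReImE /=.
  by apply: eq_Rintegral => x _; rewrite cReJ.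
rewrite -mulN1r -RintegralZl //.
by apply: eq_Rintegral => x _; rewrite cImJ mulN1r.
Qed.

Lemma cmod_cint_le D g (h : R -> R) : measurable D -> cintg D g ->
  mu.-integrable D (EFin \o h) -> (forall x, D x -> cmod (g x) <= h x) ->
  cmod (cint D g) <= \int[mu]_(x in D) h x.
Proof.
move=> mD ig ih gh; set c := cint D g.
have [->|c0] := eqVneq c 0.
  by rewrite cmod0; apply: Rintegral_ge0 => x /gh; apply: le_trans (cmod_ge0 _).
have c0' : 0 < cmod c by rewrite cmod_gt0.
(* Rotation by the unimodular [u] turns the integral into its modulus, so it suffices to bound the
   real part of the rotated integrand. *)
pose u := c^* / (cmod c)%:C.
have cE : (cmod c)%:C != 0 :> C by rewrite -cmod_gt0 cmod_real gtr0_norm.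
have u1 : cmod u = 1.
  by rewrite cmodM cmod_conj cmodV cmod_real gtr0_norm // divff // gt_eqF.
have -> : cmod c = Re (u * c).
  have -> : u * c = (cmod c)%:C; last by [].
    apply: (mulIf cE); rewrite /u mulrAC divfK // mulrC mulJ -cmod_sqr.
    by apply: complex_ext; rewrite !ReImE /=; ring.
rewrite -cintZ //=; have [iu _] := cintgZ u mD ig.
apply: le_Rintegral => // x xD; apply: le_trans (Re_le _) _.
by rewrite cmodM u1 mul1r gh.
Qed.

End ComplexIntegral.

(** * Integration along horizontal and vertical segments *)

Section Paths.
Variable R : realType.
Local Notation C := R[i].
Local Notation mu := (@lebesgue_measure R).
Implicit Types (g k : R -> C) (f : C -> C) (D : set R).

Definition pcont g (t : R) := forall e : R, 0 < e ->
  exists2 d : R, 0 < d & forall s, `|s - t| < d -> cmod (g s - g t) < e.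

Lemma pcont_horizontal f (x y : R) : ccont f (x +i* y) ->
  pcont (fun t => f (t +i* y)) x.
Proof.
move=> cf e /cf[d d0 h]; exists d => // s sx; apply: h.
have -> : s +i* y - x +i* y = (s - x)%:C.
  by apply: complex_ext; rewrite !ReImE //= subrr.
by rewrite cmod_real.
Qed.

Lemma pcont_vertical f (x y : R) : ccont f (x +i* y) ->
  pcont (fun t => f (x +i* t)) y.
Proof.
move=> cf e /cf[d d0 h]; exists d => // s sx; apply: h.
have -> : x +i* s - x +i* y = 'i * (s - y)%:C.
  by apply: complex_ext; rewrite !ReImE /=; ring.
by rewrite cmodM cmod_i mul1r cmod_real.
Qed.

Lemma pcontB g k t : pcont g t -> pcont k t -> pcont (fun s => g s - k s) t.
Proof.
move=> cg ck e e0; have e2 : 0 < e / 2 by lra.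
have [d1 d10 h1] := cg _ e2; have [d2 d20 h2] := ck _ e2.
exists (Num.min d1 d2); first by rewrite lt_min d10.
move=> s; rewrite lt_min => /andP[/h1 a /h2 b].
rewrite [X in cmod X](_ : _ = (g s - g t) - (k s - k t)); last by ring.
by apply: le_lt_trans (cmodB _ _) _; lra.
Qed.

Lemma real_cont (h : R -> R) (t : R) :
  (forall e, 0 < e -> exists2 d, 0 < d & forall s, `|s - t| < d -> `|h s - h t| < e) ->
  {for t, continuous h}.
Proof.
move=> ht; apply/cvgrPdist_lt => e /ht[d d0 hd].
near=> s; rewrite distrC; apply: hd; rewrite distrC.
by near: s; apply: cvgr_dist_lt.
Unshelve. all: by end_near. Qed.

Lemma pcont_Re g t : pcont g t -> {for t, continuous (fun s => Re (g s))}.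
Proof.
move=> cg; apply: real_cont => e /cg[d d0 h]; exists d => // s /h.
by apply: le_lt_trans; rewrite -cReB normRe_le.
Qed.

Lemma pcont_Im g t : pcont g t -> {for t, continuous (fun s => Im (g s))}.
Proof.
move=> cg; apply: real_cont => e /cg[d d0 h]; exists d => // s /h.
by apply: le_lt_trans; rewrite -cImB normIm_le.
Qed.

Lemma pcont_cmod g t : pcont g t -> {for t, continuous (fun s => cmod (g s))}.
Proof.
move=> cg; apply: real_cont => e /cg[d d0 h]; exists d => // s /h.
apply: le_lt_trans; rewrite ler_norml; apply/andP; split.
  by have := cmodD (g t - g s) (g s); rewrite subrK cmodBC; lra.
by have := cmodD (g s - g t) (g t); rewrite subrK; lra.
Qed.

Lemma continuous_itv_integrable (h : R -> R) a b :
  (forall t, a <= t <= b -> {for t, continuous h}) ->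
  mu.-integrable `[a, b] (EFin \o h).
Proof.
move=> ch; apply: continuous_compact_integrable; first exact: segment_compact.
by apply: continuous_in_subspaceT => t; rewrite inE /= in_itv /= => /ch.
Qed.

Lemma pcont_cintg g a b : (forall t, a <= t <= b -> pcont g t) -> cintg `[a, b] g.
Proof.
by move=> cg; split; apply: continuous_itv_integrable => t /cg;
  [apply: pcont_Re|apply: pcont_Im].
Qed.

Lemma pcont_measurable_Re g : (forall t, pcont g t) ->
  measurable_fun setT (fun s => Re (g s)).
Proof. by move=> cg; apply: continuous_measurable_fun => t; apply: pcont_Re. Qed.

Lemma pcont_measurable_Im g : (forall t, pcont g t) ->
  measurable_fun setT (fun s => Im (g s)).
Proof. by move=> cg; apply: continuous_measurable_fun => t; apply: pcont_Im. Qed.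

Lemma dominated_cintg g (h : R -> R) : (forall t, pcont g t) ->
  mu.-integrable setT (EFin \o h) -> (forall t, cmod (g t) <= h t) ->
  cintg setT g.
Proof.
move=> cg ih gh; split; apply: le_integrable ih => //.
- by apply/measurable_EFinP; exact: pcont_measurable_Re.
- move=> t _; rewrite /= lee_fin; apply: le_trans (normRe_le _) _.
  exact: le_trans (gh t) (ler_norm _).
- by apply/measurable_EFinP; exact: pcont_measurable_Im.
- move=> t _; rewrite /= lee_fin; apply: le_trans (normIm_le _) _.
  exact: le_trans (gh t) (ler_norm _).
Qed.

Lemma nonneg_integrable (h : R -> R) (M : R) : measurable_fun setT h ->
  (forall t, 0 <= h t) -> (\int[mu]_(t in setT) (h t)%:E <= M%:E)%E ->
  mu.-integrable setT (EFin \o h).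
Proof.
move=> mh h0 hM; apply/integrableP; split; first exact/measurable_EFinP.
apply: le_lt_trans (ltry M); apply: le_trans hM.
rewrite le_eqVlt; apply/orP; left; apply/eqP; apply: eq_integral => t _.
by rewrite /= ger0_norm.
Qed.

Lemma cint_itv_split g a m b : a <= m <= b -> cintg `[a, b] g ->
  cint `[a, b] g = cint `[a, m] g + cint `[m, b] g.
Proof.
move=> /andP[am mb] [g1 g2].
have aux (h : R -> R) : mu.-integrable `[a, b] (EFin \o h) ->
  \int[mu]_(x in `[a, b]) h x =
  \int[mu]_(x in `[a, m]) h x + \int[mu]_(x in `[m, b]) h x.
  move=> ih; have := @Rintegral_itvB R h (BLeft a) (BRight b) m ih.
  rewrite !bnd_simp => /(_ am mb) /eqP; rewrite subr_eq addrC => /eqP ->.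
  rewrite Rintegral_itv_obnd_cbnd //.
  apply: integrableS ih => //; apply: subset_itv; rewrite ?bnd_simp //.
by apply: complex_ext; rewrite !ReImE /= aux.
Qed.

Lemma cint_itv_cst (c : C) a b : a <= b -> cint `[a, b] (fun=> c) = c * (b - a)%:C.
Proof.
move=> ab; rewrite /cint !Rintegral_cst //= lebesgue_measure_itv /= lte_fin.
case: ltP => [_|ba]; rewrite /=.
  by apply: complex_ext; rewrite !ReImE /= ?mulr0; ring.
have -> : b = a by apply/eqP; rewrite eq_le ba ab.
by rewrite subrr !mulr0.
Qed.

Lemma cmod_cint_itv_le g a b M : a <= b -> (forall t, a <= t <= b -> pcont g t) ->
  (forall t, a <= t <= b -> cmod (g t) <= M) -> cmod (cint `[a, b] g) <= M * (b - a).
Proof.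
move=> ab cg gM; apply: (@le_trans _ _ (\int[mu]_(x in `[a, b]) M)).
  apply: (cmod_cint_le _ (pcont_cintg cg)) => //.
    by apply: continuous_itv_integrable => t _; exact: cvg_cst.
rewrite Rintegral_cst //= lebesgue_measure_itv /= lte_fin.
case: ltP => [_|ba] //=.
have -> : b = a by apply/eqP; rewrite eq_le ba ab.
by rewrite subrr.
Qed.

End Paths.

(** * Goursat's theorem by bisection of rectangles *)

Section Goursat.
Variable R : realType.
Local Notation C := R[i].
Implicit Types (f g : C -> C) (z w : C) (a b c d : R).

(* The contour integral of [f] along the positively oriented boundary of
   [a, b] x [c, d]; opposite sides are grouped so that affine functions have
   constant integrands. *)
Definition bdry f a b c d : C :=
  cint `[a, b] (fun x => f (x +i* c) - f (x +i* d)) +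
  'i * cint `[c, d] (fun y => f (b +i* y) - f (a +i* y)).

Lemma horizontal_pcont f a b c d :
  (forall x, a <= x <= b -> ccont f (x +i* c) /\ ccont f (x +i* d)) ->
  forall x, a <= x <= b -> pcont (fun x => f (x +i* c) - f (x +i* d)) x.
Proof.
by move=> cf x /cf[c1 c2]; apply: pcontB; apply: pcont_horizontal.
Qed.

Lemma vertical_pcont f a b c d :
  (forall y, c <= y <= d -> ccont f (a +i* y) /\ ccont f (b +i* y)) ->
  forall y, c <= y <= d -> pcont (fun y => f (b +i* y) - f (a +i* y)) y.
Proof.
by move=> cf x /cf[c1 c2]; apply: pcontB; apply: pcont_vertical.
Qed.

Lemma bdry_splitx f a m b c d : a <= m <= b ->
  (forall x, a <= x <= b -> ccont f (x +i* c) /\ ccont f (x +i* d)) ->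
  (forall y, c <= y <= d ->
    [/\ ccont f (a +i* y), ccont f (m +i* y) & ccont f (b +i* y)]) ->
  bdry f a b c d = bdry f a m c d + bdry f m b c d.
Proof.
move=> amb ch cv; rewrite /bdry (cint_itv_split amb); last first.
  exact/pcont_cintg/horizontal_pcont.
rewrite [X in _ + 'i * X](_ : _ = cint `[c, d] (fun y => f (b +i* y) - f (m +i* y)) +
    cint `[c, d] (fun y => f (m +i* y) - f (a +i* y))); last first.
  rewrite -cintD //.
  - by apply: eq_cint => y _; ring.
  - by apply/pcont_cintg/vertical_pcont => y /cv[].
  - by apply/pcont_cintg/vertical_pcont => y /cv[].
ring.
Qed.

Lemma bdry_splity f a b c m d : c <= m <= d ->
  (forall y, c <= y <= d -> ccont f (a +i* y) /\ ccont f (b +i* y)) ->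
  (forall x, a <= x <= b ->
    [/\ ccont f (x +i* c), ccont f (x +i* m) & ccont f (x +i* d)]) ->
  bdry f a b c d = bdry f a b c m + bdry f a b m d.
Proof.
move=> cmd cv ch; rewrite /bdry (cint_itv_split cmd); last first.
  exact/pcont_cintg/vertical_pcont.
rewrite [X in X + _](_ : _ = cint `[a, b] (fun x => f (x +i* c) - f (x +i* m)) +
    cint `[a, b] (fun x => f (x +i* m) - f (x +i* d))); last first.
  rewrite -cintD //.
  - by apply: eq_cint => y _; ring.
  - by apply/pcont_cintg/horizontal_pcont => y /ch[].
  - by apply/pcont_cintg/horizontal_pcont => y /ch[].
ring.
Qed.

Definition ccont_on f a b c d :=
  forall x y, a <= x <= b -> c <= y <= d -> ccont f (x +i* y).

Definition ccont_bd f a b c d := forall x y, a <= x <= b -> c <= y <= d ->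
  x = a \/ x = b \/ y = c \/ y = d -> ccont f (x +i* y).

Lemma ccont_on_bd f a b c d : ccont_on f a b c d -> ccont_bd f a b c d.
Proof. by move=> cf x y hx hy _; apply: cf. Qed.

Lemma bdryD f g a b c d : a <= b -> c <= d ->
  ccont_bd f a b c d -> ccont_bd g a b c d ->
  bdry (fun z => f z + g z) a b c d = bdry f a b c d + bdry g a b c d.
Proof.
move=> ab cd cf cg.
have ch h : ccont_bd h a b c d ->
    cintg `[a, b] (fun x => h (x +i* c) - h (x +i* d)).
  move=> hh; apply/pcont_cintg/horizontal_pcont => x xab.
  by split; apply: hh; rewrite // ?lexx ?cd //; auto.
have cv h : ccont_bd h a b c d ->
    cintg `[c, d] (fun y => h (b +i* y) - h (a +i* y)).
  move=> hh; apply/pcont_cintg/vertical_pcont => y yab.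
  by split; apply: hh; rewrite // ?lexx ?ab //; auto.
rewrite /bdry -[X in X + _](_ : cint `[a, b] (fun x => f (x +i* c) - f (x +i* d)) +
    cint `[a, b] (fun x => g (x +i* c) - g (x +i* d)) = _); last first.
  by rewrite -cintD //; [apply: eq_cint => x _; ring|exact: ch|exact: ch].
rewrite -[X in _ + 'i * X](_ : cint `[c, d] (fun y => f (b +i* y) - f (a +i* y)) +
    cint `[c, d] (fun y => g (b +i* y) - g (a +i* y)) = _); last first.
  by rewrite -cintD //; [apply: eq_cint => x _; ring|exact: cv|exact: cv].
ring.
Qed.

Lemma bdryZ f k a b c d : a <= b -> c <= d -> ccont_bd f a b c d ->
  bdry (fun z => k * f z) a b c d = k * bdry f a b c d.
Proof.
move=> ab cd cf.
have ch : cintg `[a, b] (fun x => f (x +i* c) - f (x +i* d)).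
  apply/pcont_cintg/horizontal_pcont => x xab.
  by split; apply: cf; rewrite // ?lexx ?cd //; auto.
have cv : cintg `[c, d] (fun y => f (b +i* y) - f (a +i* y)).
  apply/pcont_cintg/vertical_pcont => y yab.
  by split; apply: cf; rewrite // ?lexx ?ab //; auto.
rewrite /bdry mulrDr (mulrCA k) -[k * cint `[a, b] _]cintZ // -[k * cint `[c, d] _]cintZ //.
by congr (_ + 'i * _); apply: eq_cint => x _; rewrite mulrBr.
Qed.

Lemma bdry_affine A B a b c d : a <= b -> c <= d ->
  bdry (fun z => A + B * z) a b c d = 0.
Proof.
move=> ab cd; rewrite /bdry.
rewrite [X in X + _](_ : _ = cint `[a, b] (fun=> B * ('i * (c - d)%:C))); last first.
  apply: eq_cint => x _; rewrite opprD addrACA subrr add0r -mulrBr; congr (_ * _).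
  by apply: complex_ext; rewrite !ReImE /=; ring.
rewrite [X in _ + 'i * X](_ : _ = cint `[c, d] (fun=> B * (b - a)%:C)); last first.
  apply: eq_cint => x _; rewrite opprD addrACA subrr add0r -mulrBr; congr (_ * _).
  by apply: complex_ext; rewrite !ReImE /=; ring.
rewrite !cint_itv_cst //.
by apply: complex_ext; rewrite !ReImE /=; ring.
Qed.

Lemma cmod_bdry_le f a b c d M : a <= b -> c <= d -> ccont_bd f a b c d ->
  (forall x y, a <= x <= b -> c <= y <= d ->
     x = a \/ x = b \/ y = c \/ y = d -> cmod (f (x +i* y)) <= M) ->
  cmod (bdry f a b c d) <= 2 * M * ((b - a) + (d - c)).
Proof.
move=> ab cd cf fM; rewrite mulrDr; apply: le_trans (cmodD _ _) _.
rewrite cmodM cmod_i mul1r; apply: lerD; apply: cmod_cint_itv_le => // t tt.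
- by apply: (horizontal_pcont _ tt) => x xab; split; apply: cf; rewrite // ?lexx ?cd //; auto.
- apply: le_trans (cmodB _ _) _.
  by rewrite mulr_natl mulr2n lerD // fM // ?lexx ?cd //; auto.
- by apply: (vertical_pcont _ tt) => x xab; split; apply: cf; rewrite // ?lexx ?ab //; auto.
- apply: le_trans (cmodB _ _) _.
  by rewrite mulr_natl mulr2n lerD // fM // ?lexx ?ab //; auto.
Qed.

Lemma eq_bdry f g a b c d : a <= b -> c <= d ->
  (forall x y, a <= x <= b -> c <= y <= d ->
     x = a \/ x = b \/ y = c \/ y = d -> f (x +i* y) = g (x +i* y)) ->
  bdry f a b c d = bdry g a b c d.
Proof.
move=> ab cd fg; rewrite /bdry; congr (_ + 'i * _); apply: eq_cint => t.
  rewrite inE /= in_itv /= => tab.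
  by rewrite !fg //; rewrite ?lexx ?cd //; auto.
rewrite inE /= in_itv /= => tab.
by rewrite !fg //; rewrite ?lexx ?ab //; auto.
Qed.

Definition holo_on f a b c d :=
  forall x y, a <= x <= b -> c <= y <= d -> exists k, cderiv f (x +i* y) k.

Lemma holo_on_cont f a b c d : holo_on f a b c d -> ccont_on f a b c d.
Proof. by move=> hf x y xab ycd; have [k] := hf x y xab ycd; apply: cderiv_cont. Qed.

Lemma bdry_local f (p : C) k e : cderiv f p k -> 0 < e ->
  exists2 r, 0 < r & forall a b c d, a <= b -> c <= d ->
    holo_on f a b c d -> a <= Re p <= b -> c <= Im p <= d ->
    (b - a) + (d - c) < r ->
    cmod (bdry f a b c d) <= e * ((b - a) + (d - c)) ^+ 2.
Proof.
move=> [q [cq qk hq]] e0; have [r r0 hr] := cq (e / 2) ltac:(lra).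
exists r => // a b c d ab cd hf pab pcd sr.
pose A := f p - p * q p; pose B := q p.
pose g := fun z => f z + (- A + - B * z).
have aff A' B' : ccont_on (fun z => A' + B' * z) a b c d.
  move=> x y _ _; apply: ccontD; first exact: ccont_cst.
  by apply: ccontM; [exact: ccont_cst|exact: ccont_id].
have cf := holo_on_cont hf.
have E : bdry f a b c d = bdry g a b c d.
  by rewrite /g bdryD ?bdry_affine ?addr0 //; apply: ccont_on_bd.
have gE z : g z = (z - p) * (q z - q p).
  by rewrite mulrBr -hq /g /A /B; ring.
set s := (b - a) + (d - c).
have s0 : 0 <= s by rewrite /s; lra.
have zp x y : a <= x <= b -> c <= y <= d -> cmod (x +i* y - p) <= s.
  move=> xab ycd; apply: le_trans (cmod_le _) _; rewrite !cReB !cImB /=.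
  by apply: lerD; rewrite ler_norml; lra.
rewrite E; apply: le_trans (cmod_bdry_le (M := e / 2 * s) ab cd _ _) _.
- by move=> x y xab ycd _; apply: ccontD; [exact: cf|exact: aff].
- move=> x y xab ycd _; rewrite gE cmodM mulrC.
  apply: ler_pM; rewrite ?cmod_ge0 //; last exact: zp.
  by apply/ltW/hr; apply: le_lt_trans sr; apply: zp.
- by rewrite -/s expr2; nra.
Qed.

Lemma nested_point (a b : nat -> R) :
  (forall n, a n <= a n.+1) -> (forall n, b n.+1 <= b n) -> (forall n, a n <= b n) ->
  exists p, forall n, a n <= p <= b n.
Proof.
move=> ha hb hab.
have am m n : (m <= n)%N -> a m <= a n.
  by move=> mn; rewrite -(subnK mn); elim: (n - m)%N => // k IH; apply: le_trans IH _; rewrite addSn.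
have bm m n : (m <= n)%N -> b n <= b m.
  by move=> mn; rewrite -(subnK mn); elim: (n - m)%N => // k; apply: le_trans; rewrite addSn.
have ab m n : a m <= b n.
  have [mn|/ltnW nm] := leqP m n; first exact: le_trans (am _ _ mn) (hab n).
  exact: le_trans (hab m) (bm _ _ nm).
exists (sup (range a)) => n; apply/andP; split.
  by apply: ub_le_sup; [exists (b 0%N) => _ [m _ <-]; exact: ab|exists n].
by apply: ge_sup; [exists (a 0%N); exists 0%N|move=> _ [m _ <-]; exact: ab].
Qed.

Lemma le_quarter (K t c1 c2 c3 c4 : R) : 4 * K <= t -> t <= c1 + c2 + (c3 + c4) ->
  [\/ K <= c1, K <= c2, K <= c3 | K <= c4].
Proof.
move=> h1 h2; have [|g1] := leP K c1; first by constructor 1.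
have [|g2] := leP K c2; first by constructor 2.
have [|g3] := leP K c3; first by constructor 3.
have [|g4] := leP K c4; first by constructor 4.
exfalso; lra.
Qed.

Lemma le_itv_trans (x a b c d : R) : a <= b -> c <= d -> b <= x <= c -> a <= x <= d.
Proof. by move=> ab cd /andP[bx xc]; rewrite (le_trans ab bx) (le_trans xc cd). Qed.

(** Each quarter has half the half-perimeter, so the square drops by 4; if every quarter missed the
    bound, the sum of the four integrals would miss it too. *)
Lemma bdry_quad f x1 x2 y1 y2 k : x1 < x2 -> y1 < y2 -> ccont_on f x1 x2 y1 y2 ->
  k * ((x2 - x1) + (y2 - y1)) ^+ 2 <= cmod (bdry f x1 x2 y1 y2) ->
  exists a b c d, [/\ [/\ x1 <= a, a < b & b <= x2], [/\ y1 <= c, c < d & d <= y2],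
    (b - a) + (d - c) = ((x2 - x1) + (y2 - y1)) / 2 &
    k * ((b - a) + (d - c)) ^+ 2 <= cmod (bdry f a b c d)].
Proof.
move=> xx yy cf hk; set xm := (x1 + x2) / 2; set ym := (y1 + y2) / 2.
have [m1 m2] : x1 < xm /\ xm < x2 by rewrite /xm; split; lra.
have [n1 n2] : y1 < ym /\ ym < y2 by rewrite /ym; split; lra.
have [M1 M2 M3] : [/\ x1 <= xm, xm <= x2 & x1 <= x2] by split; exact: ltW.
have [N1 N2 N3] : [/\ y1 <= ym, ym <= y2 & y1 <= y2] by split; exact: ltW.
have E : bdry f x1 x2 y1 y2 = bdry f x1 xm y1 ym + bdry f x1 xm ym y2
      + (bdry f xm x2 y1 ym + bdry f xm x2 ym y2).
  have inx u v x : x1 <= u -> v <= x2 -> u <= x <= v -> x1 <= x <= x2.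
    exact: le_itv_trans.
  have X1 : x1 <= x1 <= x2 by rewrite lexx.
  have X2 : x1 <= xm <= x2 by rewrite M1 M2.
  have X3 : x1 <= x2 <= x2 by rewrite lexx M3.
  have Y1 : y1 <= y1 <= y2 by rewrite lexx.
  have Y2 : y1 <= ym <= y2 by rewrite N1 N2.
  have Y3 : y1 <= y2 <= y2 by rewrite lexx N3.
  rewrite (@bdry_splitx _ x1 xm) //; last 2 first.
  - by move=> x hx; split; apply: cf.
  - by move=> y hy; split; apply: cf.
  rewrite (@bdry_splity _ x1 xm y1 ym) //; last 2 first.
  - by move=> y hy; split; apply: cf.
  - by move=> x /(inx _ _ _ (lexx _) M2) hx; split; apply: cf.
  rewrite (@bdry_splity _ xm x2 y1 ym) //.
  - by move=> y hy; split; apply: cf.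
  - by move=> x /(inx _ _ _ M1 (lexx _)) hx; split; apply: cf.
set s := (x2 - x1) + (y2 - y1) in hk *.
pose K := k * (s / 2) ^+ 2.
have hK : 4 * K <= cmod (bdry f x1 x2 y1 y2).
  by apply: le_trans hk; rewrite /K le_eqVlt; apply/orP; left; apply/eqP; field.
have e1 : (xm - x1) + (ym - y1) = s / 2 by rewrite /s /xm /ym; field.
have e2 : (xm - x1) + (y2 - ym) = s / 2 by rewrite /s /xm /ym; field.
have e3 : (x2 - xm) + (ym - y1) = s / 2 by rewrite /s /xm /ym; field.
have e4 : (x2 - xm) + (y2 - ym) = s / 2 by rewrite /s /xm /ym; field.
have le4 : cmod (bdry f x1 x2 y1 y2) <=
    cmod (bdry f x1 xm y1 ym) + cmod (bdry f x1 xm ym y2)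
      + (cmod (bdry f xm x2 y1 ym) + cmod (bdry f xm x2 ym y2)).
  by rewrite E; apply: le_trans (cmodD _ _) _; apply: lerD; exact: cmodD.
have [h|h|h|h] := le_quarter hK le4.
- by exists x1, xm, y1, ym; rewrite e1; split => //; split => //.
- by exists x1, xm, ym, y2; rewrite e2; split => //; split => //.
- by exists xm, x2, y1, ym; rewrite e3; split => //; split => //.
- by exists xm, x2, ym, y2; rewrite e4; split => //; split => //.
Qed.

Record rect := Rect { r1 : R; r2 : R; r3 : R; r4 : R }.

Lemma goursat f a b c d : a < b -> c < d -> holo_on f a b c d ->
  bdry f a b c d = 0.
Proof.
move=> ab cd hf; apply/eqP; rewrite -cmod_eq0 eq_le cmod_ge0 andbT leNgt.
apply/negP => I0.
pose sz (q : rect) := (r2 q - r1 q) + (r4 q - r3 q).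
pose I q := bdry f (r1 q) (r2 q) (r3 q) (r4 q).
pose q0 := Rect a b c d.
have sz0 : 0 < sz q0 by rewrite /sz /=; lra.
(* The ratio of the integral to the squared half-perimeter never drops below [k] along the
   bisection, against [bdry_local] applied with [k / 2] at the common point. *)
pose k := cmod (I q0) / sz q0 ^+ 2.
have k0 : 0 < k by rewrite divr_gt0 ?exprn_gt0.
pose P q := [/\ a <= r1 q, r1 q < r2 q & r2 q <= b] /\
            [/\ c <= r3 q, r3 q < r4 q & r4 q <= d] /\
            k * sz q ^+ 2 <= cmod (I q).
(* Stated as an implication so that the choice function is defined on all rectangles; only its
   iterates from [q0], which satisfy [P], are used. *)
pose S q q' := P q -> [/\ P q', sz q' = sz q / 2,
   r1 q <= r1 q', r2 q' <= r2 q & r3 q <= r3 q' /\ r4 q' <= r4 q].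
have /choice [st stP] : forall q, exists q', S q q'.
  move=> q; case: (pselect (P q)) => [Pq|nP]; last by exists q.
  have [[h1 h2 h3] [[h4 h5 h6] h7]] := Pq.
  have cf : ccont_on f (r1 q) (r2 q) (r3 q) (r4 q).
    by move=> x y hx hy; apply: (holo_on_cont hf); [apply: le_itv_trans hx|apply: le_itv_trans hy].
  have [x1 [x2 [y1 [y2 [[i1 i2 i3] [j1 j2 j3] es hs]]]]] := bdry_quad h2 h5 cf h7.
  exists (Rect x1 x2 y1 y2) => _; split => //=; split; first split => //=.
  - exact: le_trans i1.
  - exact: le_trans h3.
  - by split => //; split => //=; [exact: le_trans j1|exact: le_trans h6].
pose Q n := iter n st q0.
have PQ n : P (Q n).
  elim: n => [|n IH]; last by have [] := stP _ IH.
  split; first by split => //=; rewrite lexx.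
  split; first by split => //=; rewrite lexx.
  by rewrite /k divfK // expf_neq0 // gt_eqF.
have QS n := stP _ (PQ n).
have szQ n : sz (Q n) = sz q0 / 2 ^+ n.
  elim: n => [|n IH]; first by rewrite expr0 divr1.
  by have [_ -> _ _ _] := QS n; rewrite IH exprS invfM; ring.
have [px hpx] : exists p, forall n, r1 (Q n) <= p <= r2 (Q n).
  apply: nested_point => n; [by have [] := QS n|by have [] := QS n|].
  by have [[_ /ltW]] := PQ n.
have [py hpy] : exists p, forall n, r3 (Q n) <= p <= r4 (Q n).
  apply: nested_point => n; [by have [_ _ _ _ []] := QS n|by have [_ _ _ _ []] := QS n|].
  by have [_ [[_ /ltW]]] := PQ n.
have [k1 hk1] := hf px py (hpx 0%N) (hpy 0%N).
have [r r0 hr] := bdry_local hk1 (e := k / 2) ltac:(lra).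
have [n hn] : exists n, sz (Q n) < r.
  exists (Num.bound (sz q0 / r)); rewrite szQ ltr_pdivrMr ?exprn_gt0 //.
  by rewrite mulrC -ltr_pdivrMr // upper_nthrootP.
have [[h1 h2 h3] [[h4 h5 h6] h7]] := PQ n.
have hfQ : holo_on f (r1 (Q n)) (r2 (Q n)) (r3 (Q n)) (r4 (Q n)).
  by move=> x y hx hy; apply: hf; [apply: le_itv_trans hx|apply: le_itv_trans hy].
have sq : 0 < sz (Q n) by rewrite addr_gt0 ?subr_gt0.
have := hr _ _ _ _ (ltW h2) (ltW h5) hfQ (hpx n) (hpy n) hn.
rewrite -/(sz (Q n)) -/(I (Q n)) => hh.
have : 0 < k * sz (Q n) ^+ 2 by rewrite mulr_gt0 ?exprn_gt0.
by rewrite mulrAC in hh; move: (k * _) hh h7 => u hh h7 u0; clear -hh h7 u0; lra.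
Qed.

End Goursat.

(** * Removable points and Cauchy's formula on rectangles *)

Section Cauchy.
Variable R : realType.
Local Notation C := R[i].
Implicit Types (f g : C -> C) (z w : C) (a b c d : R).

(** Cutting along the sides of the small square around [w] splits off four rectangles that avoid
    [w], and Goursat's theorem kills each of them. *)
Lemma bdry_shrink q w a b c d e : 0 < e ->
  a < Re w - e -> Re w + e < b -> c < Im w - e -> Im w + e < d ->
  ccont_on q a b c d ->
  (forall x y, a <= x <= b -> c <= y <= d -> x +i* y != w ->
    exists k, cderiv q (x +i* y) k) ->
  bdry q a b c d = bdry q (Re w - e) (Re w + e) (Im w - e) (Im w + e).
Proof.
case: w => u v /= e0 au ub cv vd cq hq.
have [a1 a2] : a < u /\ u < b by split; lra.
have [c1 c2] : c < v /\ v < d by split; lra.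
have cq' x y : a <= x <= b -> c <= y <= d -> ccont q (x +i* y) by exact: cq.
have zero a' b' c' d' : a' < b' -> c' < d' -> a <= a' -> b' <= b -> c <= c' -> d' <= d ->
    [\/ b' < u, u < a', d' < v | v < c'] -> bdry q a' b' c' d' = 0.
  move=> ab cd h1 h2 h3 h4 out; apply: goursat => // x y hx hy.
  apply: hq; [exact: le_itv_trans hx|exact: le_itv_trans hy|].
  apply/eqP => -[xu yv]; move: hx hy out; rewrite xu yv => /andP[k1 k2] /andP[k3 k4].
  by rewrite !ltNge k1 k2 k3 k4; case.
have z1 : bdry q a (u - e) c d = 0 by apply: zero; rewrite ?lexx //; try lra; constructor 1; lra.
have z2 : bdry q (u + e) b c d = 0 by apply: zero; rewrite ?lexx //; try lra; constructor 2; lra.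
have z3 : bdry q (u - e) (u + e) c (v - e) = 0.
  by apply: zero; rewrite ?lexx //; try lra; constructor 3; lra.
have z4 : bdry q (u - e) (u + e) (v + e) d = 0.
  by apply: zero; rewrite ?lexx //; try lra; constructor 4; lra.
rewrite (@bdry_splitx _ _ a (u - e)); last 3 first.
- by apply/andP; split; lra.
- by move=> x hx; split; apply: cq' => //; apply/andP; split; lra.
- by move=> y hy; split; apply: cq' => //; apply/andP; split; lra.
rewrite z1 add0r (@bdry_splitx _ _ (u - e) (u + e)); last 3 first.
- by apply/andP; split; lra.
- by move=> x hx; split; apply: cq' => //; apply/andP; split; lra.
- by move=> y hy; split; apply: cq' => //; apply/andP; split; lra.
rewrite z2 addr0 (@bdry_splity _ _ _ _ c (v - e)); last 3 first.
- by apply/andP; split; lra.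
- by move=> x hx; split; apply: cq' => //; apply/andP; split; lra.
- by move=> y hy; split; apply: cq' => //; apply/andP; split; lra.
rewrite z3 add0r (@bdry_splity _ _ _ _ (v - e) (v + e)); last 3 first.
- by apply/andP; split; lra.
- by move=> x hx; split; apply: cq' => //; apply/andP; split; lra.
- by move=> y hy; split; apply: cq' => //; apply/andP; split; lra.
by rewrite z4 addr0.
Qed.

Lemma removable_goursat q w a b c d :
  a < Re w < b -> c < Im w < d -> ccont_on q a b c d ->
  (forall x y, a <= x <= b -> c <= y <= d -> x +i* y != w ->
    exists k, cderiv q (x +i* y) k) ->
  bdry q a b c d = 0.
Proof.
move=> /andP[aw wb] /andP[cw wd] cq hq.
have cqw : ccont q w by case: w aw wb cw wd hq => u v /= *; apply: cq; apply/andP; split; apply: ltW.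
have [r r0 hr] := ccont_bounded cqw.
set M := cmod (q w) + 1 in hr.
have M0 : 0 < M by rewrite ltr_wpDl ?cmod_ge0.
pose m := Num.min (Num.min (Re w - a) (b - Re w)) (Num.min (Num.min (Im w - c) (d - Im w)) r).
have m0 : 0 < m by rewrite !lt_min !subr_gt0 aw wb cw wd r0.
apply/eqP; rewrite -cmod_eq0 eq_le cmod_ge0 andbT; apply/ler_addgt0Pr => t t0.
(* [m / 3] keeps the square inside the rectangle and inside the disc where |q| is at most [M]; its
   boundary integral is then at most [8 * M * e]. *)
rewrite add0r; pose e := Num.min (m / 3) (t / (8 * M)).
have e0 : 0 < e by rewrite lt_min !divr_gt0 // mulr_gt0.
have [em et] : e <= m / 3 /\ e <= t / (8 * M).
  by split; rewrite ge_min lexx ?orbT.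
have em' : e < m by lra.
move: (em'); rewrite !lt_min => /andP[/andP[i1 i2] /andP[/andP[i3 i4] i5]].
rewrite (@bdry_shrink q w a b c d e) //; try lra.
apply: le_trans (cmod_bdry_le (M := M) _ _ _ _) _; try lra.
- by move=> x y hx hy _; apply: cq; lra.
- move=> x y hx hy _; apply: hr; apply: le_lt_trans (cmod_le _) _.
  rewrite cReB cImB /=.
  have h1 : `|x - Re w| <= e by rewrite ler_norml; lra.
  have h2 : `|y - Im w| <= e by rewrite ler_norml; lra.
  have : m <= r by rewrite !ge_min lexx !orbT.
  lra.
- have : e * (8 * M) <= t by rewrite -ler_pdivlMr ?mulr_gt0.
  nra.
Qed.

Lemma div_quotient f w k : cderiv f w k -> f w = 0 ->
  exists q, [/\ ccont q w, q w = k & forall z, z != w -> f z / (z - w) = q z].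
Proof.
move=> [q [cq qk hq]] fw; exists q; split=> // z zw.
have := hq z; rewrite fw subr0 => ->; rewrite mulrAC divff ?mul1r //.
by rewrite subr_eq0.
Qed.

Lemma cauchy_goursat f w a b c d :
  a < Re w < b -> c < Im w < d -> holo_on f a b c d -> f w = 0 ->
  bdry (fun z => f z / (z - w)) a b c d = 0.
Proof.
move=> aw cw hf fw.
have [k hk] : exists k, cderiv f w k.
  by case: w aw cw {fw} => u v /= /andP[? ?] /andP[? ?]; apply: hf; apply/andP; split; apply: ltW.
have [q [cq _ hq]] := div_quotient hk fw.
have [ab cd] : a <= b /\ c <= d by split; lra.
have dq x y : a <= x <= b -> c <= y <= d -> x +i* y != w -> exists k, cderiv q (x +i* y) k.
  move=> hx hy zw; have [k1 hk1] := hf x y hx hy.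
  have zw' : x +i* y - w != 0 by rewrite subr_eq0.
  have dz : cderiv (fun z => z - w) (x +i* y) (1 - 0).
    by apply: cderivB; [exact: cderiv_id|exact: cderiv_cst].
  eexists; apply: (cderiv_near (r := cmod (x +i* y - w)) _ _ (cderiv_div hk1 dz zw')).
    by rewrite cmod_gt0.
  move=> z zr; apply: hq; apply: contraTneq zr => ->.
  by rewrite cmodBC ltxx.
rewrite (@eq_bdry _ _ q) //.
  apply: (removable_goursat aw cw) => // x y hx hy.
  have [<-//|zw] := eqVneq w (x +i* y).
  by rewrite eq_sym in zw; have [k1 /cderiv_cont] := dq x y hx hy zw.
move=> x y hx hy on; apply: hq; apply/eqP => E.
by move: aw cw; rewrite -E /=; case: on => [->|[->|[->|->]]]; rewrite ltxx ?andbF.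
Qed.

Lemma ccont_kernel w z : z != w -> ccont (fun z => (z - w)^-1) z.
Proof.
move=> zw; apply: ccontV; last by rewrite subr_eq0.
by apply: ccontB; [exact: ccont_id|exact: ccont_cst].
Qed.

(** The integral of the kernel on the right is never evaluated; the lower bound [Im_bdry_kernel_ge]
    is enough for the Liouville theorem. *)
Lemma cauchy_formula f w a b c d :
  a < Re w < b -> c < Im w < d -> holo_on f a b c d ->
  bdry (fun z => f z / (z - w)) a b c d =
  f w * bdry (fun z => (z - w)^-1) a b c d.
Proof.
move=> aw cw hf.
have [ab cd] : a <= b /\ c <= d by split; lra.
have cK : ccont_bd (fun z => (z - w)^-1) a b c d.
  move=> x y hx hy on; apply: ccont_kernel; apply/eqP => E.
  by move: aw cw; rewrite -E /=; case: on => [->|[->|[->|->]]]; rewrite ltxx ?andbF.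
rewrite -bdryZ //.
have -> : bdry (fun z => f z / (z - w)) a b c d =
    bdry (fun z => (f z - f w) / (z - w) + f w / (z - w)) a b c d.
  by apply: eq_bdry => // x y _ _ _; rewrite -mulrDl subrK.
rewrite bdryD //.
- rewrite [X in X + _](cauchy_goursat (f := fun z => f z - f w)) ?add0r ?subrr //.
  move=> x y hx hy; have [k hk] := hf x y hx hy.
  by exists (k - 0); apply: cderivB => //; exact: cderiv_cst.
- move=> x y hx hy on; apply: ccontM; last exact: cK.
  by apply: ccontB; [exact: (holo_on_cont hf)|exact: ccont_cst].
- by move=> x y hx hy on; apply: ccontM; [exact: ccont_cst|exact: cK].
Qed.

End Cauchy.

(** * Measurability, Fatou, Tonelli and the Poisson kernel on the line *)

Section MeasureTools.
Variable R : realType.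
Local Notation mu := (@lebesgue_measure R).

(** Rounding the first variable down to a multiple of [1 / (n + 1)] gives a function that is
    measurable on each of countably many strips; continuity in that variable makes these functions
    converge to [f]. *)
Lemma separately_measurable (f : R -> R -> R) :
  (forall y, continuous (fun x => f x y)) ->
  (forall x, measurable_fun setT (f x)) ->
  measurable_fun setT (fun p : R * R => f p.1 p.2).
Proof.
move=> cf mf.
pose fl (n : nat) (x : R) : R := (Num.floor (x * n.+1%:R))%:~R / n.+1%:R.
apply: (@measurable_fun_cvg _ _ _ _ (fun n (p : R * R) => f (fl n p.1) p.2)).
- move=> n _ B mB; rewrite setTI.
  have -> : (fun p : R * R => f (fl n p.1) p.2) @^-1` B =
     \bigcup_(z in [set: int])
       (((fun x : R => Num.floor (x * n.+1%:R)) @^-1` [set z]) `*`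
        (f (z%:~R / n.+1%:R) @^-1` B)).
    apply/seteqP; split=> [[x y] /= fB|[x y] /= [z _ [/= zx fB]]].
      by exists (Num.floor (x * n.+1%:R)).
    by rewrite /fl zx.
  apply: countable_bigcupT_measurable; first exact: countableP.
  move=> z; apply: measurableX; last by rewrite -[X in measurable X]setTI; exact: mf.
  have -> : (fun x : R => Num.floor (x * n.+1%:R)) @^-1` [set z] =
      (`[z%:~R / n.+1%:R, (z + 1)%:~R / n.+1%:R[%classic : set R).
    apply/seteqP; split=> x /=; rewrite in_itv /= ler_pdivrMr // ltr_pdivlMr //.
      by move=> <-; exact: floor_itv.
    by move=> /floor_def.
  exact: measurable_itv.
- move=> [x y] _ /=.
  have flx : fl ^~ x @ \oo --> (x : R).
    apply/cvgrPdist_lt => e e0; near=> n.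
    have n0 : 0 < n.+1%:R :> R by [].
    have := floor_itv (x * n.+1%:R); rewrite -/(fl n x) intrD.
    have -> : (Num.floor (x * n.+1%:R))%:~R = fl n x * n.+1%:R :> R.
      by rewrite /fl divfK // gt_eqF.
    move=> /andP[h1 h2].
    have h3 : n.+1%:R^-1 < e by near: n; exact: near_infty_natSinv_lt (PosNum e0).
    have h4 : 1 < e * n.+1%:R by rewrite -ltr_pdivrMr // mul1r.
    rewrite ger0_norm; last by rewrite subr_ge0 -(ler_pM2r n0).
    by rewrite -(ltr_pM2r n0) mulrBl; lra.
  exact: (continuous_cvg _ (@cf y x) flx).
Unshelve. all: by end_near. Qed.

Lemma fatou_le (h : nat -> R -> R) (g : R -> R) (M : \bar R) :
  (forall n, measurable_fun setT (h n)) -> (forall n x, 0 <= h n x) ->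
  (forall x, h ^~ x @ \oo --> g x) ->
  (forall n, \int[mu]_(x in setT) (h n x)%:E <= M)%E ->
  (\int[mu]_(x in setT) (g x)%:E <= M)%E.
Proof.
move=> mh h0 hg hM.
pose H n (x : R) := (h n x)%:E.
have mH n : measurable_fun setT (H n) by apply/measurable_EFinP; exact: mh.
have H0 n x : setT x -> (0 <= H n x)%E by move=> _; rewrite lee_fin.
have -> : (\int[mu]_(x in setT) (g x)%:E = \int[mu]_(x in setT) limn_einf (H^~ x))%E.
  apply: eq_integral => x _; have [-> //] : (limn_einf (H^~ x) = (g x)%:E) * (limn_esup (H^~ x) = (g x)%:E).
  by apply: cvg_limn_einf_sup; apply: cvg_EFin; [exact: nearW|exact: hg].
apply: le_trans (fatou mu measurableT mH H0) _.
rewrite limn_einf_lim; apply: lime_le; first exact: is_cvg_einfs.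
apply: nearW => n; apply: le_trans (hM n); apply: ereal_inf_lbound.
by exists n => //=.
Qed.

(** If [h] stayed above [e] on an interval longer than |M| / e, its integral would exceed [M]. *)
Lemma exists_small (h : R -> R) (M e X : R) : measurable_fun setT h ->
  (forall x, 0 <= h x) ->
  (\int[mu]_(x in setT) (h x)%:E <= M%:E)%E -> 0 < e ->
  exists2 x, X < x & h x < e.
Proof.
move=> mh h0 hM e0; apply: contrapT => no.
have he x : X < x -> e <= h x.
  by move=> Xx; rewrite leNgt; apply/negP => hx; apply: no; exists x.
pose n := (Num.bound (`|M| / e)).+1.
have : (\int[mu]_(x in `]X, (X + n%:R)%R]) e%:E <= M%:E)%E.
  apply: le_trans hM; apply: (@le_trans _ _ (\int[mu]_(x in `]X, (X + n%:R)%R]) (h x)%:E)%E).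
    apply: ge0_le_integral => //.
    - by move=> x _; rewrite lee_fin ltW.
    - by apply/measurable_EFinP; apply: measurable_funS mh.
    - by move=> x; rewrite /= in_itv /= lee_fin => /andP[/he].
  apply: ge0_subset_integral => //.
  - by apply/measurable_EFinP.
  - by move=> x _; rewrite lee_fin.
rewrite integral_cst //= lebesgue_measure_itv /= lte_fin ltrDl ltr0n /=.
rewrite -EFinD -EFinM lee_fin addrAC subrr add0r.
have : `|M| / e < n%:R.
  apply: lt_le_trans (archi_boundP _) _; first by rewrite divr_ge0 // ltW.
  by rewrite ler_nat /n.
rewrite ltr_pdivrMr // => h1 h2.
by have := ler_norm M; rewrite mulrC in h2; lra.
Qed.

Lemma exists_smallN (h : R -> R) (M e X : R) : measurable_fun setT h ->
  (forall x, 0 <= h x) ->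
  (\int[mu]_(x in setT) (h x)%:E <= M%:E)%E -> 0 < e ->
  exists2 x, x < X & h x < e.
Proof.
move=> mh h0 hM e0; apply: contrapT => no.
have he x : x < X -> e <= h x.
  by move=> Xx; rewrite leNgt; apply/negP => hx; apply: no; exists x.
pose n := (Num.bound (`|M| / e)).+1.
have : (\int[mu]_(x in `[(X - n%:R)%R, X[) e%:E <= M%:E)%E.
  apply: le_trans hM; apply: (@le_trans _ _ (\int[mu]_(x in `[(X - n%:R)%R, X[) (h x)%:E)%E).
    apply: ge0_le_integral => //.
    - by move=> x _; rewrite lee_fin ltW.
    - by apply/measurable_EFinP; apply: measurable_funS mh.
    - by move=> x; rewrite /= in_itv /= lee_fin => /andP[_ /he].
  apply: ge0_subset_integral => //.
  - by apply/measurable_EFinP.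
  - by move=> x _; rewrite lee_fin.
rewrite integral_cst //= lebesgue_measure_itv /= lte_fin ltrBlDr ltrDl ltr0n /=.
rewrite -EFinD -EFinM lee_fin opprB addrC subrK.
have : `|M| / e < n%:R.
  apply: lt_le_trans (archi_boundP _) _; first by rewrite divr_ge0 // ltW.
  by rewrite ler_nat /n.
rewrite ltr_pdivrMr // => h1 h2.
by have := ler_norm M; rewrite mulrC in h2; lra.
Qed.

(** Supplies good vertical sides for contours: the integral of [k x] over [[0, Y]], as a function of
    [x], has finite total mass, hence by [exists_small] is small for some [x] beyond any bound. *)
Lemma tonelli_strip (k : R -> R -> R) (Y M : R) : 0 <= Y ->
  (forall x y, 0 <= k x y) ->
  (forall x y, 0 <= y <= Y -> {for x, continuous (k ^~ y)}) ->
  (forall x y, 0 <= y <= Y -> {for y, continuous (k x)}) ->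
  (forall y, 0 <= y <= Y -> (\int[mu]_(x in setT) (k x y)%:E <= M%:E)%E) ->
  let h x := \int[mu]_(y in `[0, Y]) k x y in
  measurable_fun setT h /\ (\int[mu]_(x in setT) (h x)%:E <= (M * Y)%:E)%E.
Proof.
move=> Y0 k0 c1 c2 hM h.
(* Extended by 0 in [y] outside [[0, Y]], the function stays continuous in [x] for each [y], as
   [separately_measurable] requires. *)
pose g (p : R * R) := (k p.1 \_ `[0, Y]) p.2.
have gE x y : g (x, y) = if (0 <= y <= Y) then k x y else 0.
  by rewrite /g /patch mem_setE /= in_itv.
have intg x : mu.-integrable `[0, Y] (EFin \o k x).
  by apply: continuous_itv_integrable => y; exact: c2.
have mg : measurable_fun setT g.
  apply: (separately_measurable (f := fun x => k x \_ `[0, Y])) => [y|x].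
    have [yY|yY] := boolP (0 <= y <= Y).
      have -> : (fun x => (k x \_ `[0, Y]) y) = k ^~ y.
        by apply/funext => x; have := gE x y; rewrite yY.
      by move=> x; apply: c1.
    have -> : (fun x => (k x \_ `[0, Y]) y) = cst 0.
      by apply/funext => x; have := gE x y; rewrite (negbTE yY).
    exact: cst_continuous.
  apply/(measurable_restrictT _ _).1 => //.
  by have /measurable_EFinP := measurable_int mu (intg x).
have mG : @measurable_fun _ _ (measurableTypeR R * measurableTypeR R)%type (\bar R) setT
    (EFin \o g).
  by apply/measurable_EFinP; exact: mg.
have g0 p : (0 <= (EFin \o g) p)%E.
  by case: p => x y; rewrite /= lee_fin gE; case: ifP.
have hE x : (h x)%:E = (\int[mu]_(y in setT) (EFin \o g) (x, y))%E.
  rewrite /h /Rintegral fineK; last by apply: (integrable_fin_num _ (intg x)).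
  rewrite integral_mkcond; apply: eq_integral => y _.
  by rewrite /= gE /patch mem_setE /= in_itv; case: ifP.
split.
  apply/measurable_EFinP; rewrite /comp; under eq_fun do rewrite hE.
  exact: (@measurable_fun_fubini_tonelli_F _ _ (measurableTypeR R) (measurableTypeR R) R mu _ mG g0).
under eq_integral do rewrite hE.
rewrite (@fubini_tonelli _ _ (measurableTypeR R) (measurableTypeR R) R mu mu _ mG g0).
have -> : (M * Y)%:E = (\int[mu]_(y in `[0%R, Y]) (M)%:E)%E.
  rewrite integral_cst //= lebesgue_measure_itv /= lte_fin.
  case: ltgtP Y0 => // [_ _|<- _]; first by rewrite -EFinD subr0.
  by rewrite mulr0 mule0.
have M0 : 0 <= M.
  have h1 := hM 0; rewrite lexx Y0 in h1; have {}h1 := h1 isT.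
  rewrite -lee_fin; apply: le_trans h1; apply: integral_ge0 => x _.
  by rewrite lee_fin.
rewrite [leRHS]integral_mkcond; apply: ge0_le_integral => //.
- by move=> y _; apply: integral_ge0 => x _; exact: g0.
- exact: (@measurable_fun_fubini_tonelli_G _ _ (measurableTypeR R) (measurableTypeR R) R mu _ mG g0).
- by apply/(measurable_restrictT _ _).1 => //; exact: measurable_cst.
- move=> y _; rewrite /patch mem_setE /= in_itv /=; case: ifPn => yY.
    by under eq_integral do rewrite gE yY; exact: hM.
  by under eq_integral do rewrite gE (negbTE yY); rewrite integral0.
Qed.

(** The two ends move independently. Failure for every [X] would give a sequence of intervals
    exhausting the line along which the integrals stay away from the limit, against dominated
    convergence. *)
Lemma Rintegral_tail (f : R -> R) (e : R) : mu.-integrable setT (EFin \o f) ->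
  0 < e -> exists X : R, forall a b, a < - X -> X < b ->
  `| \int[mu]_(x in `[a, b]) f x - \int[mu]_(x in setT) f x | < e.
Proof.
move=> intf e0; apply: contrapT => no.
have /choice [ab abP] : forall n : nat, exists ab : R * R,
   [/\ ab.1 < - n%:R, n%:R < ab.2 &
     e <= `| \int[mu]_(x in `[ab.1, ab.2]) f x - \int[mu]_(x in setT) f x |].
  move=> n; apply: contrapT => nn; apply: no; exists n%:R => a b an bn.
  rewrite ltNge; apply/negP => ee; apply: nn; by exists (a, b).
pose F n (x : R) := (f x * (\1_(`[(ab n).1, (ab n).2]%classic : set R) x))%:E.
have mf : measurable_fun setT f by apply/measurable_EFinP; exact: measurable_int intf.
have mF n : measurable_fun setT (F n).
  apply/measurable_EFinP; apply: measurable_funM => //.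
have FE n : (\int[mu]_(x in setT) F n x = \int[mu]_(x in `[(ab n).1, (ab n).2]) (f x)%:E)%E.
  rewrite [RHS]integral_mkcond; apply: eq_integral => x _.
  by rewrite /F /patch indicE; case: ifP => _; rewrite ?mulr1 ?mulr0.
have cF x : setT x -> F ^~ x @ \oo --> (f x)%:E.
  move=> _; apply: cvg_near_cst; near=> n; rewrite /F /= indicE mem_setE in_itv /=.
  have xn : `|x| < n%:R by near: n; exact: nbhs_infty_gtr.
  have [h1 h2 _] := abP n; move: xn; rewrite ltr_norml => /andP[x1 x2].
  by rewrite (ltW (lt_trans h1 x1)) (ltW (lt_trans x2 h2)) mulr1.
have dF n x : setT x -> (`|F n x| <= (EFin \o (Num.norm \o f)) x)%E.
  move=> _; rewrite /F /= lee_fin normrM ler_piMr // indicE.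
  by case: (_ \in _); rewrite ?normr1 ?normr0.
have inf : mu.-integrable setT (EFin \o (Num.norm \o f)) by exact: integrable_norm.
have fing x : setT x -> (EFin \o (Num.norm \o f)) x \is a fin_num by [].
have := @dominated_cvg _ (measurableTypeR R) R mu setT measurableT F _ _ mF cF fing inf dF.
rewrite -(fineK (integrable_fin_num measurableT intf)) => /fine_cvg /cvgrPdist_lt /(_ _ e0) hn.
near \oo => n.
have : `|fine (\int[mu]_(x in setT) (EFin \o f) x) - fine (\int[mu]_(x in setT) F n x)| < e.
  by near: n; exact: hn.
have [_ _] := abP n; rewrite FE distrC => h1 h2.
by have := le_lt_trans h1 h2; rewrite ltxx.
Unshelve. all: by end_near. Qed.

(** This is [pi] times the Poisson kernel of the upper half-plane at the point [u + i s]. *)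
Definition cauchy_kernel (s u t : R) : R := s / ((t - u) ^+ 2 + s ^+ 2).

Lemma cauchy_kernel_gt0 s u t : 0 < s -> 0 < cauchy_kernel s u t.
Proof. by move=> s0; rewrite divr_gt0 // ltr_wpDl ?sqr_ge0 ?exprn_gt0. Qed.

Lemma continuous_cauchy_kernel s u : 0 < s -> continuous (cauchy_kernel s u).
Proof.
move=> s0 t; apply: cvgM; first exact: cvg_cst.
apply: cvgV; first by rewrite gt_eqF // ltr_wpDl ?sqr_ge0 ?exprn_gt0.
apply: cvgD; last exact: cvg_cst.
rewrite expr2; under eq_fun do rewrite expr2.
by apply: cvgM; apply: cvgB => //; exact: cvg_cst.
Qed.

Lemma integral_oneDsqr : (\int[mu]_(x in setT) (oneDsqr x)^-1%:E = pi%:E)%E.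
Proof.
rewrite ge0_symfun_integralT.
- rewrite -set_itvcy integral0y_oneDsqr -EFinM; congr EFin; by field.
- by move=> x; rewrite invr_ge0 (le_trans ler01) // oneDsqr_ge1.
- exact: continuous_oneDsqrV.
- by move=> x; rewrite /= /oneDsqr sqrrN.
Qed.

Lemma integral_cauchy_kernel s u : 0 < s ->
  (\int[mu]_(x in setT) (cauchy_kernel s u x)%:E = pi%:E)%E.
Proof.
move=> s0; pose F x : R := (x - u) / s.
have dF (x : R) : is_derive x 1 F s^-1.
  rewrite /F; apply: is_derive_eq; rewrite ?scaler0 ?add0r ?subr0 ?addr0; first by rewrite /GRing.scale /= mulr1.
have F' : derive1 F = cst s^-1.
  by apply/funext => x; rewrite derive1E derive_val.
rewrite -integral_oneDsqr.
rewrite (@increasing_ge0_integration_by_substitutionT _ F (fun x => (oneDsqr x)^-1)).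
- apply: eq_integral => x _; congr EFin; rewrite F' /cauchy_kernel /F /oneDsqr.
  change (s / ((x - u) ^+ 2 + s ^+ 2) = (1 + ((x - u) / s) ^+ 2)^-1 * s^-1).
  have d0 : (x - u) ^+ 2 + s ^+ 2 != 0 by rewrite gt_eqF // ltr_wpDl ?sqr_ge0 ?exprn_gt0.
  by field; rewrite gt_eqF // addrC d0.
- by move=> x y xy; rewrite /F ltr_pM2r ?invr_gt0 // ltrD2r.
- by rewrite F'; exact: cst_continuous.
- by rewrite F'; exact: is_cvg_cst.
- by rewrite F'; exact: is_cvg_cst.
- by move=> x; have [] := dF x.
- apply/cvgrNyPle => A; near=> x; rewrite /F ler_pdivrMr // lerBlDr.
  by near: x; apply: nbhs_ninfty_le; rewrite num_real.
- apply/cvgryPge => A; near=> x; rewrite /F ler_pdivlMr // lerBrDr.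
  by near: x; apply: nbhs_pinfty_ge; rewrite num_real.
- exact: continuous_oneDsqrV.
- by move=> x; rewrite invr_ge0 (le_trans ler01) // oneDsqr_ge1.
Unshelve. all: by end_near. Qed.

End MeasureTools.

(** * The Hardy space of the upper half-plane *)

Section HardySpace.
Variable R : realType.
Local Notation C := R[i].
Local Notation mu := (@lebesgue_measure R).
Implicit Types (F G q : C -> C) (z w p : C).

(* Holomorphy is required up to the real axis, so that boundary values are plain
   restrictions. *)
Definition hardy F (M : R) :=
  (forall z, 0 <= Im z -> exists k, cderiv F z k) /\
  (forall y : R, 0 <= y -> (\int[mu]_(x in setT) (cmod2 (F (x +i* y)))%:E <= M%:E)%E).

Lemma cmod_cint_le_ext D (g : R -> C) (h : R -> R) (K : R) :
  @measurable _ (measurableTypeR R) D -> cintg D g -> measurable_fun setT h ->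
  (forall x, 0 <= h x) ->
  (\int[mu]_(x in setT) (h x)%:E <= K%:E)%E -> (forall x, D x -> cmod (g x) <= h x) ->
  cmod (cint D g) <= K.
Proof.
move=> mD ig mh h0 hK gh.
have ih : mu.-integrable setT (EFin \o h) by exact: nonneg_integrable hK.
have ihD : mu.-integrable D (EFin \o h) by apply: integrableS ih.
apply: le_trans (cmod_cint_le mD ig ihD gh) _.
rewrite -lee_fin /Rintegral fineK; last exact: integrable_fin_num.
apply: le_trans hK; apply: ge0_subset_integral => //.
- by apply/measurable_EFinP.
- by move=> x _; rewrite lee_fin.
Qed.

Lemma cmod2_sub (x y u v : R) : cmod2 (x +i* y - (u +i* v)) = (x - u) ^+ 2 + (y - v) ^+ 2.
Proof. by rewrite /cmod2 !cReB !cImB. Qed.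

(** The free weight [t] is what makes the top side of a contour small: a small [t] damps the term in
    [F], then a great height damps the term in the kernel. *)
Lemma amgm (a b t : R) : 0 < t -> a * b <= (t * a ^+ 2 + b ^+ 2 / t) / 2.
Proof.
move=> t0; rewrite -subr_ge0.
have -> : (t * a ^+ 2 + b ^+ 2 / t) / 2 - a * b = (t * a - b) ^+ 2 / (2 * t).
  by field; rewrite gt_eqF.
by rewrite divr_ge0 ?sqr_ge0 // mulr_ge0 // ltW.
Qed.

Lemma cmod_quotient_le F (q1 z w : C) (t : R) : q1 * (z - w) = F z -> z != w -> 0 < t ->
  cmod q1 <= (t * cmod2 (F z) + (cmod2 (z - w))^-1 / t) / 2.
Proof.
move=> qF zw t0; have zw0 : z - w != 0 by rewrite subr_eq0.
have -> : q1 = F z * (z - w)^-1 by rewrite -qF mulfK.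
rewrite cmodM cmodV -!cmod_sqr -exprVn; exact: amgm.
Qed.

Lemma cmod_kernelE (x y u v : R) : y != v ->
  (cmod2 (x +i* y - (u +i* v)))^-1 = cauchy_kernel `|y - v| u x / `|y - v|.
Proof.
move=> yv; have yv0 : `|y - v| != 0 by rewrite normr_eq0 subr_eq0.
rewrite cmod2_sub /cauchy_kernel real_normK ?num_real // mulrAC divff // mul1r //.
Qed.

Lemma pcont_cmod2 (g : R -> C) t : pcont g t -> {for t, continuous (fun s => cmod2 (g s))}.
Proof.
move=> cg; have -> : (fun s => cmod2 (g s)) = (fun s => cmod (g s) * cmod (g s)).
  by apply/funext => s; rewrite -expr2 cmod_sqr.
by apply: cvgM; apply: pcont_cmod.
Qed.

Lemma measurable_cmod2 (g : R -> C) : (forall t, pcont g t) ->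
  measurable_fun setT (fun s => cmod2 (g s)).
Proof. by move=> cg; apply: continuous_measurable_fun => t; apply: pcont_cmod2. Qed.

Lemma hardy_cont F M z : hardy F M -> 0 <= Im z -> ccont F z.
Proof. by move=> [hF _] /hF[k /cderiv_cont]. Qed.

Lemma hardy_pcont F M (y t : R) : hardy F M -> 0 <= y -> pcont (fun x => F (x +i* y)) t.
Proof. by move=> hF y0; apply: pcont_horizontal; exact: (hardy_cont hF). Qed.

Lemma measurable_cauchy_kernel (s u : R) : 0 < s -> measurable_fun setT (cauchy_kernel s u).
Proof. by move=> s0; apply: continuous_measurable_fun; exact: continuous_cauchy_kernel. Qed.

Lemma integral_cstM (k : R) (h : R -> R) (M : R) : 0 <= k -> measurable_fun setT h ->
  (forall x, 0 <= h x) -> (\int[mu]_(x in setT) (h x)%:E <= M%:E)%E ->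
  (\int[mu]_(x in setT) (k * h x)%:E <= (k * M)%:E)%E.
Proof.
move=> k0 mh h0 hM; under eq_integral do rewrite EFinM.
rewrite ge0_integralZl //.
- by rewrite EFinM; apply: lee_wpmul2l; rewrite ?lee_fin.
- by apply/measurable_EFinP.
- by move=> x _; rewrite lee_fin.
Qed.

Lemma integral_le_add (h k : R -> R) (M N : R) : measurable_fun setT h -> measurable_fun setT k ->
  (forall x, 0 <= h x) -> (forall x, 0 <= k x) ->
  (\int[mu]_(x in setT) (h x)%:E <= M%:E)%E ->
  (\int[mu]_(x in setT) (k x)%:E <= N%:E)%E ->
  (\int[mu]_(x in setT) (h x + k x)%:E <= (M + N)%:E)%E.
Proof.
move=> mh mk h0 k0 hM kN; under eq_integral do rewrite EFinD.
rewrite ge0_integralD //.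
- by rewrite EFinD; apply: leeD.
- by move=> x _; rewrite lee_fin.
- by apply/measurable_EFinP.
- by move=> x _; rewrite lee_fin.
- by apply/measurable_EFinP.
Qed.

(* The majorant of |q| on the line at height y, for q (z - (u + iv)) = F z. *)
Definition majorant F (t u v y x : R) : R :=
  (t * cmod2 (F (x +i* y)) + (cauchy_kernel `|y - v| u x / `|y - v|) / t) / 2.

Lemma majorantP F M (t u v y : R) : hardy F M -> 0 < t -> 0 <= y -> y != v ->
  [/\ measurable_fun setT (majorant F t u v y), (forall x, 0 <= majorant F t u v y x) &
   (\int[mu]_(x in setT) (majorant F t u v y x)%:E <=
     (t * M + pi / (`|y - v| * t))%:E)%E].
Proof.
move=> hF t0 y0 yv; have s0 : 0 < `|y - v| by rewrite normr_gt0 subr_eq0.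
have mF : measurable_fun setT (fun x => cmod2 (F (x +i* y))).
  by apply: measurable_cmod2 => x; exact: (hardy_pcont _ hF).
have mk := measurable_cauchy_kernel u s0.
have k0 x : 0 <= cauchy_kernel `|y - v| u x by rewrite ltW ?cauchy_kernel_gt0.
have E : majorant F t u v y = fun x => t / 2 * cmod2 (F (x +i* y)) +
    (2 * `|y - v| * t)^-1 * cauchy_kernel `|y - v| u x.
  by apply/funext => x; rewrite /majorant; field; rewrite !gt_eqF.
have c0 : 0 <= t / 2 by lra.
have d0 : 0 <= (2 * `|y - v| * t)^-1 by rewrite invr_ge0 !mulr_ge0 // ltW.
have iF := integral_cstM c0 mF (fun x => cmod20 _) (hF.2 y y0).
have ik := integral_cstM d0 mk k0 _ (M := pi).
rewrite E; split.
- by apply: measurable_funD; apply: measurable_funM => //; exact: measurable_cst.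
- by move=> x; rewrite addr_ge0 // mulr_ge0 // cmod20.
- apply: le_trans (integral_le_add _ _ _ _ iF (ik _)) _.
  + by apply: measurable_funM => //; exact: measurable_cst.
  + by apply: measurable_funM => //; exact: measurable_cst.
  + by move=> x; rewrite mulr_ge0 // cmod20.
  + by move=> x; rewrite mulr_ge0.
  + by rewrite integral_cauchy_kernel.
  + rewrite lee_fin.
    have M0 : 0 <= M.
      rewrite -lee_fin; apply: le_trans (hF.2 _ y0); apply: integral_ge0 => x _.
      by rewrite lee_fin cmod20.
    have -> : (2 * `|y - v| * t)^-1 * pi = pi / (`|y - v| * t) / 2 by field; rewrite !gt_eqF.
    have p0 : 0 <= pi / (`|y - v| * t) :> R by rewrite divr_ge0 ?pi_ge0 // mulr_ge0 // ltW.
    have : 0 <= t * M by rewrite mulr_ge0 // ltW.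
    lra.
Qed.

(** Goursat's theorem on [[a, b] x [0, Y]], where [q] may have a removable point [p]. The top side
    is small by the weighted bound, the vertical sides by a choice of [a] and [b] through
    [tonelli_strip], and the bottom side tends to the integral over the line. Each of top, left
    side, right side and tail takes [e / 4]. *)
Lemma half_plane_goursat F M q p (u v : R) : hardy F M -> 0 < Im p -> v != 0 ->
  (forall z, 0 <= Im z -> ccont q z) ->
  (forall z, 0 <= Im z -> z != p -> exists k, cderiv q z k) ->
  (forall z, 0 <= Im z -> z != p -> q z * (z - (u +i* v)) = F z) ->
  cintg setT (fun x => q (x +i* 0)) /\ cint setT (fun x => q (x +i* 0)) = 0.
Proof.
move=> hF p0 v0 cq dq qF.
have M0 : 0 <= M.
  rewrite -lee_fin; apply: le_trans (hF.2 0 (lexx 0)); apply: integral_ge0 => x _.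
  by rewrite lee_fin cmod20.
have q_le (t x y : R) : 0 < t -> 0 <= y -> y != Im p -> y != v ->
    cmod (q (x +i* y)) <= majorant F t u v y x.
  move=> t0 y0 yp yv; rewrite /majorant -cmod_kernelE //.
  apply: cmod_quotient_le => //; last by apply: contra yv => /eqP[_ ->].
  by apply: qF => //; apply: contra yp => /eqP <-.
have pq (y t : R) : 0 <= y -> pcont (fun x => q (x +i* y)) t.
  by move=> y0; apply: pcont_horizontal; apply: cq.
have cintgq (y : R) : 0 <= y -> y != Im p -> y != v -> cintg setT (fun x => q (x +i* y)).
  move=> y0 yp yv; have [m1 m2 m3] := majorantP u hF ltr01 y0 yv.
  apply: (dominated_cintg (h := majorant F 1 u v y)).
  - by move=> t; apply: pq.
  - exact: nonneg_integrable m3.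
  - by move=> x; apply: q_le.
have p0' : 0 != Im p by rewrite eq_sym gt_eqF.
have ig0 := cintgq 0 (lexx 0) p0' ltac:(by rewrite eq_sym).
split => //; apply/eqP; rewrite -cmod_eq0 eq_le cmod_ge0 andbT.
apply/ler_addgt0Pr => e e0; rewrite add0r.
(* Makes [t * M] at most [e / 8]. *)
pose t : R := e / (8 * (M + 1)).
have t0 : 0 < t by rewrite divr_gt0 // mulr_gt0 // ltr_wpDl.
(* The first two summands put the top side above both [v] and [Im p]; the third makes the kernel
   term [pi / (|Y - v| * t)] at most [e / 8]. *)
pose Y : R := `|v| + Im p + 8 * pi / (e * t) + 1.
have pi0 : 0 < pi :> R by exact: pi_gt0.
have et0 : 0 < 8 * pi / (e * t) by apply: divr_gt0; apply: mulr_gt0.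
have Yv : 8 * pi / (e * t) < `|Y - v|.
  apply: lt_le_trans (ler_norm _); have := ler_norm v; rewrite /Y; lra.
have Yp : Im p < Y by rewrite /Y; have := normr_ge0 v; lra.
have Y0 : 0 < Y by lra.
have Yv' : Y != v by rewrite -subr_eq0 -normr_gt0; apply: lt_trans Yv.
have top_le (a b : R) : cmod (cint `[a, b] (fun x => q (x +i* Y))) <= e / 4.
  have [m1 m2 m3] := majorantP u hF t0 (ltW Y0) Yv'.
  have := cmod_cint_le_ext (D := `[a, b]) (g := fun x => q (x +i* Y)) _ _ m1 m2 m3.
  move=> /(_ _ _ _)/le_trans; apply.
  - by [].
  - by apply: pcont_cintg => x _; exact/pq/ltW.
  - by move=> x _; apply: q_le => //; [exact: ltW|rewrite gt_eqF].
  have h1 : t * M <= e / 8.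
    rewrite /t mulrAC ler_pdivrMr ?mulr_gt0 ?ltr_wpDl //.
    have -> : e / 8 * (8 * (M + 1)) = e * M + e by field.
    by rewrite lerDl ltW.
  have h2 : pi / (`|Y - v| * t) <= e / 8.
    rewrite ler_pdivrMr; last by rewrite mulr_gt0 // (lt_trans _ Yv).
    have h : 8 * pi < `|Y - v| * (e * t) by rewrite -ltr_pdivrMr //; exact: mulr_gt0.
    lra.
  lra.
pose k (x y : R) := cmod2 (F (x +i* y)).
have ck1 x y : 0 <= y <= Y -> {for x, continuous (k ^~ y)}.
  by move=> /andP[y0 _]; apply: pcont_cmod2; exact: (hardy_pcont _ hF).
have ck2 x y : 0 <= y <= Y -> {for y, continuous (k x)}.
  by move=> /andP[y0 _]; apply/pcont_cmod2/pcont_vertical; exact: (hardy_cont hF).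
have [mh hh] := tonelli_strip (ltW Y0) (fun x y => cmod20 _) ck1 ck2
   (fun y yY => hF.2 y (proj1 (andP yY))).
set h := fun x : R => \int[mu]_(y in `[0, Y]) k x y in mh hh.
have h0 x : 0 <= h x by apply: Rintegral_ge0 => y _; exact: cmod20.
(* Beyond [A] a vertical side avoids [p], and its squared distance from [u] is at least [4 * Y / e],
   so the kernel term contributes at most [e / 8] over the height [Y]. *)
pose A : R := `|u| + `|Re p| + 1 + 4 * Y / e.
have vert x : A < `|x| -> h x < e / 4 ->
    cmod (cint `[0, Y] (fun y => q (x +i* y))) <= e / 4.
  move=> Ax hx; have A1 : 4 * Y / e + 1 < `|x - u|.
    have := ler_normD (x - u) u; rewrite subrK; have := normr_ge0 (Re p).
    rewrite /A in Ax; lra.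
  have Ye0 : 0 < 4 * Y / e by rewrite divr_gt0 // mulr_gt0.
  have xp : x != Re p.
    apply/eqP => E; move: Ax; rewrite /A E; have := normr_ge0 u; lra.
  have ik : mu.-integrable `[0, Y] (EFin \o k x).
    by apply: continuous_itv_integrable => y /ck2.
  have s2 : e^-1 * (4 * Y) <= (x - u) ^+ 2.
    rewrite mulrC -real_normK ?num_real //; nra.
  apply: (@le_trans _ _ (\int[mu]_(y in `[0, Y]) (2^-1 * k x y + 2^-1 * (e / (4 * Y))))).
    apply: cmod_cint_le => //.
    - apply: pcont_cintg => y /andP[y0 _]; apply: pcont_vertical; exact: cq.
    - by apply: continuous_itv_integrable => y yY; apply: cvgD; [apply: cvgM; [exact: cvg_cst|exact: ck2]|exact: cvg_cst].
    - move=> y; rewrite /= in_itv /= => /andP[y0 _].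
      have zp : x +i* y != p by apply: contra xp => /eqP <-.
      have xu : x != u by rewrite -subr_eq0 -normr_gt0; lra.
      have zu : x +i* y != u +i* v by apply: contra xu => /eqP[->].
      have inv_le : (cmod2 (x +i* y - (u +i* v)))^-1 <= e / (4 * Y).
        rewrite cmod2_sub invf_ple ?posrE; last 2 first.
        - by rewrite ltr_wpDr ?sqr_ge0 // exprn_even_gt0 // subr_eq0.
        - by apply: divr_gt0 => //; exact: mulr_gt0.
        rewrite invf_div mulrC; apply: le_trans s2 _.
        by rewrite lerDl sqr_ge0.
      apply: le_trans (cmod_quotient_le (qF (x +i* y) y0 zp) zu ltr01) _.
      rewrite mul1r divr1 /k; lra.
  have ic (c : R) : mu.-integrable `[0, Y] (EFin \o (fun=> c)).
    by apply: continuous_itv_integrable => y _; exact: cvg_cst.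
  rewrite RintegralD //; last first.
    by apply: continuous_itv_integrable => y yY; apply: cvgM; [exact: cvg_cst|exact: ck2].
  rewrite [X in X + _]RintegralZl // -/(h x).
  set c : R := 2^-1 * (e / (4 * Y)).
  rewrite [X in _ + X]Rintegral_cst //= lebesgue_measure_itv /= lte_fin Y0 /= subr0.
  have -> : c * Y = e / 8 by rewrite /c; field; rewrite gt_eqF.
  by lra.
have e8 : 0 < e / 8 by lra.
have [ig1 ig2] := ig0.
have [X1 hX1] := Rintegral_tail ig1 e8; have [X2 hX2] := Rintegral_tail ig2 e8.
pose X : R := `|X1| + `|X2| + A.
have A0 : 0 < A.
  have h1 := normr_ge0 u; have h2 := normr_ge0 (Re p).
  have h3 : 0 < 4 * Y / e by rewrite divr_gt0 // mulr_gt0.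
  rewrite /A; lra.
have [X1X X2X] : X1 <= X /\ X2 <= X.
  have h1 := ler_norm X1; have h2 := ler_norm X2; have h3 := normr_ge0 X1.
  have h4 := normr_ge0 X2; rewrite /X; split; clear -h1 h2 h3 h4 A0; lra.
have AX : A <= X by rewrite /X lerDr addr_ge0.
have [b bX hb] := exists_small X mh h0 hh (e := e / 4) ltac:(lra).
have [a aX ha] := exists_smallN (- X) mh h0 hh (e := e / 4) ltac:(lra).
have pA : `|Re p| < A.
  have h1 := normr_ge0 u; have h3 : 0 < 4 * Y / e by rewrite divr_gt0 // mulr_gt0.
  rewrite /A; clear -h1 h3; lra.
have vb := vert b ltac:(by apply: lt_le_trans (ler_norm b); exact: le_lt_trans AX bX) hb.
have va := vert a ltac:(by rewrite -normrN; apply: lt_le_trans (ler_norm (- a)); apply: le_lt_trans AX _; rewrite ltrNr) ha.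
have bd : bdry q a b 0 Y = 0.
  apply: (@removable_goursat _ q p).
  - by move: pA; rewrite ltr_norml; clear -AX aX bX; lra.
  - by rewrite p0 Yp.
  - by move=> x y _ /andP[y0 _]; exact: cq.
  - by move=> x y _ /andP[y0 _] xp; exact: dq.
have i0 : cintg `[a, b] (fun x => q (x +i* 0)) by apply: pcont_cintg => x _; exact: pq.
have iY : cintg `[a, b] (fun x => q (x +i* Y)) by apply: pcont_cintg => x _; apply/pq/ltW.
have iv x : cintg `[0, Y] (fun y => q (x +i* y)).
  by apply: pcont_cintg => y /andP[y0 _]; apply: pcont_vertical; exact: cq.
move: bd; rewrite /bdry cintB // cintB // => bd.
set J0 := cint `[a, b] (fun x => q (x +i* 0)) in bd.
set JY := cint `[a, b] (fun x => q (x +i* Y)) in bd.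
set Vb := cint `[0, Y] (fun y => q (b +i* y)) in bd vb.
set Va := cint `[0, Y] (fun y => q (a +i* y)) in bd va.
have J0E : J0 = JY - 'i * (Vb - Va).
  by apply/eqP; rewrite -subr_eq0 -bd; apply/eqP; ring.
have h1 : cmod J0 <= 3 * (e / 4).
  rewrite J0E; apply: le_trans (cmodB _ _) _; rewrite cmodM cmod_i mul1r.
  have j1 := cmodB Vb Va; have j2 := top_le a b; rewrite -/JY in j2.
  clear -j1 j2 va vb; lra.
set J := cint setT _.
have h2 : cmod (J0 - J) <= e / 4.
  apply: le_trans (cmod_le _) _; rewrite cReB cImB /=.
  have g1 : `|Re J0 - Re J| < e / 8.
    by apply: hX1; [apply: lt_le_trans aX _; rewrite lerN2|exact: le_lt_trans bX].
  have g2 : `|Im J0 - Im J| < e / 8.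
    by apply: hX2; [apply: lt_le_trans aX _; rewrite lerN2|exact: le_lt_trans bX].
  clear -g1 g2; lra.
have := cmodB J0 (J0 - J).
by rewrite opprB addrC subrK; clear -h1 h2; lra.
Qed.

Lemma hardy_lower F M w : hardy F M -> Im w < 0 ->
  cintg setT (fun x => F (x +i* 0) / (x +i* 0 - w)) /\
  cint setT (fun x => F (x +i* 0) / (x +i* 0 - w)) = 0.
Proof.
case: w => u v /= hF v0.
have nz z : 0 <= Im z -> z - (u +i* v) != 0.
  move=> z0; rewrite subr_eq0; apply/eqP => E; move: z0; rewrite E /=; lra.
have dz z : cderiv (fun z => z - (u +i* v)) z (1 - 0).
  by apply: cderivB; [exact: cderiv_id|exact: cderiv_cst].
(* The pole lies below the axis, so [q] is regular on the closed half-plane and any point of the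
   open half-plane can serve as [p]. *)
apply: (half_plane_goursat (p := 0 +i* 1) (u := u) (v := v) (q := fun z => F z / (z - (u +i* v))) hF).
- exact: ltr01.
- by rewrite lt_eqF.
- move=> z z0; apply: ccont_div; [exact: (hardy_cont hF)| |exact: nz].
  exact: cderiv_cont (dz z).
- by move=> z z0 _; have [k hk] := hF.1 z z0; eexists; apply: cderiv_div hk (dz z) (nz z z0).
- by move=> z z0 _; rewrite divfK // nz.
Qed.

Lemma hardy_zero F M w : hardy F M -> 0 < Im w -> F w = 0 ->
  cintg setT (fun x => F (x +i* 0) / (x +i* 0 - w)) /\
  cint setT (fun x => F (x +i* 0) / (x +i* 0 - w)) = 0.
Proof.
case: w => u v hF v0 Fw; rewrite /= in v0.
have [k hk] := hF.1 (u +i* v) (ltW v0).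
have [q [cq _ qE]] := div_quotient hk Fw.
have dz z : cderiv (fun z => z - (u +i* v)) z (1 - 0).
  by apply: cderivB; [exact: cderiv_id|exact: cderiv_cst].
have dq z : 0 <= Im z -> z != u +i* v -> exists k, cderiv q z k.
  move=> z0 zw; have [k1 hk1] := hF.1 z z0.
  have zw' : z - (u +i* v) != 0 by rewrite subr_eq0.
  eexists; apply: (cderiv_near (r := cmod (z - (u +i* v))) _ _ (cderiv_div hk1 (dz z) zw')).
    by rewrite cmod_gt0.
  move=> z1 zr; apply: qE; apply: contraTneq zr => ->.
  by rewrite cmodBC ltxx.
have e0 x : F (x +i* 0) / (x +i* 0 - (u +i* v)) = q (x +i* 0).
  by apply: qE; apply/eqP => -[_ E]; move: v0; rewrite -E ltxx.
under eq_fun do rewrite e0.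
apply: (half_plane_goursat (p := u +i* v) (u := u) (v := v) hF) => //.
- by rewrite gt_eqF.
- move=> z z0; have [->//|zw] := eqVneq z (u +i* v).
  by have [k1 /cderiv_cont] := dq z z0 zw.
- by move=> z z0 zw; rewrite -qE // divfK // subr_eq0.
Qed.

End HardySpace.

(** * Cauchy and Poisson formulas on the half-plane *)

Section HardyCauchy.
Variable R : realType.
Local Notation C := R[i].
Local Notation mu := (@lebesgue_measure R).
Implicit Types (F G : C -> C) (z w : C).

Lemma hardy_ge0 F M : hardy F M -> 0 <= M.
Proof.
move=> hF; rewrite -lee_fin; apply: le_trans (hF.2 0 (lexx 0)).
by apply: integral_ge0 => x _; rewrite lee_fin cmod20.
Qed.

Lemma ge0_integral_le (h k : R -> R) (N : \bar R) : measurable_fun setT h ->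
  measurable_fun setT k -> (forall x, 0 <= h x) -> (forall x, h x <= k x) ->
  (\int[mu]_(x in setT) (k x)%:E <= N)%E -> (\int[mu]_(x in setT) (h x)%:E <= N)%E.
Proof.
move=> mh mk h0 hk; apply: le_trans; apply: ge0_le_integral => //.
- by move=> x _; rewrite lee_fin.
- by apply/measurable_EFinP.
- by apply/measurable_EFinP.
- by move=> x _; rewrite lee_fin.
Qed.

Lemma measurable_cstM (r : R) (h : R -> R) :
  measurable_fun setT h -> measurable_fun setT (fun x => r * h x).
Proof. by move=> mh; apply: measurable_funM => //; exact: measurable_cst. Qed.

Lemma measurable_line F (y : R) : (forall x, ccont F (x +i* y)) ->
  measurable_fun setT (fun x : R => cmod2 (F (x +i* y))).
Proof. by move=> cF; apply: measurable_cmod2 => x; exact: pcont_horizontal. Qed.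

Lemma hardy_measurable F M (y : R) : hardy F M -> 0 <= y ->
  measurable_fun setT (fun x : R => cmod2 (F (x +i* y))).
Proof. by move=> hF y0; apply: measurable_cmod2 => x; exact: (hardy_pcont _ hF). Qed.

Lemma hardyD F G M N : hardy F M -> hardy G N ->
  hardy (fun z => F z + G z) (2 * M + 2 * N).
Proof.
move=> hF hG; split=> [z z0|y y0].
  have [k1 h1] := hF.1 z z0; have [k2 h2] := hG.1 z z0.
  by exists (k1 + k2); apply: cderivD.
have pos H x : 0 <= 2 * cmod2 (H (x +i* y) : C) by rewrite mulr_ge0 // cmod20.
have mF := hardy_measurable hF y0; have mG := hardy_measurable hG y0.
have i1 := integral_cstM (ler0n R 2) mF (fun x => cmod20 _) (hF.2 y y0).
have i2 := integral_cstM (ler0n R 2) mG (fun x => cmod20 _) (hG.2 y y0).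
have [m1 m2] := (measurable_cstM 2 mF, measurable_cstM 2 mG).
apply: (ge0_integral_le _ _ _ _ (integral_le_add m1 m2 (pos F) (pos G) i1 i2)).
- apply: (@measurable_line (fun z => F z + G z)) => x.
  by apply: ccontD; [exact: (hardy_cont hF)|exact: (hardy_cont hG)].
- exact: measurable_funD.
- by move=> x; exact: cmod20.
- by move=> x; exact: cmod2D.
Qed.

(** The pole lies below the axis, and the square integral of the kernel on the line at height [y] is
    [pi / (y + Im w)], largest for [y = 0]. *)
Lemma hardy_bounded_quotient F w (B : R) : 0 < Im w ->
  (forall z, 0 <= Im z -> exists k, cderiv F z k) ->
  (forall z, 0 <= Im z -> cmod (F z) <= B) ->
  hardy (fun z => F z / (z - w^*)) (B ^+ 2 * pi / Im w).
Proof.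
case: w => u v /= v0 dF bF.
have dq z : 0 <= Im z -> exists k, cderiv (fun z => F z / (z - (u -i* v))) z k.
  move=> z0; have nz : z - (u -i* v) != 0.
    rewrite subr_eq0; apply/eqP => E; move: z0; rewrite E /=; lra.
  have dz : cderiv (fun z => z - (u -i* v)) z (1 - 0).
    by apply: cderivB; [exact: cderiv_id|exact: cderiv_cst].
  by have [k hk] := dF z z0; eexists; apply: cderiv_div hk dz nz.
split=> // y y0.
have yv : 0 < y + v by lra.
have k0 x : 0 <= cauchy_kernel (y + v) u x by rewrite ltW ?cauchy_kernel_gt0.
have mk := measurable_cauchy_kernel u yv.
have c0 : 0 <= B ^+ 2 / (y + v) by rewrite divr_ge0 ?sqr_ge0 // ltW.
apply: (@le_trans _ _ (B ^+ 2 / (y + v) * pi)%:E).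
  apply: (ge0_integral_le _ (measurable_cstM _ mk) _ _ (integral_cstM c0 mk k0 (M := pi) _)).
  - apply: (@measurable_line (fun z => F z / (z - (u -i* v)))) => x.
    by have [k /cderiv_cont] := dq (x +i* y) y0.
  - by move=> x; exact: cmod20.
  - move=> x; rewrite cmod2M -[X in _ * X]cmod_sqr cmodV exprVn cmod_sqr.
    rewrite cmod2_sub opprK /cauchy_kernel.
    have d0 : 0 < (x - u) ^+ 2 + (y + v) ^+ 2 by rewrite ltr_wpDl ?sqr_ge0 ?exprn_gt0.
    have -> : B ^+ 2 / (y + v) * ((y + v) / ((x - u) ^+ 2 + (y + v) ^+ 2)) =
        B ^+ 2 * ((x - u) ^+ 2 + (y + v) ^+ 2)^-1 by field; rewrite !gt_eqF.
    rewrite ler_wpM2r ?invr_ge0 ?(ltW d0) // -cmod_sqr.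
    have bz : cmod (F (x +i* y)) <= B by apply: bF.
    by rewrite ler_pXn2r ?nnegrE ?cmod_ge0 // (le_trans (cmod_ge0 _) bz).
  - by rewrite integral_cauchy_kernel.
have bp : 0 <= B ^+ 2 * pi by rewrite mulr_ge0 ?pi_ge0 // sqr_ge0.
rewrite lee_fin mulrAC ler_wpM2l //.
by rewrite lef_pV2 ?posrE // lerDr.
Qed.

Lemma line_kernel (x u v : R) : 0 < v ->
  (x +i* 0 - (u +i* v)) * (x +i* 0 - (u -i* v)) = ((x - u) ^+ 2 + v ^+ 2)%:C.
Proof. by move=> v0; apply: complex_ext; rewrite !ReImE /=; ring. Qed.

Lemma line_sub_neq0 (x u v : R) : v != 0 -> x +i* 0 - (u +i* v) != 0.
Proof.
move=> v0; rewrite subr_eq0; apply/eqP => -[_ E].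
by move: v0; rewrite -E eqxx.
Qed.

Lemma integrable_cauchy_kernel (s u : R) : 0 < s ->
  mu.-integrable setT (EFin \o cauchy_kernel s u).
Proof.
move=> s0; apply: (nonneg_integrable (M := pi)).
- exact: measurable_cauchy_kernel.
- by move=> t; rewrite ltW ?cauchy_kernel_gt0.
- by rewrite integral_cauchy_kernel.
Qed.

Lemma cint_cauchy_kernel (s u : R) : 0 < s ->
  cintg setT (fun x => (cauchy_kernel s u x)%:C) /\
  cint setT (fun x => (cauchy_kernel s u x)%:C) = pi%:C.
Proof.
move=> s0; split; first by split => /=; [exact: integrable_cauchy_kernel|exact: integrable0].
apply: complex_ext => /=.
  by rewrite /Rintegral integral_cauchy_kernel.
by rewrite /Rintegral integral0.
Qed.

(** Subtracting the multiple of [1 / (z - conj w)] that agrees with [F] at [w] reduces the claim to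
    [hardy_zero]. What was subtracted is, after division by [z - w], a multiple of the Poisson
    kernel, whose integral is known, so no residue is computed. *)
Lemma hardy_cauchy F M w : hardy F M -> 0 < Im w ->
  cintg setT (fun x => F (x +i* 0) / (x +i* 0 - w)) /\
  cint setT (fun x => F (x +i* 0) / (x +i* 0 - w)) = 2 * pi%:C * 'i * F w.
Proof.
case: w => u v hF v0; have v0' : 0 < v := v0.
set w := u +i* v; set c := F w * (2 * v%:C * 'i).
have hc : hardy (fun z => - c / (z - w^*)) (cmod (- c) ^+ 2 * pi / v).
  apply: (@hardy_bounded_quotient (fun=> - c) w) => // z _.
  by exists 0; exact: cderiv_cst.
have hP := hardyD hF hc.
have Pw : F w + - c / (w - w^*) = 0.
  have -> : w - w^* = 2 * v%:C * 'i by apply: complex_ext; rewrite !ReImE /=; ring.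
  have v1 : v%:C != 0 :> C by rewrite -cmod_gt0 cmod_real gtr0_norm.
  have i1 : 'i != 0 :> C by rewrite -cmod_gt0 cmod_i.
  by rewrite /c; field; rewrite v1 i1.
have [i1 e1] := hardy_zero hP v0 Pw.
have [ik ek] := cint_cauchy_kernel u v0'.
have E x : F (x +i* 0) / (x +i* 0 - w) =
   (F (x +i* 0) + - c / (x +i* 0 - w^*)) / (x +i* 0 - w) +
   2 * 'i * F w * (cauchy_kernel v u x)%:C.
  have n1 : x +i* 0 - w != 0 by apply: line_sub_neq0; rewrite gt_eqF.
  have n2 : x +i* 0 - w^* != 0 by apply: line_sub_neq0; rewrite oppr_eq0 gt_eqF.
  have -> : (cauchy_kernel v u x)%:C = v%:C / ((x +i* 0 - w) * (x +i* 0 - w^*)).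
    by rewrite line_kernel // /cauchy_kernel rmorphM fmorphV.
  by rewrite /c; field; rewrite n1 n2.
have mT : @measurable _ (measurableTypeR R) setT by [].
split.
  apply: (eq_cintg mT (g := fun x => (F (x +i* 0) + - c / (x +i* 0 - w^*)) / (x +i* 0 - w) +
   2 * 'i * F w * (cauchy_kernel v u x)%:C)) => [x _|]; first by rewrite E.
  by apply: cintgD => //; apply: cintgZ.
under eq_fun do rewrite E.
by rewrite cintD // ?e1 ?cintZ ?ek //; [ring|exact: cintgZ].
Qed.

(** The kernel is a multiple of the difference of the Cauchy kernels at [u + i v] and at its
    conjugate, and the integral against the latter vanishes by [hardy_lower]. *)
Lemma hardy_poisson F M (u v : R) : hardy F M -> 0 < v ->
  cintg setT (fun x => (cauchy_kernel v u x)%:C * F (x +i* 0)) /\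
  cint setT (fun x => (cauchy_kernel v u x)%:C * F (x +i* 0)) = pi%:C * F (u +i* v).
Proof.
move=> hF v0; have [i1 e1] := hardy_cauchy (w := u +i* v) hF v0.
have vn : Im (u -i* v) < 0 by rewrite /= oppr_lt0.
have [i2 e2] := hardy_lower hF vn.
have mT : @measurable _ (measurableTypeR R) setT by [].
have v1 : v%:C != 0 :> C by rewrite -cmod_gt0 cmod_real gtr0_norm.
have ii : 'i != 0 :> C by rewrite -cmod_gt0 cmod_i.
have E x : (cauchy_kernel v u x)%:C * F (x +i* 0) =
  (2 * 'i)^-1 * (F (x +i* 0) / (x +i* 0 - (u +i* v)) - F (x +i* 0) / (x +i* 0 - (u -i* v))).
  have n1 : x +i* 0 - (u +i* v) != 0 by apply: line_sub_neq0; rewrite gt_eqF.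
  have n2 : x +i* 0 - (u -i* v) != 0 by apply: line_sub_neq0; rewrite oppr_eq0 gt_eqF.
  have -> : (cauchy_kernel v u x)%:C = v%:C / ((x +i* 0 - (u +i* v)) * (x +i* 0 - (u -i* v))).
    by rewrite line_kernel // /cauchy_kernel rmorphM fmorphV.
  have dd : (x +i* 0 - (u -i* v)) - (x +i* 0 - (u +i* v)) = 2 * 'i * v%:C.
    by apply: complex_ext; rewrite !ReImE /=; ring.
  have -> : v%:C = (2 * 'i)^-1 * ((x +i* 0 - (u -i* v)) - (x +i* 0 - (u +i* v))).
    by rewrite dd mulKf // mulf_neq0 // pnatr_eq0.
  by field; rewrite ii n1 n2.
split.
  apply: (eq_cintg mT (g := fun x => (2 * 'i)^-1 * (F (x +i* 0) / (x +i* 0 - (u +i* v)) -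
      F (x +i* 0) / (x +i* 0 - (u -i* v))))) => [x _|]; first by rewrite E.
  by apply: cintgZ => //; apply: cintgB.
under eq_fun do rewrite E.
rewrite cintZ //; last exact: cintgB.
by rewrite cintB // e1 e2 subr0; field; rewrite ii.
Qed.

(** Multiplying the Poisson formula by the conjugate of its value [c] gives [pi |c|^2] on the left;
    on the right [|c| |F|] is at most half of [|c|^2 + |F|^2], and the half with [|c|^2] is
    absorbed. *)
Lemma hardy_jensen F M (u v : R) : hardy F M -> 0 < v ->
  ((pi * cmod2 (F (u +i* v)))%:E <=
   \int[mu]_(x in setT) (cauchy_kernel v u x * cmod2 (F (x +i* 0)))%:E)%E.
Proof.
move=> hF v0; set c := F (u +i* v).
have k0 x : 0 <= cauchy_kernel v u x by rewrite ltW ?cauchy_kernel_gt0.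
have mF := hardy_measurable hF (lexx 0).
have mk := measurable_cauchy_kernel u v0.
have mkF : measurable_fun setT (fun x => cauchy_kernel v u x * cmod2 (F (x +i* 0))).
  exact: measurable_funM.
have kF0 x : 0 <= cauchy_kernel v u x * cmod2 (F (x +i* 0)) by rewrite mulr_ge0 // cmod20.
have kv x : cauchy_kernel v u x <= v^-1.
  rewrite /cauchy_kernel ler_pdivrMr; last by rewrite ltr_wpDl ?sqr_ge0 ?exprn_gt0.
  rewrite mulrDr; have -> : v^-1 * v ^+ 2 = v by rewrite expr2 mulKf // gt_eqF.
  by rewrite lerDr mulr_ge0 ?sqr_ge0 // invr_ge0 ltW.
have v0' : 0 <= v^-1 by rewrite invr_ge0 ltW.
have fin : (\int[mu]_(x in setT) (cauchy_kernel v u x * cmod2 (F (x +i* 0)))%:E <= (v^-1 * M)%:E)%E.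
  apply: (ge0_integral_le mkF (measurable_cstM _ mF) kF0 _
     (integral_cstM v0' mF (fun x => cmod20 _) (hF.2 0 (lexx 0)))).
  by move=> x; rewrite ler_wpM2r // cmod20.
set I := (\int[mu]_(x in setT) _)%E in fin *.
have I0 : (0 <= I)%E by apply: integral_ge0 => x _; rewrite lee_fin.
have If : I \is a fin_num by rewrite ge0_fin_numE //; exact: le_lt_trans fin (ltry _).
rewrite -(fineK If) lee_fin; set J := fine I.
have [i1 e1] := hardy_poisson u hF v0.
have mT : @measurable _ (measurableTypeR R) setT by [].
have ic := cintgZ c^* mT i1.
have := cmod_cint_le_ext (K := 2^-1 * (cmod2 c * pi + J)) mT ic
  (h := fun x => 2^-1 * (cmod2 c * cauchy_kernel v u x + cauchy_kernel v u x * cmod2 (F (x +i* 0)))).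
have c0 x : 0 <= cmod2 c * cauchy_kernel v u x by rewrite mulr_ge0 // cmod20.
have m1 := measurable_cstM (cmod2 c) mk.
move=> /(_ _ _ _ _) h.
have {}h : cmod (cint setT (fun x => c^* * ((cauchy_kernel v u x)%:C * F (x +i* 0)))) <=
   2^-1 * (cmod2 c * pi + J).
  apply: h.
  - by apply: measurable_cstM; apply: measurable_funD.
  - by move=> x; rewrite mulr_ge0 // addr_ge0.
  - apply: integral_cstM => //.
    + exact: measurable_funD.
    + by move=> x; rewrite addr_ge0.
    + apply: integral_le_add => //.
      * by apply: integral_cstM => //; [exact: cmod20|rewrite integral_cauchy_kernel].
      * by rewrite /J fineK.
  - move=> x _; rewrite !cmodM cmod_conj cmod_real ger0_norm //.
    rewrite -!cmod_sqr -subr_ge0; move: (k0 x); set k := cauchy_kernel v u x => kx.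
    have := mulr_ge0 kx (sqr_ge0 (cmod c - cmod (F (x +i* 0)))); rewrite sqrrB; lra.
move: h; rewrite cintZ // e1 !cmodM cmod_conj cmod_real ger0_norm ?pi_ge0 //.
have -> : cmod c * (pi * cmod c) = pi * cmod2 c by rewrite -cmod_sqr; ring.
lra.
Qed.

(** Integrating [hardy_jensen] in [u] and exchanging the integrals, every Poisson kernel integrates
    to [pi]. Hence the norm on the real line is itself a Hardy constant, which replaces the
    unspecified one. *)
Lemma hardy_line_le F M (N : R) : hardy F M ->
  (\int[mu]_(x in setT) (cmod2 (F (x +i* 0)))%:E <= N%:E)%E -> hardy F N.
Proof.
move=> hF hN; split; first exact: hF.1.
move=> y; rewrite le_eqVlt => /predU1P[<-//|y0].
have p0 : 0 < pi :> R by exact: pi_gt0.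
have mF := hardy_measurable hF (lexx 0).
pose g (p : R * R) := cauchy_kernel y p.1 p.2 * cmod2 (F (p.2 +i* 0)).
have k0 u x : 0 <= cauchy_kernel y u x by rewrite ltW ?cauchy_kernel_gt0.
have g0 p : (0 <= (EFin \o g) p)%E by rewrite lee_fin mulr_ge0 // cmod20.
have sym u x : cauchy_kernel y u x = cauchy_kernel y x u.
  by rewrite /cauchy_kernel -sqrrN opprB.
have mg : measurable_fun setT g.
  apply: (@separately_measurable R (fun u x => cauchy_kernel y u x * cmod2 (F (x +i* 0)))).
    move=> x u; apply: cvgM; last exact: cvg_cst.
    under eq_fun do rewrite sym; rewrite sym; exact: continuous_cauchy_kernel.
  by move=> u; apply: measurable_funM => //; exact: measurable_cauchy_kernel.
have mG : @measurable_fun _ _ (measurableTypeR R * measurableTypeR R)%type (\bar R) setT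
    (EFin \o g) by apply/measurable_EFinP; exact: mg.
have mI := @measurable_fun_fubini_tonelli_F _ _ (measurableTypeR R) (measurableTypeR R) R mu _ mG g0.
apply: (@le_trans _ _ (\int[mu]_(u in setT) (pi^-1%:E * \int[mu]_(x in setT) (EFin \o g) (u, x)))%E).
  apply: ge0_le_integral => //.
  - by move=> x _; rewrite lee_fin cmod20.
  - by apply/measurable_EFinP; exact: (hardy_measurable hF (ltW y0)).
  - by apply: measurable_funeM; exact: mI.
  - move=> u _; have := hardy_jensen u hF y0.
    rewrite EFinM -(@lee_pmul2l _ (pi^-1)%:E) ?lte_fin ?invr_gt0 //.
    have -> : ((pi^-1)%:E * (pi%:E * (cmod2 (F (u +i* y)))%:E) = (cmod2 (F (u +i* y)))%:E)%E.
      by rewrite -!EFinM mulKf // gt_eqF.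
    by [].
rewrite ge0_integralZl //; last 2 first.
- by move=> u _; apply: integral_ge0 => x _; exact: g0.
- by rewrite lee_fin invr_ge0 ltW.
rewrite (@fubini_tonelli _ _ (measurableTypeR R) (measurableTypeR R) R mu mu _ mG g0).
under eq_integral => x _.
  rewrite /= /g /=.
  under eq_integral do rewrite mulrC EFinM sym.
  rewrite ge0_integralZl //; last 3 first.
  - by apply/measurable_EFinP; exact: measurable_cauchy_kernel.
  - by move=> u _; rewrite lee_fin.
  - by rewrite lee_fin cmod20.
  rewrite integral_cauchy_kernel // muleC.
  over.
rewrite ge0_integralZl //; last 3 first.
- by apply/measurable_EFinP.
- by move=> x _; rewrite lee_fin cmod20.
- by rewrite lee_fin ltW.
by rewrite muleA -EFinM mulVf ?gt_eqF // mul1e.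
Qed.

End HardyCauchy.

(** * Pick's and Harnack's inequalities for functions with nonnegative real part *)

Section Pick.
Variable R : realType.
Local Notation C := R[i].
Local Notation mu := (@lebesgue_measure R).
Implicit Types (f g : C -> C) (z v w : C).

(** The optimal weight is [t = X / a]. If [a = 0] and [b] is positive, the large weight [b / X]
    gives a contradiction. *)
Lemma sqr_le_amgm (X a b : R) : 0 <= X -> 0 <= a -> 0 <= b ->
  (forall t, 0 < t -> 2 * X <= t * a + b / t) -> X ^+ 2 <= a * b.
Proof.
move=> X0 a0 b0 h; have [->|Xn] := eqVneq X 0; first by rewrite expr0n mulr_ge0.
have Xp : 0 < X by rewrite lt_def Xn.
have [a1|an] := eqVneq a 0.
  have [b1|bn] := eqVneq b 0.
    have := h 1 ltr01; rewrite a1 b1; lra.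
  have bp : 0 < b by rewrite lt_def bn.
  have := h (b / X) (divr_gt0 bp Xp); rewrite a1 mulr0 add0r invf_div mulrCA divff //; lra.
have ap : 0 < a by rewrite lt_def an.
have := h (X / a) (divr_gt0 Xp ap); rewrite divfK // invf_div => h1.
have : X <= b * (a / X) by lra.
by rewrite mulrA ler_pdivlMr // -expr2 mulrC.
Qed.

(** This is the determinant of the 2 x 2 Pick matrix of [g] at [v] and [w]. Adding a Cauchy integral
    to the conjugate of its mirror image leaves the nonnegative weight [2 Re g] against the two
    kernels, and a weighted Cauchy-Schwarz inequality compares it with the diagonal integrals of
    [h v] and [h w]. *)
Lemma pick_bounded g (B : R) v w :
  (forall z, 0 <= Im z -> exists k, cderiv g z k) ->
  (forall z, 0 <= Im z -> cmod (g z) <= B) ->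
  (forall z, 0 <= Im z -> 0 <= Re (g z)) ->
  0 < Im v -> 0 < Im w ->
  cmod (g v + (g w)^*) ^+ 2 * (Im v * Im w) <=
    cmod (v - w^*) ^+ 2 * (Re (g v) * Re (g w)).
Proof.
move=> dg bg pg v0 w0.
have mT : @measurable _ (measurableTypeR R) setT by [].
have J a b : 0 < Im a -> 0 < Im b ->
    cintg setT (fun x => g (x +i* 0) / (x +i* 0 - b^*) / (x +i* 0 - a)) /\
    cint setT (fun x => g (x +i* 0) / (x +i* 0 - b^*) / (x +i* 0 - a)) =
      2 * pi%:C * 'i * (g a / (a - b^*)).
  by move=> a0 b0; apply: (hardy_cauchy (hardy_bounded_quotient b0 dg bg)).
have ii : 'i != 0 :> C by rewrite -cmod_gt0 cmod_i.
have nzr (x : R) a : 0 < Im a -> x +i* 0 - a != 0 /\ x +i* 0 - a^* != 0.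
  case: a => p q q0; split; apply: line_sub_neq0; first by rewrite gt_eqF.
  by rewrite oppr_eq0 gt_eqF.
(* the integral of [h a] over the line is [pi Re (g a) / Im a] *)
pose h a (x : R) := Re (g (x +i* 0)) / cmod (x +i* 0 - a) ^+ 2.
have hE a x : 0 < Im a -> g (x +i* 0) / (x +i* 0 - a^*) / (x +i* 0 - a) =
    g (x +i* 0) * ((cmod (x +i* 0 - a) ^+ 2)^-1)%:C.
  move=> a0; have [n1 n2] := nzr x a a0.
  have -> : ((cmod (x +i* 0 - a) ^+ 2)^-1)%:C = ((x +i* 0 - a) * (x +i* 0 - a^*))^-1.
    have -> : x +i* 0 - a^* = (x +i* 0 - a)^* by apply: complex_ext; rewrite !ReImE /=; ring.
    by rewrite mulJ cmod_sqr fmorphV.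
  by field; rewrite n1 n2.
have hP a : 0 < Im a -> [/\ measurable_fun setT (h a), (forall x, 0 <= h a x) &
    (\int[mu]_(x in setT) (h a x)%:E = (pi * (Re (g a) / Im a))%:E)%E].
  move=> a0; have [[i1 i2] e] := J a a a0 a0.
  have E1 : (fun x => Re (g (x +i* 0) / (x +i* 0 - a^*) / (x +i* 0 - a))) = h a.
    by apply/funext => x; rewrite hE // !ReImE /= mulr0 subr0.
  have h0 x : 0 <= h a x by rewrite divr_ge0 ?sqr_ge0 // pg.
  rewrite E1 in i1; split=> //.
    by apply/measurable_EFinP; exact: measurable_int i1.
  have /(congr1 (@complex.Re R)) := e; rewrite /= E1 /Rintegral => e2.
  rewrite -[LHS]fineK; last exact: (integrable_fin_num measurableT i1).
  rewrite e2; congr EFin.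
  have -> : 2 * pi%:C * 'i * (g a / (a - a^*)) = (pi / Im a)%:C * g a.
    have -> : a - a^* = 2 * (Im a)%:C * 'i.
      by case: a {a0 i1 i2 e E1 h0 e2} => p q; apply: complex_ext; rewrite !ReImE /=; ring.
    have a1 : (Im a)%:C != 0 :> C by rewrite -cmod_gt0 cmod_real gtr0_norm.
    by rewrite rmorphM fmorphV; field; rewrite a1 ii.
  by rewrite !ReImE /= mul0r subr0; ring.
have [mv v1 ev] := hP v v0; have [mw w1 ew] := hP w w0.
have [i1 e1] := J v w v0 w0; have [i2 e2] := J w v w0 v0.
have vw : v - w^* != 0.
  by apply/eqP => /(congr1 (@complex.Im R)); rewrite !ReImE /=; lra.
have wv : w - v^* != 0.
  by apply/eqP => /(congr1 (@complex.Im R)); rewrite !ReImE /=; lra.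
set X := cmod (g v + (g w)^*) / cmod (v - w^*).
have key (t : R) : 0 < t -> 2 * (pi * X) <= t * (pi * (Re (g w) / Im w)) + (pi * (Re (g v) / Im v)) / t.
  move=> t0; have i3 := cintg_conj mT i2.
  have e3 : cint setT (fun x => g (x +i* 0) / (x +i* 0 - w^*) / (x +i* 0 - v) +
      (g (x +i* 0) / (x +i* 0 - v^*) / (x +i* 0 - w))^*) =
      2 * pi%:C * 'i * ((g v + (g w)^*) / (v - w^*)).
    rewrite cintD // cint_conj // e1 e2.
    have -> : (2 * pi%:C * 'i * (g w / (w - v^*)))^* =
        - (2 * pi%:C * 'i) * ((g w)^* / - (v - w^*)).
      transitivity ((2 * pi%:C * 'i : C)^* * ((g w)^* / (w - v^*)^*)).
        by rewrite -conjV -conjM -conjM.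
      congr (_ * (_ / _)).
        by apply: complex_ext; rewrite !ReImE /=; ring.
      by apply: complex_ext; rewrite !ReImE /=; ring.
    by field; rewrite vw.
  have -> : 2 * (pi * X) = cmod (2 * pi%:C * 'i * ((g v + (g w)^*) / (v - w^*))).
    rewrite !cmodM cmodV cmod_i mulr1 cmod_real ger0_norm ?pi_ge0 //.
    have -> : cmod (2 : C) = 2 by rewrite (_ : (2 : C) = (2 : R)%:C) ?cmod_real ?ger0_norm // rmorphMn.
    by rewrite -!mulrA.
  rewrite -e3; apply: (@cmod_cint_le_ext _ _ _ (fun x => t * h w x + t^-1 * h v x)) => //.
  - exact: cintgD.
  - by apply: measurable_funD; exact: measurable_cstM.
  - by move=> x; rewrite addr_ge0 // mulr_ge0 // ?invr_ge0 ltW.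
  - rewrite (mulrC _ t^-1); apply: integral_le_add.
    + exact: measurable_cstM.
    + exact: measurable_cstM.
    + by move=> x; rewrite mulr_ge0 // ltW.
    + by move=> x; rewrite mulr_ge0 // invr_ge0 ltW.
    + by apply: integral_cstM => //; [exact: ltW|rewrite ew].
    + by apply: integral_cstM => //; [rewrite invr_ge0 ltW|rewrite ev].
  - suff bnd (x : R) : cmod (g (x +i* 0) / (x +i* 0 - w^*) / (x +i* 0 - v) +
        (g (x +i* 0) / (x +i* 0 - v^*) / (x +i* 0 - w))^*) <= t * h w x + t^-1 * h v x.
      by move=> x _; exact: bnd.
    have [n1 n2] := nzr x v v0; have [n3 n4] := nzr x w w0.
    have cj (a : C) : (x +i* 0 - a)^* = x +i* 0 - a^*.
      by apply: complex_ext; rewrite !ReImE /=; ring.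
    have -> : g (x +i* 0) / (x +i* 0 - w^*) / (x +i* 0 - v) +
      (g (x +i* 0) / (x +i* 0 - v^*) / (x +i* 0 - w))^* =
      (2 * Re (g (x +i* 0)))%:C / (x +i* 0 - w^*) / (x +i* 0 - v).
      rewrite !conjM !conjV !cj conjcK.
      have -> : (2 * Re (g (x +i* 0)))%:C = g (x +i* 0) + (g (x +i* 0))^*.
        by apply: complex_ext; rewrite !ReImE /=; ring.
      by field; rewrite n1 n4.
    rewrite !cmodM !cmodV cmod_real ger0_norm ?mulr_ge0 ?pg //.
    rewrite -cj cmod_conj /h; set r := Re (g _).
    have r0 : 0 <= r by rewrite /r pg.
    have c1 : 0 < cmod (x +i* 0 - w) by rewrite cmod_gt0.
    have c2 : 0 < cmod (x +i* 0 - v) by rewrite cmod_gt0.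
    set A := cmod (x +i* 0 - w) in c1 *; set D := cmod (x +i* 0 - v) in c2 *.
    have := ler_wpM2l r0 (amgm A^-1 D^-1 t0).
    have -> : r * ((t * A^-1 ^+ 2 + D^-1 ^+ 2 / t) / 2) =
        (t * (r / A ^+ 2) + t^-1 * (r / D ^+ 2)) / 2.
      by field; rewrite !gt_eqF.
    have -> : 2 * r / A / D = 2 * (r * (A^-1 * D^-1)) by ring.
    lra.
have pi0 : 0 < pi :> R by exact: pi_gt0.
have X0 : 0 <= X by rewrite divr_ge0 ?cmod_ge0.
have pv : 0 <= Re (g v) by apply: pg; exact: ltW.
have pw : 0 <= Re (g w) by apply: pg; exact: ltW.
have := @sqr_le_amgm X (Re (g w) / Im w) (Re (g v) / Im v) X0
   (divr_ge0 pw (ltW w0)) (divr_ge0 pv (ltW v0)).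
have k2 t : 0 < t -> 2 * X <= t * (Re (g w) / Im w) + Re (g v) / Im v / t.
  move=> /key kk; rewrite -(ler_pM2l pi0); apply: le_trans (le_trans kk _).
    by rewrite mulrCA.
  by rewrite mulrDr (mulrCA pi t) !mulrA.
move=> /(_ k2); rewrite /X expr_div_n.
have cv : 0 < cmod (v - w^*) ^+ 2 by rewrite exprn_gt0 // cmod_gt0.
rewrite ler_pdivrMr // mulf_div => h1.
have vw0 : 0 < Im w * Im v by rewrite mulr_gt0.
rewrite mulrAC ler_pdivlMr // in h1.
by rewrite (mulrC (Im v)) (mulrC (Re (g v))) (mulrC (cmod (v - w^*) ^+ 2)).
Qed.

(** Boundedness is removed by the transform [f / (1 + t f)], which for [t > 0] is bounded by
    [1 / t], keeps a nonnegative real part and tends to [f] as [t] decreases to 0. The parameter of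
    [F] is complex so that [ccont_le] yields the limit. *)
Lemma pick_ineq f v w :
  (forall z, 0 <= Im z -> exists k, cderiv f z k) ->
  (forall z, 0 <= Im z -> 0 <= Re (f z)) ->
  0 < Im v -> 0 < Im w ->
  cmod (f v + (f w)^*) ^+ 2 * (Im v * Im w) <=
    cmod (v - w^*) ^+ 2 * (Re (f v) * Re (f w)).
Proof.
move=> df pf v0 w0.
pose F (d : C) (a : C) := f a / (1 + d * f a).
have cF a : ccont (F^~ a) 0.
  apply: ccont_div.
  - exact: ccont_cst.
  - by apply: ccontD; [exact: ccont_cst|apply: ccontM; [exact: ccont_id|exact: ccont_cst]].
  - by rewrite mul0r addr0 oner_neq0.
have cRe (h : C -> C) z : ccont h z -> ccont (fun d => (Re (h d))%:C) z.
  move=> ch e /ch[d d0 hd]; exists d => // y /hd.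
  by apply: le_lt_trans; rewrite -rmorphB cmod_real -cReB normRe_le.
have F0 a : F 0 a = f a by rewrite /F mul0r addr0 divr1.
have E : cmod ((f v + (f w)^*) ^+ 2 * (Im v * Im w)%:C) =
    cmod (f v + (f w)^*) ^+ 2 * (Im v * Im w).
  by rewrite cmodM cmodX cmod_real ger0_norm // mulr_ge0 // ltW.
rewrite -E -!F0.
have -> : cmod (v - w^*) ^+ 2 * (Re (F 0 v) * Re (F 0 w)) =
   Re ((cmod (v - w^*) ^+ 2)%:C * ((Re (F 0 v))%:C * (Re (F 0 w))%:C)).
  by rewrite !ReImE /=; ring.
apply: (@ccont_le _ (fun d => (F d v + (F d w)^*) ^+ 2 * (Im v * Im w)%:C)
  (fun d => (cmod (v - w^*) ^+ 2)%:C * ((Re (F d v))%:C * (Re (F d w))%:C)) 0 1) => //.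
- apply: ccontM; last exact: ccont_cst.
  by apply: ccontX; apply: ccontD => //; apply: ccont_conj.
- apply: ccontM; first exact: ccont_cst.
  by apply: ccontM; apply: cRe.
move=> t /andP[t0 _]; rewrite add0r.
have den z : 0 <= Im z -> 1 <= Re (1 + t%:C * f z).
  by move=> z0; rewrite !ReImE /= mul0r subr0 lerDl mulr_ge0 ?pf // ltW.
have den0 z : 0 <= Im z -> 1 + t%:C * f z != 0.
  move=> z0; apply/eqP => h; have := den z z0; rewrite h /=; lra.
have ReF z : Re (F t%:C z) = (Re (f z) + t * cmod2 (f z)) / cmod2 (1 + t%:C * f z).
  have [n0|n0] := eqVneq (1 + t%:C * f z) 0.
    by rewrite /F n0 invr0 mulr0 /cmod2 /= expr0n addr0 invr0 mulr0.
  have -> : F t%:C z = f z * (1 + t%:C * f z)^* / (cmod2 (1 + t%:C * f z))%:C.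
    rewrite /F; move: (1 + t%:C * f z) n0 => D n0; rewrite -mulJ.
    have n1 : D^* != 0 by rewrite -cmod_gt0 cmod_conj cmod_gt0.
    by field; rewrite n0 n1.
  rewrite -fmorphV !ReImE /= !mulr0 !subr0; congr (_ / _).
  by rewrite /cmod2; ring.
have := @pick_bounded (F t%:C) t^-1 v w.
rewrite cmodM cmodX cmod_real ger0_norm; last by rewrite mulr_ge0 // ltW.
have -> : Re ((cmod (v - w^*) ^+ 2)%:C * ((Re (F t%:C v))%:C * (Re (F t%:C w))%:C)) =
   cmod (v - w^*) ^+ 2 * (Re (F t%:C v) * Re (F t%:C w)) by rewrite !ReImE /=; ring.
apply => // z z0.
- have [k hk] := df z z0; eexists; apply: (cderiv_div hk _ (den0 z z0)).
  exact: cderivD (cderiv_cst _ _) (cderivZ _ hk).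
- rewrite /F cmodM cmodV ler_pdivrMr; last by rewrite cmod_gt0 den0.
  rewrite -(ler_pM2l t0) mulVKf ?gt_eqF //.
  rewrite -(@ler_pXn2r _ 2) ?nnegrE ?mulr_ge0 ?cmod_ge0 ?(ltW t0) //.
  rewrite exprMn !cmod_sqr /cmod2 !ReImE /= !mul0r !subr0 !addr0 !add0r.
  have := mulr_ge0 (ltW t0) (pf z z0); rewrite !sqrrD !exprMn; lra.
- by rewrite ReF divr_ge0 ?cmod20 // addr_ge0 ?pf // mulr_ge0 ?cmod20 // ltW.
Qed.

(** Both real parts being nonnegative, |f v + conj (f w)| is at least [Re (f v)], so one factor
    [Re (f v)] cancels in Pick's inequality. The constant is crude but sufficient. *)
Lemma harnack_ineq f v w :
  (forall z, 0 <= Im z -> exists k, cderiv f z k) ->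
  (forall z, 0 <= Im z -> 0 <= Re (f z)) ->
  0 < Im v -> 0 < Im w ->
  Re (f v) * (Im v * Im w) <= cmod (v - w^*) ^+ 2 * Re (f w).
Proof.
move=> df pf v0 w0; have pv := pf v (ltW v0); have pw := pf w (ltW w0).
have [->|nv] := eqVneq (Re (f v)) 0.
  by rewrite mul0r mulr_ge0 ?sqr_ge0.
have gv : 0 < Re (f v) by rewrite lt_def nv.
have := pick_ineq df pf v0 w0.
have h : Re (f v) ^+ 2 <= cmod (f v + (f w)^*) ^+ 2.
  rewrite ler_pXn2r ?nnegrE ?cmod_ge0 //; apply: le_trans (Re_le _).
  by rewrite cReD cReJ lerDl.
move=> h2; rewrite -(ler_pM2l gv).
have vw0 : 0 <= Im v * Im w by rewrite mulr_ge0 // ltW.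
have := ler_wpM2r vw0 h; rewrite expr2 => h3.
have -> : Re (f v) * (cmod (v - w^*) ^+ 2 * Re (f w)) =
   cmod (v - w^*) ^+ 2 * (Re (f v) * Re (f w)) by ring.
by apply: le_trans h2; rewrite (mulrA (Re (f v)) (Re (f v))); exact: h3.
Qed.

(** In Pick's inequality at [v = w + t] and [w] the same term [4 Re (f v) Re (f w) (Im w)^2] splits
    off on both sides; the rest carries a factor [t^2], which cancels before [t] tends to 0. *)
Lemma pick_derivative f w k :
  (forall z, 0 <= Im z -> exists k, cderiv f z k) ->
  (forall z, 0 <= Im z -> 0 <= Re (f z)) ->
  0 < Im w -> cderiv f w k -> cmod k * Im w <= Re (f w).
Proof.
move=> df pf w0 [q [cq <- hq]].
have pw := pf w (ltW w0).
have cf : ccont f w by have [k1 /cderiv_cont] := df w (ltW w0).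
have cRe : ccont (fun d => (Re (f d))%:C) w.
  move=> e /cf[d d0 hd]; exists d => // y /hd.
  by apply: le_lt_trans; rewrite -rmorphB cmod_real -cReB normRe_le.
suff : cmod (q w ^+ 2 * (Im w ^+ 2)%:C) <= Re ((Re (f w))%:C * (Re (f w))%:C).
  rewrite cmodM cmodX cmod_real ger0_norm ?sqr_ge0 // -exprMn.
  have -> : Re ((Re (f w))%:C * (Re (f w))%:C) = Re (f w) ^+ 2.
    by rewrite !ReImE /=; ring.
  by rewrite ler_pXn2r // nnegrE // mulr_ge0 ?cmod_ge0 // ltW.
apply: (@ccont_le _ (fun z => q z ^+ 2 * (Im w ^+ 2)%:C)
   (fun z => (Re (f z))%:C * (Re (f w))%:C) w 1) => //.
- by apply: ccontM; [apply: ccontX|exact: ccont_cst].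
- by apply: ccontM => //; exact: ccont_cst.
move=> t /andP[t0 _]; set v := w + t%:C.
have vw : v - w = t%:C by rewrite /v addrC addKr.
have Iv : Im v = Im w by rewrite /v cImD /= addr0.
have v0 : 0 < Im v by rewrite Iv.
have qE : f v - f w = t%:C * q v by rewrite hq vw.
have := pick_ineq df pf v0 w0; rewrite Iv.
rewrite cmodM cmodX cmod_real ger0_norm ?sqr_ge0 //.
have -> : Re ((Re (f v))%:C * (Re (f w))%:C) = Re (f v) * Re (f w) by rewrite !ReImE /=; ring.
have -> : cmod (f v + (f w)^*) ^+ 2 = t ^+ 2 * cmod (q v) ^+ 2 + 4 * (Re (f v) * Re (f w)).
  have -> : t ^+ 2 * cmod (q v) ^+ 2 = cmod (f v - f w) ^+ 2.
    by rewrite qE cmodM cmod_real exprMn real_normK ?num_real.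
  by rewrite !cmod_sqr /cmod2 !ReImE; ring.
have -> : cmod (v - w^*) ^+ 2 = t ^+ 2 + 4 * Im w ^+ 2.
  rewrite /v cmod_sqr /cmod2 !ReImE /=; ring.
move=> h; have t2 : 0 < t ^+ 2 by rewrite exprn_gt0.
by rewrite -(ler_pM2l t2); move: h; rewrite -expr2; lra.
Qed.

End Pick.

(** * Primitives, Harnack and Liouville *)

Section ComplexExponential.
Variable R : realType.
Local Notation C := R[i].
Implicit Types (f : C -> C) (z w : C).

Lemma cderiv_eps f z k :
  (forall e : R, 0 < e -> exists2 d : R, 0 < d & forall w, cmod (w - z) < d ->
     cmod (f w - f z - k * (w - z)) <= e * cmod (w - z)) -> cderiv f z k.
Proof.
move=> h; exists (fun w => if w == z then k else (f w - f z) / (w - z)); split.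
- move=> e e0; have e2 : 0 < e / 2 by lra.
  have [d d0 hd] := h _ e2; exists d => // w wd; rewrite eqxx.
  case: eqVneq => [_|wz]; first by rewrite subrr cmod0.
  have wz0 : w - z != 0 by rewrite subr_eq0.
  have -> : (f w - f z) / (w - z) - k = (f w - f z - k * (w - z)) / (w - z).
    by rewrite [RHS]mulrBl mulfK.
  rewrite cmodM cmodV ltr_pdivrMr ?cmod_gt0 //; apply: le_lt_trans (hd _ wd) _.
  by rewrite ltr_pM2r ?cmod_gt0 //; lra.
- by rewrite eqxx.
- move=> w; case: eqVneq => [->|wz]; first by rewrite !subrr mul0r.
  by rewrite mulrC divfK // subr_eq0.
Qed.

Lemma cexpD z w : cexp (z + w) = cexp z * cexp w.
Proof.
by apply: complex_ext; rewrite /cexp ?ReImE /= ?ReImE expRD ?cosD ?sinD; ring.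
Qed.

Lemma cexp0 : cexp (0 : C) = 1.
Proof. by apply: complex_ext; rewrite /= expR0 ?cos0 ?sin0; ring. Qed.

Lemma cmod_cexp z : cmod (cexp z) = expR (Re z).
Proof.
rewrite /cmod /cmod2 /= !exprMn -mulrDr cos2Dsin2 mulr1 sqrtr_sqr.
by rewrite ger0_norm ?expR_ge0.
Qed.

Lemma cexp_neq0 z : cexp z != 0.
Proof. by rewrite -cmod_gt0 cmod_cexp expR_gt0. Qed.

Lemma cexpN z : cexp (- z) = (cexp z)^-1.
Proof.
by apply: (mulfI (cexp_neq0 z)); rewrite -cexpD subrr cexp0 divff ?cexp_neq0.
Qed.

Lemma cexp_conj z : (cexp z)^* = cexp (z^*).
Proof. by case: z => a b; rewrite /cexp /= cosN sinN mulrN. Qed.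

Lemma is_derive_eps (r : R -> R) (t k : R) : is_derive t 1 r k ->
  forall e, 0 < e -> exists2 d, 0 < d & forall s, `|s - t| < d ->
    `|r s - r t - k * (s - t)| <= e * `|s - t|.
Proof.
move=> [dr rk] e e0.
have := dr; rewrite /derivable => /cvg_ex[l hl].
have lk : l = k by rewrite -rk /derive; apply/esym/cvg_lim.
rewrite lk in hl; move/cvgrPdist_le : hl => /(_ _ e0) /nbhs_ballP[d /= d0 hd].
exists d => // s sd; have [->|st] := eqVneq s t; first by rewrite !subrr mulr0 subr0 normr0 mulr0.
have st0 : s - t != 0 by rewrite subr_eq0.
have := hd (s - t); rewrite /ball /= sub0r normrN => /(_ sd st0).
rewrite /GRing.scale /= mulr1 subrK distrC => h.
have -> : r s - r t - k * (s - t) = ((s - t)^-1 * (r s - r t) - k) * (s - t).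
  by rewrite mulrBl -mulrA (mulrC (r s - r t)) mulKf.
by rewrite normrM ler_wpM2r.
Qed.

Lemma eps_is_derive0 (r : R -> R) (t : R) :
  (forall e, 0 < e -> exists2 d, 0 < d & forall s, `|s - t| < d ->
    `|r s - r t| <= e * `|s - t|) -> is_derive t 1 r 0.
Proof.
move=> h; have c : (fun s => s^-1 *: (r (s *: 1 + t) - r t)) @ 0^' --> (0 : R).
  apply/cvgrPdist_le => e e0; have [d d0 hd] := h e e0.
  apply/nbhs_ballP; exists d => //= s; rewrite /ball /= !sub0r !normrN => sd s0.
  have := hd (s + t); rewrite addrK => /(_ sd).
  rewrite /GRing.scale /= mulr1 normrM normfV ler_pdivrMl ?normr_gt0 //.
  by rewrite mulrC.
by split; [apply/cvg_ex; exists 0|exact: cvg_lim c].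
Qed.

Lemma cderiv_cexp0 : cderiv (@cexp R) 0 1.
Proof.
apply: cderiv_eps => e e0.
have e4 : 0 < e / 8 by lra.
have dc : is_derive (0 : R) 1 (@cos R) 0.
  by apply: is_derive_eq; rewrite sin0 oppr0.
have ds : is_derive (0 : R) 1 (@sin R) 1.
  by apply: is_derive_eq; rewrite cos0.
have de : is_derive (0 : R) 1 (@expR R) 1.
  by apply: is_derive_eq; rewrite expR0.
have [d1 d10 h1] := is_derive_eps dc e4.
have [d2 d20 h2] := is_derive_eps ds e4.
have [d3 d30 h3] := is_derive_eps de e4.
have [d4 d40 h4] := is_derive_eps de ltr01.
(* [1 / 4] keeps [expR a] below 2, and [e / 8] makes the mixed term [(expR a - 1) * b] small; the
   errors add up to seven times [e / 8 * N]. *)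
pose m := Num.min (Num.min d1 d2) (Num.min d3 (Num.min d4 (Num.min (1/4) (e / 8)))).
have m0 : 0 < m by rewrite /m !lt_min d10 d20 d30 d40 e4; apply/andP; split; lra.
exists m => // w; rewrite !subr0 cexp0 mul1r => wm.
have /= := normRe_le w; have /= := normIm_le w.
case: w wm => a b; set N := cmod _ => wm /= bN aN.
move: wm; rewrite /m !lt_min => /andP[/andP[n1 n2] /and4P[n3 n4 n5 n6]].
have := h1 b; have := h2 b; have := h3 a; have := h4 a.
rewrite !subr0 cos0 sin0 expR0 !mul1r mul0r !subr0.
move=> /(_ (le_lt_trans aN n4)) k4 /(_ (le_lt_trans aN n3)) k3.
move=> /(_ (le_lt_trans bN n2)) k2 /(_ (le_lt_trans bN n1)) k1.
have ea : expR a <= 2.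
  have := ler_norm (expR a - 1 - a); have := ler_norm a; lra.
have ea0 := expR_ge0 a.
have ea1 : `|expR a - 1| <= 2 * `|a|.
  have := ler_normD (expR a - 1 - a) a; rewrite subrK; lra.
apply: le_trans (cmod_le _) _; rewrite !cReB !cImB /= subr0.
have N0 : 0 <= N := le_trans (normr_ge0 _) aN.
have r1 : `|expR a * cos b - 1 - a| <= 2 * (e / 8 * N) + e / 8 * N.
  have -> : expR a * cos b - 1 - a = expR a * (cos b - 1) + (expR a - 1 - a) by ring.
  apply: le_trans (ler_normD _ _) _; apply: lerD.
    rewrite normrM (ger0_norm ea0); apply: ler_pM => //.
    by apply: le_trans k1 _; rewrite ler_wpM2l // ltW.
  by apply: le_trans k3 _; rewrite ler_wpM2l // ltW.
have r2 : `|expR a * sin b - b| <= 2 * (e / 8 * N) + 2 * (e / 8 * N).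
  have -> : expR a * sin b - b = expR a * (sin b - b) + (expR a - 1) * b by ring.
  apply: le_trans (ler_normD _ _) _; apply: lerD; rewrite normrM.
    rewrite (ger0_norm ea0); apply: ler_pM => //.
    by apply: le_trans k2 _; rewrite ler_wpM2l // ltW.
  rewrite (mulrA 2 (e / 8)); apply: ler_pM => //; apply: le_trans ea1 _.
  by rewrite ler_pM2l //; apply: le_trans aN (ltW n6).
have := mulr_ge0 (ltW e0) N0; clear -r1 r2; lra.
Qed.

Lemma cderiv_cexp z : cderiv (@cexp R) z (cexp z).
Proof.
have E : (@cexp R) = fun w => cexp z * cexp (w - z).
  by apply/funext => w; rewrite -cexpD addrC subrK.
rewrite {1}E; have ds : cderiv (fun w => w - z) z (1 - 0).
  by apply: cderivB; [exact: cderiv_id|exact: cderiv_cst].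
have d0 : cderiv (@cexp R) (z - z) 1 by rewrite subrr; exact: cderiv_cexp0.
have := cderivZ (cexp z) (cderiv_comp ds d0).
by rewrite subr0 !mulr1.
Qed.

Lemma real_const (r : R -> R) (a b : R) :
  (forall t : R, is_derive t 1 r 0) -> r a = r b.
Proof. by move=> dr; apply: is_derive_0_is_cst. Qed.

(* A vertical half-line is traversed by [t |-> h + t ^ 2], which is defined for
   all real [t]. *)
Lemma half_plane_const f (h : R) z w :
  (forall z, h <= Im z -> cderiv f z 0) -> h <= Im z -> h <= Im w -> f z = f w.
Proof.
move=> df.
(* Along a locally Lipschitz path [f] has zero derivative; [u] stands for its real or imaginary
   part. *)
have path (g : R -> C) s t :
    (forall t, h <= Im (g t)) ->
    (forall t, exists2 l : R, 0 < l & exists2 d : R, 0 < d &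
       forall s, `|s - t| < d -> cmod (g s - g t) <= l * `|s - t|) ->
    f (g s) = f (g t).
  move=> gh gl; have D (u : R -> R) : (forall s t, `|u s - u t| <= cmod (f (g s) - f (g t))) ->
      u s = u t.
    move=> uf; apply: real_const => t0; apply: eps_is_derive0 => e e0.
    have [l l0 [d d0 hl]] := gl t0.
    have [q [cq q0 hq]] := df _ (gh t0).
    have [d1 d10 h1] := cq (e / l) (divr_gt0 e0 l0).
    exists (Num.min d (d1 / l)); first by rewrite lt_min d0 divr_gt0.
    move=> t1; rewrite lt_min => /andP[/hl k1 k2]; apply: le_trans (uf _ _) _.
    rewrite hq cmodM; have k3 : cmod (g t1 - g t0) < d1.
      by apply: le_lt_trans k1 _; rewrite mulrC -ltr_pdivlMr.
    have := h1 _ k3; rewrite q0 subr0 => k4.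
    apply: (@le_trans _ _ (l * `|t1 - t0| * (e / l))).
      by apply: ler_pM; rewrite ?cmod_ge0 // ltW.
    suff -> : l * `|t1 - t0| * (e / l) = e * `|t1 - t0| by [].
    by field; rewrite gt_eqF.
  apply: complex_ext.
    by apply: (D (fun t => Re (f (g t)))) => s1 t1; rewrite -cReB normRe_le.
  by apply: (D (fun t => Im (f (g t)))) => s1 t1; rewrite -cImB normIm_le.
have horiz (x x' y : R) : h <= y -> f (x +i* y) = f (x' +i* y).
  move=> hy; apply: (path (fun t => t +i* y) x x') => // t.
  exists 1 => //; exists 1 => // s _.
  have -> : s +i* y - t +i* y = (s - t)%:C by apply: complex_ext; rewrite !ReImE /= ?subrr.
  by rewrite cmod_real mul1r.
have vert (x y : R) : h <= y -> f (x +i* y) = f (x +i* h).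
  move=> hy; have := path (fun t => x +i* (h + t ^+ 2)) (Num.sqrt (y - h)) 0.
  rewrite sqr_sqrtr ?subr_ge0 // expr0n addr0 subrKC; apply.
    by move=> t /=; rewrite lerDl sqr_ge0.
  move=> t; exists (2 * `|t| + 1); first by rewrite ltr_wpDl // mulr_ge0.
  exists 1 => // s st.
  have -> : x +i* (h + s ^+ 2) - x +i* (h + t ^+ 2) = 'i * ((s - t) * (s + t))%:C.
    by apply: complex_ext; rewrite !ReImE /=; ring.
  rewrite cmodM cmod_i mul1r cmod_real normrM mulrC ler_wpM2r //.
  have := ler_normD (s - t) (2 * t); have -> : s - t + 2 * t = s + t by ring.
  rewrite normrM (ger0_norm (ler0n _ 2)); lra.
case: z w => [x y] [x' y'] /= hy hy'.
by rewrite (vert x y) // (vert x' y') //; apply: horiz.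
Qed.

End ComplexExponential.

(** * Primitives on half-planes and the bound on logarithmic derivatives *)

Section Primitive.
Variable R : realType.
Local Notation C := R[i].
Implicit Types (f k : C -> C) (g : R -> C) (z w : C).

Lemma cint_point g (a : R) : pcont g a -> cint `[a, a] g = 0.
Proof.
move=> cg; have /(cint_itv_split _) : cintg `[a, a] g.
  by apply: pcont_cintg => t /andP[ta at_]; have -> : t = a by apply: le_anti; rewrite ta at_.
by move=> /(_ a); rewrite lexx => /(_ isT)/eqP; rewrite -subr_eq0 opprD addrA subrr sub0r oppr_eq0 => /eqP.
Qed.

Lemma cint_empty g (a b : R) : b < a -> cint `[a, b] g = 0.
Proof.
move=> ba; have E : [set` `[a, b]] = set0 :> set R.
  by apply/seteqP; split => // t; rewrite /= in_itv /= => /andP[h1 h2]; move: (le_trans h1 h2); rewrite leNgt ba.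
by rewrite /cint E !Rintegral_set0.
Qed.

(* One of the two intervals is empty or a point, so this is the integral from
   [0] to [x] with its sign. *)
Definition cint0 g (x : R) := cint `[0, x] g - cint `[x, 0] g.

Lemma cint0_sub g (a b : R) : (forall t, pcont g t) -> a <= b ->
  cint0 g b - cint0 g a = cint `[a, b] g.
Proof.
move=> cg ab; have ci x y : cintg `[x, y] g by apply: pcont_cintg => t _.
rewrite /cint0; have [a0|a0] := leP 0 a.
  rewrite (@cint_itv_split _ g 0 a b) ?a0 //.
  have E x : 0 <= x -> cint `[x, 0] g = 0.
    rewrite le_eqVlt => /predU1P[<-|/cint_empty//]; exact: cint_point.
  by rewrite !E ?(le_trans a0 ab) // !subr0 addrC addKr.
rewrite (cint_empty _ a0) sub0r opprK; have [b0|b0] := leP 0 b.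
  rewrite (@cint_itv_split _ g a 0 b) ?b0 ?ltW // (addrC (cint _ _)).
  have -> : cint `[b, 0] g = 0.
    move: b0; rewrite le_eqVlt => /predU1P[<-|/cint_empty//]; exact: cint_point.
  by rewrite ?subr0 ?oppr0 ?add0r addrC.
rewrite (cint_empty _ b0) sub0r (@cint_itv_split _ g a b 0) ?ab ?ltW //.
by rewrite addrC addrK.
Qed.

Lemma cint_near_cst g (c : C) (a b e : R) : a <= b ->
  (forall t, a <= t <= b -> pcont g t) ->
  (forall t, a <= t <= b -> cmod (g t - c) <= e) ->
  cmod (cint `[a, b] g - c * (b - a)%:C) <= e * (b - a).
Proof.
move=> ab cg h; have mD : @measurable _ (measurableTypeR R) `[a, b] by [].
have pc t : pcont (fun=> c) t by move=> d d0; exists 1 => // s _; rewrite subrr cmod0.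
rewrite -cint_itv_cst // -cintB //; last 2 first.
- exact: pcont_cintg.
- by apply: pcont_cintg => t _.
by apply: cmod_cint_itv_le => // t /cg ct; exact: pcontB.
Qed.

(** The primitive integrates along the line [Im z = h] from abscissa 0 and then vertically. Vertical
    increments are immediate; Goursat's theorem on a rectangle standing on that line turns
    horizontal increments into integrals at height [y]. *)
Lemma half_plane_primitive k (h : R) :
  (forall z, h <= Im z -> exists d, cderiv k z d) ->
  exists F, forall z, h < Im z -> cderiv F z (k z).
Proof.
move=> dk; have ck z : h <= Im z -> ccont k z by move=> /dk[d /cderiv_cont].
pose F (z : C) := cint0 (fun t => k (t +i* h)) (Re z) +
  'i * cint `[h, Im z] (fun t => k (Re z +i* t)).
have ch (x y : R) : h <= y -> pcont (fun t => k (t +i* y)) x.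
  by move=> hy; apply: pcont_horizontal; apply: ck.
have cv (x y : R) : h <= y -> pcont (fun t => k (x +i* t)) y.
  by move=> hy; apply: pcont_vertical; apply: ck.
have Fv (x y y' : R) : h <= y -> y <= y' ->
    F (x +i* y') - F (x +i* y) = 'i * cint `[y, y'] (fun t => k (x +i* t)).
  move=> hy yy; rewrite /F /= (@cint_itv_split _ _ h y y') ?hy //; last first.
    by apply: pcont_cintg => t /andP[ht _]; exact: cv.
  by ring.
have Fh (x x' y : R) : h < y -> x <= x' ->
    F (x' +i* y) - F (x +i* y) = cint `[x, x'] (fun t => k (t +i* y)).
  move=> hy; rewrite le_eqVlt => /predU1P[->|xx].
    by rewrite subrr cint_point //; apply: ch; exact: ltW.
  have mD (a b : R) : @measurable _ (measurableTypeR R) `[a, b] by [].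
  have := @goursat _ k x x' h y xx hy; rewrite /bdry.
  have ci (y0 : R) : h <= y0 -> cintg `[x, x'] (fun t => k (t +i* y0)).
    by move=> hy0; apply: pcont_cintg => t _; exact: ch.
  have cj (x0 : R) : cintg `[h, y] (fun t => k (x0 +i* t)).
    by apply: pcont_cintg => t /andP[ht _]; exact: cv.
  rewrite (@cintB _ _ (fun t => k (t +i* h)) (fun t => k (t +i* y))) //; last 2 first.
  - exact: ci.
  - by apply: ci; exact: ltW.
  rewrite (@cintB _ _ (fun t => k (x' +i* t)) (fun t => k (x +i* t))) //.
  move=> G; have /G {}G : holo_on k x x' h y.
    by move=> u v _ /andP[hv _]; exact: dk.
  rewrite /F /= -[RHS]addr0 -G.
  rewrite -(@cint0_sub (fun t => k (t +i* h)) x x') ?ltW //; last by move=> t; exact: ch.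
  by ring.
exists F => z hz; apply: cderiv_eps => e e0.
have [d d0 hd] := ck z (ltW hz) (e / 2) (divr_gt0 e0 (ltr0n _ 2)).
exists (Num.min d (Im z - h)); first by rewrite lt_min d0 subr_gt0.
case: z hz hd => x0 y0 /= hy0 hd [x y]; rewrite lt_min => /andP[w1 w2].
have /= nx := normRe_le (x +i* y - (x0 +i* y0)).
have /= ny := normIm_le (x +i* y - (x0 +i* y0)).
have hy : h < y by have := ler_norm (- (y - y0)); rewrite normrN; lra.
have near (u v : R) : `|u - x0| <= `|x - x0| -> `|v - y0| <= `|y - y0| ->
    cmod (k (u +i* v) - k (x0 +i* y0)) <= e / 2.
  move=> hu hv; apply/ltW/hd; apply: le_lt_trans w1.
  rewrite -(@ler_pXn2r _ 2) ?nnegrE ?cmod_ge0 // !cmod_sqr !cmod2_sub.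
  have sq (s t : R) : `|s| <= `|t| -> s ^+ 2 <= t ^+ 2.
    by move=> st; rewrite -(real_normK (num_real s)) -(real_normK (num_real t)) ler_pXn2r ?nnegrE.
  by rewrite lerD // sq.
set K := k (x0 +i* y0).
have bx : cmod (F (x +i* y0) - F (x0 +i* y0) - K * (x - x0)%:C) <= e / 2 * `|x - x0|.
  have [xx|xx] := leP x0 x.
    rewrite Fh // ger0_norm ?subr_ge0 //; apply: cint_near_cst => // t.
      by move=> _; apply: ch; exact: ltW.
    move=> /andP[t1 t2]; apply: near; last by rewrite subrr normr0.
    by rewrite !ger0_norm ?subr_ge0 // lerB.
  rewrite -cmodN distrC ger0_norm ?subr_ge0 ?(ltW xx) //.
  have -> : - (F (x +i* y0) - F (x0 +i* y0) - K * (x - x0)%:C) =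
     F (x0 +i* y0) - F (x +i* y0) - K * (x0 - x)%:C by rewrite !rmorphB /=; ring.
  rewrite Fh ?(ltW xx) //; apply: cint_near_cst; rewrite ?(ltW xx) // => t.
    by move=> _; apply: ch; exact: ltW.
  move=> /andP[t1 t2]; apply: near; last by rewrite subrr normr0.
  by rewrite !(distrC _ x0) !ger0_norm ?subr_ge0 ?(ltW xx) // lerB.
have by_ : cmod (F (x +i* y) - F (x +i* y0) - K * ('i * (y - y0)%:C)) <= e / 2 * `|y - y0|.
  have [yy|yy] := leP y0 y.
    rewrite Fv ?(ltW hy0) // mulrCA -mulrBr cmodM cmod_i mul1r ger0_norm ?subr_ge0 //.
    apply: cint_near_cst => // t /andP[t1 t2].
      by apply: cv; apply: le_trans t1; exact: ltW.
    by apply: near => //; rewrite !ger0_norm ?subr_ge0 // lerB.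
  rewrite -cmodN distrC ger0_norm ?subr_ge0 ?(ltW yy) //.
  have -> : - (F (x +i* y) - F (x +i* y0) - K * ('i * (y - y0)%:C)) =
     F (x +i* y0) - F (x +i* y) - K * ('i * (y0 - y)%:C) by rewrite !rmorphB /=; ring.
  rewrite Fv ?(ltW hy) ?(ltW yy) // mulrCA -mulrBr cmodM cmod_i mul1r.
  apply: cint_near_cst; rewrite ?(ltW yy) // => t /andP[t1 t2].
    by apply: cv; apply: le_trans t1; exact: ltW.
  by apply: near => //; rewrite !(distrC _ y0) !ger0_norm ?subr_ge0 ?(ltW yy) // lerB.
have -> : F (x +i* y) - F (x0 +i* y0) - K * (x +i* y - (x0 +i* y0)) =
   (F (x +i* y0) - F (x0 +i* y0) - K * (x - x0)%:C) +
   (F (x +i* y) - F (x +i* y0) - K * ('i * (y - y0)%:C)).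
  have -> : x +i* y - (x0 +i* y0) = (x - x0)%:C + 'i * (y - y0)%:C.
    by apply: complex_ext; rewrite !ReImE /=; ring.
  by ring.
apply: le_trans (cmodD _ _) _; apply: le_trans (lerD bx by_) _.
have e20 : 0 < e / 2 by lra.
have := ler_wpM2l (ltW e20) nx; have := ler_wpM2l (ltW e20) ny; lra.
Qed.

(* [a (z + i)^2] times a constant is bounded below on [Im z >= h], so its
   logarithm has positive real part there; Harnack's inequality controls the
   derivative of that logarithm. *)
Lemma log_derivative_bound (a a1 : C -> C) (K : R) :
  (forall z, 0 < Im z -> cderiv a z (a1 z)) ->
  (forall z, 0 < Im z -> exists d, cderiv a1 z d) ->
  (forall z, 0 < Im z -> a z != 0) ->
  (forall z, 0 < Im z -> cmod (a z)^-1 <= K * (1 + cmod z) ^+ 2 * (1 + (Im z)^-1)) ->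
  exists c : R, 0 <= c /\ forall z, 0 < Im z ->
    cmod (a1 z / a z) <= c * (1 + cmod z) ^+ 2 * ((Im z) ^- 2 + (Im z) ^- 3).
Proof.
move=> da da1 a0 aK.
have ii0 : 0 < Im ('i : C) by rewrite /=.
have K0 : 0 <= K.
  have := le_trans (cmod_ge0 _) (aK 'i ii0); rewrite /= invr1 cmod_i => h.
  by move: h; rewrite -mulrA pmulr_lge0 //; lra.
set A := cmod (a 'i); have A0 : 0 <= A := cmod_ge0 _.
(* [32 = 4 * 8]: |B i| is [4 * A], and bounding the heights above the line [Im w = h] below by
   [y / 2], [y / 2] and [1 / 2] costs 8. The factor [6 * K + 1] bounds [N] up to [1 + 1 / y], and
   the final 2 pays for [2 / (z + i)]. *)
exists (32 * A * (6 * K + 1) + 2); split.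
  by rewrite addr_ge0 // !mulr_ge0 //; lra.
move=> z z0; set y := Im z in z0 *; set r := cmod z.
have ry : y <= r := Im_le z.
(* The half-plane [Im w >= h] contains [z] and ['i], each at a distance from the edge of at least
   half its height, while [1 / h] is at most [2 + 2 / y]. *)
pose h := Num.min y 1 / 2.
have h0 : 0 < h by rewrite divr_gt0 // lt_min z0 ltr01.
have hy : h <= y / 2 by rewrite ler_pM2r // ge_min lexx.
have h1 : h <= 1 / 2 by rewrite ler_pM2r // ge_min lexx orbT.
have hV : h^-1 <= 2 + 2 / y.
  rewrite /h invf_div; case: (leP y 1) => _; first by lra.
  by rewrite divr1 lerDl divr_ge0 ?ltW.
have p1 (w : C) : 0 < Im w -> w + 'i != 0.
  by move=> w0; apply/eqP => /(congr1 (@complex.Im R)); rewrite !ReImE /=; lra.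
(* The logarithmic derivative of [B] below; its primitive [F] is a logarithm of [B] up to a
   constant. *)
pose L (w : C) := a1 w / a w + 2 / (w + 'i).
have hh : 0 < h / 2 by lra.
have dL w : h / 2 <= Im w -> exists d, cderiv L w d.
  move=> wh; have w0 : 0 < Im w by lra.
  have [d hd] := da1 w w0; eexists; apply: cderivD.
    exact: cderiv_div hd (da w w0) (a0 w w0).
  have dp : cderiv (fun v : C => v + 'i) w (1 + 0).
    exact: cderivD (cderiv_id _) (cderiv_cst _ _).
  exact: (cderiv_div (cderiv_cst _ w) dp (p1 w w0)).
have [F dF] := half_plane_primitive dL.
pose B (w : C) := a w * (w + 'i) ^+ 2.
have B0 w : 0 < Im w -> B w != 0.
  by move=> w0; rewrite mulf_neq0 ?a0 ?expf_neq0 ?p1.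
have cB w : h <= Im w -> cderiv (fun w => B w * cexp (- F w)) w 0.
  move=> wh; have w0 : 0 < Im w by lra.
  have dB : cderiv B w (a1 w * (w + 'i) ^+ 2 + a w * (2%:R * (w + 'i) ^+ 1 * (1 + 0))).
    apply: cderivM (da w w0) _; apply: cderivX.
    exact: cderivD (cderiv_id _) (cderiv_cst _ _).
  have wF : h / 2 < Im w by lra.
  have := cderivM dB (cderiv_comp (cderivN (dF w wF)) (cderiv_cexp _)).
  set u := (X in cderiv _ _ X); have -> // : u = 0.
  by rewrite /u /B /L; field; rewrite a0 // p1.
have [c cE] : exists c, forall w, h <= Im w -> B w * cexp (- F w) = c.
  exists (B 'i * cexp (- F 'i)) => w wh; apply: (half_plane_const cB) => //=; lra.
have BE w : h <= Im w -> B w = c * cexp (F w).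
  by move=> /cE <-; rewrite -mulrA -cexpD addNr cexp0 mulr1.
have c0 : c != 0.
  by apply/eqP => c0; have /eqP := B0 'i ii0; rewrite BE ?c0 ?mul0r //=; lra.
have c00 : 0 < cmod c by rewrite cmod_gt0.
(* Since (1 + |w|)^2 <= 2 |w + i|^2, the growth hypothesis bounds the inverse of |B| by
   [2 * K * (1 + h^-1)] on [Im w >= h]; the extra 1 makes [N] positive. *)
pose N := 2 * K * (1 + h^-1) + 1.
have hV0 : 0 < h^-1 by rewrite invr_gt0.
have N1 : 1 <= N by rewrite lerDr mulr_ge0 ?mulr_ge0 // addr_ge0 // ltW.
have N0 : 0 < N by apply: lt_le_trans N1.
have BN w : h <= Im w -> 1 <= cmod (B w) * N.
  move=> wh; have w0 : 0 < Im w by apply: lt_le_trans wh.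
  have Bw : 0 < cmod (B w) by rewrite cmod_gt0 B0.
  rewrite mulrC -ler_pdivrMr // div1r -cmodV /B invfM cmodM.
  have q : (1 + cmod w) ^+ 2 <= 2 * cmod (w + 'i) ^+ 2.
    have : cmod (w + 'i) ^+ 2 = cmod w ^+ 2 + 2 * Im w + 1.
      by rewrite !cmod_sqr /cmod2 !ReImE /=; ring.
    have := sqr_ge0 (cmod w - 1); rewrite !expr2; move: (cmod w) (cmod _) => s t; lra.
  have q0 : 0 < cmod (w + 'i) ^+ 2 by rewrite exprn_gt0 // cmod_gt0 p1.
  rewrite [cmod (_ ^- 2)]cmodV cmodX ler_pdivrMr //; apply: le_trans (aK w w0) _.
  have wV : (Im w)^-1 <= h^-1 by rewrite lef_pV2.
  apply: (@le_trans _ _ (K * (2 * cmod (w + 'i) ^+ 2) * (1 + h^-1))).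
    apply: ler_pM; rewrite ?mulr_ge0 ?exprn_ge0 ?addr_ge0 ?cmod_ge0 ?invr_ge0 ?(ltW w0) //.
    - by rewrite ler_wpM2l.
    - by rewrite lerD2l.
  have -> : K * (2 * cmod (w + 'i) ^+ 2) * (1 + h^-1) =
     (2 * K * (1 + h^-1)) * cmod (w + 'i) ^+ 2 by ring.
  by rewrite ler_pM2r // lerDl.
(* Up to an imaginary constant, a logarithm of [N * B] moved down by [h]: its real part is
   nonnegative on the closed upper half-plane, so Pick's and Harnack's inequalities apply. *)
pose g (w : C) := F (w + h%:C * 'i) + (ln (cmod c * N))%:C.
have ih (w : C) : Im (w + h%:C * 'i) = Im w + h by rewrite !ReImE /=; ring.
have gE w : 0 <= Im w -> Re (g w) = ln (cmod (B (w + h%:C * 'i)) * N).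
  move=> w0; rewrite /g cReD /= BE ?ih ?lerDr // cmodM cmod_cexp mulrAC.
  by rewrite [in RHS]lnM ?posrE ?mulr_gt0 ?expR_gt0 // expRK addrC.
have dg w d : 0 <= Im w -> w + h%:C * 'i = d -> cderiv g w (L d).
  move=> w0 <-; have s : cderiv (fun v : C => v + h%:C * 'i) w (1 + 0).
    exact: cderivD (cderiv_id _) (cderiv_cst _ _).
  have /(cderiv_comp s) dFw : cderiv F (w + h%:C * 'i) (L (w + h%:C * 'i)).
    by apply: dF; rewrite ih; lra.
  have := cderivD dFw (cderiv_cst (ln (cmod c * N))%:C w).
  by rewrite !addr0 mulr1.
have dg' w : 0 <= Im w -> exists d, cderiv g w d by move=> w0; eexists; exact: (dg _ _ w0 erefl).
have pg w : 0 <= Im w -> 0 <= Re (g w).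
  by move=> w0; rewrite gE // ln_ge0 // BN // ih lerDr.
pose w := z - h%:C * 'i; pose v := 'i - h%:C * 'i : C.
have Iw : Im w = y - h by rewrite /w !ReImE /= -/y; ring.
have Iv : Im v = 1 - h by rewrite /v !ReImE /=; ring.
have w0 : 0 < Im w by rewrite Iw; lra.
have v0 : 0 < Im v by rewrite Iv; lra.
have := pick_derivative dg' pg w0 (dg w z (ltW w0) (subrK _ _)).
have := harnack_ineq dg' pg w0 v0.
have gv : Re (g v) <= 4 * A * N.
  rewrite gE ?(ltW v0) // /v subrK.
  have B1 : cmod (B 'i) = 4 * A.
    rewrite /B cmodM cmodX -/A (_ : 'i + 'i = 2%:C * 'i); last by rewrite rmorphMn /= mulrDl !mul1r.
    by rewrite cmodM cmod_real cmod_i ger0_norm //; ring.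
  have Bi : 0 < cmod (B 'i) * N by rewrite mulr_gt0 // cmod_gt0 B0.
  by rewrite -B1; apply/ltW/ln_sublinear.
have wv : cmod (w - v^*) ^+ 2 <= (1 + r) ^+ 2.
  rewrite ler_pXn2r ?nnegrE ?cmod_ge0 ?addr_ge0 ?cmod_ge0 //.
  have -> : w - v^* = z + (1 - 2 * h)%:C * 'i.
    by apply: complex_ext; rewrite /w /v !ReImE /=; ring.
  apply: le_trans (cmodD _ _) _; rewrite cmodM cmod_i mulr1 cmod_real ger0_norm; last by lra.
  by rewrite -/r; lra.
have r0 : 0 <= r := cmod_ge0 z.
set S := (1 + r) ^+ 2 in wv *.
have S0 : 0 <= S by rewrite sqr_ge0.
set X := cmod (L z); set G := Re (g w) => HG XG.
have X0 : 0 <= X := cmod_ge0 _.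
have XS : X <= 32 * A * N * S * y ^- 2.
  rewrite ler_pdivlMr ?exprn_gt0 //.
  have t1 : G * (Im w * Im v) <= S * (4 * A * N).
    apply: le_trans HG _; apply: ler_pM wv gv; rewrite ?exprn_ge0 ?cmod_ge0 //.
    by apply: pg; exact: ltW.
  have t2 : X * Im w * (Im w * Im v) <= S * (4 * A * N).
    by apply: le_trans t1; rewrite ler_wpM2r // mulr_ge0 // ltW.
  have t3 : y / 2 * (y / 2 * (1 / 2)) <= Im w * (Im w * Im v).
    have y2 : 0 <= y / 2 by rewrite divr_ge0 // ltW.
    have q2 : 0 <= 1 / 2 :> R by rewrite divr_ge0.
    have yh : y / 2 <= y - h by clear -hy; lra.
    have hh1 : 1 / 2 <= 1 - h by clear -h1; lra.
    by rewrite Iw Iv; apply: ler_pM => //; [exact: mulr_ge0|exact: ler_pM].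
  have t4 : X * y ^+ 2 / 8 <= S * (4 * A * N).
    apply: le_trans t2; have -> : X * y ^+ 2 / 8 = X * (y / 2 * (y / 2 * (1 / 2))) by field.
    by rewrite -[X * Im w * _]mulrA ler_wpM2l.
  have -> : 32 * A * N * S = S * (4 * A * N) * 8 by ring.
  by rewrite -ler_pdivrMr.
have yV : 0 < y^-1 by rewrite invr_gt0.
have NK : N <= (6 * K + 1) * (1 + y^-1).
  have := ler_wpM2l K0 hV; have := mulr_ge0 K0 (ltW yV); rewrite /N; clear -yV; lra.
have y3 : y ^- 3 = y ^- 2 * y^-1 by rewrite -invfM exprSr.
have y20 : 0 < y ^- 2 by rewrite invr_gt0 exprn_gt0.
have La : a1 z / a z = L z - 2 / (z + 'i) by rewrite /L addrK.
rewrite La; apply: le_trans (cmodB _ _) _.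
have l1 : X <= 32 * A * (6 * K + 1) * S * (y ^- 2 + y ^- 3).
  apply: le_trans XS _; rewrite y3.
  have -> : 32 * A * (6 * K + 1) * S * (y ^- 2 + y ^- 2 * y^-1) =
     (32 * A * ((6 * K + 1) * (1 + y^-1)) * S) * y ^- 2 by ring.
  rewrite ler_pM2r // ler_wpM2r // ler_wpM2l // mulr_ge0 //.
have l2 : cmod (2 / (z + 'i)) <= 2 * S * (y ^- 2 + y ^- 3).
  have q : 1 <= cmod (z + 'i).
    by apply: le_trans (Im_le _); rewrite cImD /= -/y lerDr ltW.
  have S1 : 1 <= S * y ^- 2.
    by rewrite ler_pdivlMr ?exprn_gt0 // mul1r ler_pXn2r ?nnegrE ?addr_ge0 ?(ltW z0) //; lra.
  rewrite cmodM cmodV (_ : 2 = 2%:C) ?cmod_real ?ger0_norm //; last by rewrite rmorphMn.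
  rewrite ler_pdivrMr; last by apply: lt_le_trans q.
  have t1 : 2 <= 2 * S * (y ^- 2 + y ^- 3).
    have S3 : 0 <= S * y ^- 3 by rewrite mulr_ge0 // invr_ge0 exprn_ge0 ?ltW.
    by rewrite -mulrA mulrDr; move: S1 S3; clear; move: (S * _) (S * _) => s1 s2; lra.
  by apply: (le_trans t1); rewrite ler_peMr //; apply: le_trans t1.
by apply: le_trans (lerD l1 l2) _; rewrite -!mulrDl.
Qed.

End Primitive.

(** * A Liouville theorem with a singular bound at the real axis *)

Section Liouville.
Variable R : realType.
Local Notation C := R[i].
Local Notation mu := (@lebesgue_measure R).
Implicit Types (p : C -> C) (g : R -> C) (z w : C).

Lemma Im_cint_ge g (c a b : R) : a <= b ->
  (forall t, a <= t <= b -> pcont g t) ->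
  (forall t, a <= t <= b -> c <= Im (g t)) ->
  c * (b - a) <= Im (cint `[a, b] g).
Proof.
move=> ab cg h; have [_ gi] := pcont_cintg cg.
have [_ ci] : cintg `[a, b] (fun=> 'i * c%:C).
  by apply: pcont_cintg => t _ e e0; exists 1 => // s _; rewrite subrr cmod0.
have -> : c * (b - a) = Im (cint `[a, b] (fun=> 'i * c%:C)).
  by rewrite cint_itv_cst // !ReImE /=; ring.
apply: le_Rintegral => // x; rewrite /= in_itv /= => /h.
by rewrite /= !mul0r mul1r add0r.
Qed.

(** The integral is [2 pi i], but any positive lower bound independent of [r] and [z] serves, and a
    pointwise bound on the integrands gives one directly. *)
Lemma Im_bdry_kernel_ge (r : R) z : 0 < r -> cmod z <= r / 2 ->
  8 / 9 <= Im (bdry (fun w => (w - z)^-1) (- r) r (- r) r).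
Proof.
case: z => u v r0 zr; have /ler_normlP[v1 v2] : `|v| <= r / 2 := le_trans (normIm_le _) zr.
have /ler_normlP[u1 u2] : `|u| <= r / 2 := le_trans (normRe_le _) zr.
have nz (x y : R) : x - u != 0 \/ y - v != 0 -> x +i* y - (u +i* v) != 0.
  by case=> h; apply: contra_neq h => /eqP; rewrite eq_complex /= => /andP[/eqP h1 /eqP h2].
have cK (x y : R) : x - u != 0 \/ y - v != 0 -> ccont (fun w => (w - (u +i* v))^-1) (x +i* y).
  by move=> /nz h; apply: ccont_kernel; rewrite -subr_eq0.
have x1 : r - u != 0 by lra.
have x2 : - r - u != 0 by lra.
have y1 : r - v != 0 by lra.
have y2 : - r - v != 0 by lra.
have rr : - r <= r by lra.
have mD : @measurable _ (measurableTypeR R) `[- r, r] by [].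
have inv (x y : R) : (x +i* y - (u +i* v))^-1 =
    ((x - u) / ((x - u) ^+ 2 + (y - v) ^+ 2)) +i* (- (y - v) / ((x - u) ^+ 2 + (y - v) ^+ 2)).
  by apply: complex_ext; rewrite /= ?mulNr.
(* each of the four sides contributes at least [1 / (9 r)] per unit length *)
have low (s t : R) : r / 2 <= s -> s <= 3 / 2 * r -> `|t| <= 3 / 2 * r ->
    1 / (9 * r) <= s / (s ^+ 2 + t ^+ 2).
  move=> s1 s2 t1; have s0 : 0 < s by lra.
  have st : 0 < s ^+ 2 + t ^+ 2 by rewrite ltr_pwDl ?exprn_gt0 ?sqr_ge0.
  have r9 : 0 < 9 * r by lra.
  rewrite ler_pdivrMr // mulrAC ler_pdivlMr // mul1r.
  have t2 : t ^+ 2 <= 9 / 4 * r ^+ 2.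
    have -> : 9 / 4 * r ^+ 2 = (3 / 2 * r) ^+ 2 by field.
    by rewrite -(real_normK (num_real t)) ler_pXn2r ?nnegrE //; lra.
  have s3 : s ^+ 2 <= 9 / 4 * r ^+ 2.
    have -> : 9 / 4 * r ^+ 2 = (3 / 2 * r) ^+ 2 by field.
    by rewrite ler_pXn2r ?nnegrE //; lra.
  have := ler_wpM2r (ltW r9) s1.
  have -> : r / 2 * (9 * r) = 9 / 2 * r ^+ 2 by field.
  by move: t2 s3; move: (s * _) (s ^+ 2) (t ^+ 2) (r ^+ 2) => *; lra.
have bnd (t w : R) : - r <= t <= r -> - w <= r / 2 -> w <= r / 2 -> `|t - w| <= 3 / 2 * r.
  by move=> /andP[t1 t2] w1 w2; apply/ler_normlP; split; lra.
rewrite /bdry cImD.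
have h1 : 2 / (9 * r) * (r - - r) <= Im (cint `[- r, r] (fun x =>
    (x +i* - r - (u +i* v))^-1 - (x +i* r - (u +i* v))^-1)).
  apply: Im_cint_ge => // t tr.
    by apply: pcontB; apply: (@pcont_horizontal _ (fun w => (w - (u +i* v))^-1)); apply: cK; right.
  rewrite !inv cImB /= mulNr mulNr opprK.
  have l1 := low (r + v) (t - u); have l2 := low (r - v) (t - u).
  have := l2 ltac:(lra) ltac:(lra) (bnd _ _ tr u1 u2).
  have := l1 ltac:(lra) ltac:(lra) (bnd _ _ tr u1 u2).
  rewrite (addrC (_ ^+ 2) ((t - u) ^+ 2)) (addrC (_ ^+ 2) ((t - u) ^+ 2)).
  have -> : (- r - v) ^+ 2 = (r + v) ^+ 2 by ring.
  have -> : - ((- r - v) / ((t - u) ^+ 2 + (r + v) ^+ 2)) = (r + v) / ((t - u) ^+ 2 + (r + v) ^+ 2) by ring.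
  have -> : 2 / (9 * r) = 1 / (9 * r) + 1 / (9 * r) by rewrite -mulrDl.
  by move=> k1 k2; exact: lerD.
have h2 : 2 / (9 * r) * (r - - r) <= Im ('i * cint `[- r, r] (fun y =>
    (r +i* y - (u +i* v))^-1 - (- r +i* y - (u +i* v))^-1)).
  have cg t : - r <= t <= r -> pcont (fun y =>
    (r +i* y - (u +i* v))^-1 - (- r +i* y - (u +i* v))^-1) t.
    by move=> _; apply: pcontB; apply: (@pcont_vertical _ (fun w => (w - (u +i* v))^-1)); apply: cK; left.
  rewrite -cintZ //; last exact: pcont_cintg.
  apply: Im_cint_ge => // t tr.
    by move=> e /(cg t tr)[d d0 hd]; exists d => // s /hd; rewrite -mulrBr cmodM cmod_i mul1r.
  rewrite !inv cImM /= mul0r add0r mul1r.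
  have l1 := low (r - u) (t - v); have l2 := low (r + u) (t - v).
  have := l2 ltac:(lra) ltac:(lra) (bnd _ _ tr v1 v2).
  have := l1 ltac:(lra) ltac:(lra) (bnd _ _ tr v1 v2).
  have -> : (- r - u) ^+ 2 = (r + u) ^+ 2 by ring.
  have -> : - ((- r - u) / ((r + u) ^+ 2 + (t - v) ^+ 2)) = (r + u) / ((r + u) ^+ 2 + (t - v) ^+ 2) by ring.
  have -> : 2 / (9 * r) = 1 / (9 * r) + 1 / (9 * r) by rewrite -mulrDl.
  by move=> k1 k2; exact: lerD.
have E : 2 / (9 * r) * (r - - r) = 4 / 9 by field; lra.
by move: (lerD h1 h2); rewrite E; lra.
Qed.

(* The factor [(w^2 - r^2)^3] vanishes where the square meets the real axis and
   absorbs the blow-up of the bound on [p] there. *)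
Lemma real_singular_liouville p (c : R) : 0 <= c ->
  (forall z, exists d, cderiv p z d) ->
  (forall z, Im z != 0 ->
    cmod (p z) <= c * (1 + cmod z) ^+ 2 * (`|Im z| ^- 2 + `|Im z| ^- 3)) ->
  forall z, p z = p 0.
Proof.
move=> c0 dp pb z0; apply/eqP; rewrite -subr_eq0 -cmod_eq0; apply/negPn/negP => dn.
set D := cmod (p z0 - p 0) in dn; have D0 : 0 < D by rewrite lt_def dn cmod_ge0.
set P := cmod (p 0); have P0 : 0 <= P := cmod_ge0 _.
set Z := cmod z0; have Z0 : 0 <= Z := cmod_ge0 _.
(* On the boundary of the square |q| is at most (3 r |y|)^3 (|p| + P), whence [27]; and
   [18 = 3^2 * 2] because 1 + |w| <= 3 r and |y| + 1 <= 2 r. *)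
set M := 27 * (18 * c + P); have M0 : 0 <= M by rewrite mulr_ge0 // addr_ge0 // mulr_ge0.
(* the estimate below is contradictory for this [r] *)
pose r := 1 + 2 * Z + 9 * (32 * (M * Z)) / D.
have r1 : 1 + 2 * Z <= r by rewrite lerDl; apply: divr_ge0 (ltW D0); do 3!apply: mulr_ge0 => //.
have r0 : 0 < r by lra.
have rr : - r <= r by lra.
pose q w := (w ^+ 2 - (r ^+ 2)%:C) ^+ 3 * (p w - p 0).
have dq w : exists d, cderiv q w d.
  have [d hd] := dp w; eexists; apply: cderivM.
    by apply: cderivX; apply: cderivB (cderiv_cst _ _); apply: cderivX (cderiv_id _).
  exact: cderivB hd (cderiv_cst _ _).
have hq : holo_on q (- r) r (- r) r by move=> x y _ _; exact: dq.
have Zr : Z <= r / 2 by lra.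
have [zR zI] : - r < Re z0 < r /\ - r < Im z0 < r.
  have := le_trans (normRe_le z0) Zr; have := le_trans (normIm_le z0) Zr.
  by move=> /ler_normlP[i1 i2] /ler_normlP[k1 k2]; split; lra.
have z00 : - r < Re (0 : C) < r /\ - r < Im (0 : C) < r by rewrite /=; lra.
have e0 := cauchy_goursat z00.1 z00.2 hq; have e1 := cauchy_formula zR zI hq.
have q0 : q 0 = 0 by rewrite /q subrr mulr0.
have {}e0 := e0 q0.
have far w : cmod w <= r / 2 -> forall x y, - r <= x <= r -> - r <= y <= r ->
    x = - r \/ x = r \/ y = - r \/ y = r -> r / 2 <= cmod (x +i* y - w).
  move=> wr x y _ _ h; have a1 := normRe_le (x +i* y - w); have a2 := normIm_le (x +i* y - w).
  have := le_trans (normRe_le w) wr; have := le_trans (normIm_le w) wr.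
  move=> /ler_normlP[i1 i2] /ler_normlP[k1 k2].
  move: a1 a2 => /ler_normlP[a1 a2] /ler_normlP[a3 a4]; rewrite !ReImE /= in a1 a2 a3 a4.
  by case: h => [|[|[|]]] h; rewrite h in a1 a2 a3 a4 *; lra.
have far0 w : cmod w <= r / 2 -> forall x y, - r <= x <= r -> - r <= y <= r ->
    x = - r \/ x = r \/ y = - r \/ y = r -> x +i* y != w.
  move=> wr x y hx hy h; rewrite -subr_eq0 -cmod_gt0.
  by apply: lt_le_trans (far w wr x y hx hy h); lra.
have c_0 : cmod (0 : C) <= r / 2 by rewrite cmod0; lra.
have bq x y : - r <= x <= r -> - r <= y <= r ->
    x = - r \/ x = r \/ y = - r \/ y = r -> cmod (q (x +i* y)) <= M * r ^+ 6.
  move=> hx hy h; set w := x +i* y.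
  have yr : `|y| <= r by apply/ler_normlP; split; lra.
  have xr : `|x| <= r by apply/ler_normlP; split; lra.
  have wr : cmod w <= 2 * r by apply: le_trans (cmod_le _) _; rewrite /=; lra.
  (* On a vertical side of abscissa [s] one has [w^2 - r^2 = i y (2 s + i y)], which shows the
     factor |y|; on a horizontal side |y| equals [r]. *)
  have s1 : cmod (w ^+ 2 - (r ^+ 2)%:C) <= 3 * r * `|y|.
    have E : w ^+ 2 - (r ^+ 2)%:C = (w - r%:C) * (w + r%:C) by rewrite rmorphXn /= subr_sqr.
    have side (s : R) : s = r \/ s = - r -> x = s -> cmod (w ^+ 2 - (r ^+ 2)%:C) <= 3 * r * `|y|.
      move=> sr xs; have -> : w ^+ 2 - (r ^+ 2)%:C = 'i * y%:C * (2 * s +i* y).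
        by rewrite /w xs; case: sr => ->; apply: complex_ext; rewrite !expr2 !ReImE /=; ring.
      rewrite !cmodM cmod_i mul1r cmod_real mulrC ler_wpM2r //.
      apply: le_trans (cmod_le _) _; rewrite /= normrM ger0_norm //.
      have -> : `|s| = r by case: sr => ->; rewrite ?normrN gtr0_norm.
      lra.
    case: h => [h|[h|h]]; [apply: side h; by right|apply: side h; by left|].
    have -> : `|y| = r by case: h => ->; rewrite ?normrN gtr0_norm.
    have w2 : cmod w ^+ 2 <= 2 * r ^+ 2.
      rewrite cmod_sqr /cmod2 /= -(real_normK (num_real x)) -(real_normK (num_real y)).
      have : `|x| ^+ 2 <= r ^+ 2 by rewrite ler_pXn2r ?nnegrE // ltW.
      have : `|y| ^+ 2 <= r ^+ 2 by rewrite ler_pXn2r ?nnegrE // ltW.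
      lra.
    apply: le_trans (cmodB _ _) _; rewrite cmodX cmod_real ger0_norm ?sqr_ge0 //.
    by rewrite -mulrA -expr2; lra.
  have [y0|y0] := eqVneq y 0.
    have -> : q w = 0.
      have /eqP : cmod (w ^+ 2 - (r ^+ 2)%:C) = 0.
        by apply: le_anti; rewrite cmod_ge0 (le_trans s1) // y0 normr0 mulr0.
      by rewrite cmod_eq0 /q => /eqP ->; rewrite expr0n mul0r.
    by rewrite cmod0 mulr_ge0 // exprn_ge0 // ltW.
  have yp : 0 < `|y| by rewrite normr_gt0.
  rewrite /q cmodM cmodX; apply: (@le_trans _ _ ((3 * r * `|y|) ^+ 3 * (cmod (p w) + P))).
    apply: ler_pM; rewrite ?exprn_ge0 ?cmod_ge0 //; last exact: cmodB.
    by rewrite ler_pXn2r ?nnegrE ?cmod_ge0 // mulr_ge0 // mulr_ge0 // ltW.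
  have pw : `|y| ^+ 3 * cmod (p w) <= 18 * c * r ^+ 3.
    apply: le_trans (ler_wpM2l (exprn_ge0 _ (ltW yp)) (pb w y0)) _.
    rewrite [Im w]/=.
    have -> : `|y| ^+ 3 * (c * (1 + cmod w) ^+ 2 * (`|y| ^- 2 + `|y| ^- 3)) =
       c * ((1 + cmod w) ^+ 2 * (`|y| + 1)) by field; rewrite gt_eqF.
    have -> : 18 * c * r ^+ 3 = c * ((3 * r) ^+ 2 * (2 * r)) by ring.
    rewrite ler_wpM2l // ler_pM ?exprn_ge0 ?addr_ge0 ?cmod_ge0 //; last lra.
    by rewrite ler_pXn2r ?nnegrE ?addr_ge0 ?cmod_ge0 // ?mulr_ge0 ?(ltW r0) //; lra.
  have p0 : `|y| ^+ 3 * P <= r ^+ 3 * P.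
    by rewrite ler_wpM2r // ler_pXn2r ?nnegrE // ltW.
  have -> : (3 * r * `|y|) ^+ 3 * (cmod (p w) + P) =
     27 * r ^+ 3 * (`|y| ^+ 3 * cmod (p w) + `|y| ^+ 3 * P) by ring.
  have -> : M * r ^+ 6 = 27 * r ^+ 3 * (18 * c * r ^+ 3 + r ^+ 3 * P) by rewrite /M; ring.
  by rewrite ler_pM2l ?lerD // mulr_gt0 // exprn_gt0.
have cq w : ccont q w by have [d /cderiv_cont] := dq w.
have cK w : cmod w <= r / 2 -> ccont_bd (fun z => q z / (z - w)) (- r) r (- r) r.
  move=> wr x y hx hy h; have n := far0 w wr x y hx hy h.
  by apply: (ccont_div (cq _) _ _); [apply: ccontB; [exact: ccont_id|exact: ccont_cst]|rewrite subr_eq0].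
(* As [q] vanishes at 0, the integral of [q / z] is zero; subtracting it leaves the kernel
   [z0 / (z (z - z0))], which gains a factor [1 / r] over [1 / (z - z0)] and so beats the growth
   [r^6] of [q z0]. *)
have bdiff : cmod (q z0 * bdry (fun z => (z - z0)^-1) (- r) r (- r) r) <= 32 * M * Z * r ^+ 5.
  rewrite -e1.
  have -> : bdry (fun z => q z / (z - z0)) (- r) r (- r) r =
    bdry (fun z => q z / (z - z0) + -1 * (q z / (z - 0))) (- r) r (- r) r.
    have cK0 := cK 0 c_0.
    rewrite bdryD //; [|exact: cK|by move=> x y hx hy h; apply: ccontM (cK0 x y hx hy h); exact: ccont_cst].
    by rewrite bdryZ // e0 mulr0 addr0.
  have -> : 32 * M * Z * r ^+ 5 = 2 * (M * r ^+ 6 * (Z / (r / 2 * (r / 2)))) * ((r - - r) + (r - - r)).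
    by field; lra.
  apply: cmod_bdry_le => //.
    move=> x y hx hy h; apply: ccontD; first exact: (cK z0 Zr x y hx hy h).
    by apply: ccontM (cK 0 c_0 x y hx hy h); exact: ccont_cst.
  move=> x y hx hy h; have n1 := far0 z0 Zr x y hx hy h; have n2 := far0 0 c_0 x y hx hy h.
  have -> : q (x +i* y) / (x +i* y - z0) + -1 * (q (x +i* y) / (x +i* y - 0)) =
    q (x +i* y) * (z0 / ((x +i* y - z0) * (x +i* y - 0))).
    by rewrite subr0; field; rewrite n2 subr_eq0 n1.
  rewrite cmodM [cmod (z0 / _)]cmodM cmodV [cmod ((_ - z0) * _)]cmodM; apply: ler_pM; rewrite ?mulr_ge0 ?invr_ge0 ?mulr_ge0 ?cmod_ge0 //.
    exact: bq.
  rewrite ler_wpM2l // lef_pV2 ?posrE ?mulr_gt0 ?divr_gt0 ?cmod_gt0 ?subr_eq0 //.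
  by apply: ler_pM; rewrite ?(far z0 Zr) ?(far 0 c_0) // divr_ge0 // ltW.
have kI : 8 / 9 <= cmod (bdry (fun z => (z - z0)^-1) (- r) r (- r) r).
  exact: le_trans (Im_bdry_kernel_ge r0 Zr) (Im_le _).
have qz : r ^+ 6 * D / 8 <= cmod (q z0).
  rewrite /q cmodM cmodX -/D.
  have t : r ^+ 2 / 2 <= cmod (z0 ^+ 2 - (r ^+ 2)%:C).
    have := cmodD (z0 ^+ 2 - (r ^+ 2)%:C) (- z0 ^+ 2); rewrite addrAC subrr add0r !cmodN.
    rewrite cmodX cmod_real ger0_norm ?sqr_ge0 // -/Z.
    have : Z ^+ 2 <= (r / 2) ^+ 2 by rewrite ler_pXn2r ?nnegrE // divr_ge0 // ltW.
    have -> : (r / 2) ^+ 2 = r ^+ 2 / 4 by field.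
    have := sqr_ge0 r; lra.
  have -> : r ^+ 6 * D / 8 = (r ^+ 2 / 2) ^+ 3 * D by field.
  by rewrite ler_wpM2r ?(ltW D0) // ler_pXn2r ?nnegrE ?cmod_ge0 ?divr_ge0 ?sqr_ge0.
have : r ^+ 6 * D / 8 * (8 / 9) <= 32 * M * Z * r ^+ 5.
  apply: le_trans bdiff; rewrite cmodM; apply: ler_pM => //.
  by rewrite divr_ge0 // mulr_ge0 ?exprn_ge0 // ltW.
have -> : r ^+ 6 * D / 8 * (8 / 9) = (r * D / 9) * r ^+ 5 by field.
rewrite ler_pM2r ?exprn_gt0 //.
have -> : r * D / 9 = (1 + 2 * Z) * D / 9 + 32 * (M * Z) by rewrite /r; field; rewrite gt_eqF.
have := mulr_ge0 Z0 (ltW D0); have := mulr_ge0 M0 Z0; clear -D0.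
by rewrite -[32 * M * Z]mulrA mulrDl mul1r -[2 * Z * D]mulrA; move: (M * Z) (Z * D) => s t; lra.
Qed.

End Liouville.

(** * Hilbert spaces *)

Section Hilbert.
Variables (R : realType) (H : lmodType R[i]) (ip : H -> H -> R[i]).
Local Notation C := R[i].
Local Notation N := (hnorm ip).
Hypothesis hip : inner_product ip.
Implicit Types (x y z : H) (a : C) (u : nat -> H) (M : set H).

Lemma ipZDl a x y z : ip (a *: x + y) z = a * ip x z + ip y z.
Proof. by case: hip => h _; exact: h. Qed.

Lemma ipC x y : ip y x = (ip x y)^*.
Proof. by case: hip => _ [h _]; exact: h. Qed.

Lemma ipDl x y z : ip (x + y) z = ip x z + ip y z.
Proof. by have := ipZDl 1 x y z; rewrite scale1r mul1r. Qed.

Lemma ip0l z : ip 0 z = 0.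
Proof. by apply: (addrI (ip 0 z)); rewrite -ipDl !addr0. Qed.

Lemma ipZl a x z : ip (a *: x) z = a * ip x z.
Proof. by have := ipZDl a x 0 z; rewrite !addr0 ip0l addr0. Qed.

Lemma ipNl x z : ip (- x) z = - ip x z.
Proof. by rewrite -scaleN1r ipZl mulN1r. Qed.

Lemma ipBl x y z : ip (x - y) z = ip x z - ip y z.
Proof. by rewrite ipDl ipNl. Qed.

Lemma ipDr x y z : ip z (x + y) = ip z x + ip z y.
Proof. by rewrite ipC ipDl conjD -!ipC. Qed.

Lemma ip0r z : ip z 0 = 0.
Proof. by rewrite ipC ip0l; apply: complex_ext; rewrite /= ?oppr0. Qed.

Lemma ipZr a x z : ip z (a *: x) = a^* * ip z x.
Proof. by rewrite ipC ipZl conjM -ipC. Qed.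

Lemma ipNr x z : ip z (- x) = - ip z x.
Proof. by rewrite ipC ipNl conjN -ipC. Qed.

Lemma ipBr x y z : ip z (x - y) = ip z x - ip z y.
Proof. by rewrite ipDr ipNr. Qed.

Definition ipE := (ipDl, ipDr, ipNl, ipNr, ipZl, ipZr).

Lemma hnorm_ge0 x : 0 <= N x. Proof. exact: sqrtr_ge0. Qed.

Lemma ip_self x : ip x x = (N x ^+ 2)%:C.
Proof.
case: hip => _ [_ [h _]]; have [h1 h2] := h x.
by rewrite sqr_sqrtr //; apply: complex_ext.
Qed.

Lemma hnorm_sqr x : N x ^+ 2 = Re (ip x x).
Proof. by rewrite ip_self. Qed.

Lemma hnorm0 : N 0 = 0.
Proof. by apply/eqP; rewrite -sqrf_eq0 hnorm_sqr ip0l. Qed.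

Lemma hnorm_eq0 x : (N x == 0) = (x == 0).
Proof.
apply/eqP/eqP => [n0|->]; last exact: hnorm0.
by case: hip => _ [_ [_ h]]; apply: h; rewrite ip_self n0 expr0n.
Qed.

Lemma hnorm_gt0 x : (0 < N x) = (x != 0).
Proof. by rewrite lt_def hnorm_eq0 hnorm_ge0 andbT. Qed.

Lemma hnormZ a x : N (a *: x) = cmod a * N x.
Proof.
apply/eqP; rewrite -(@eqrXn2 _ 2) ?mulr_ge0 ?hnorm_ge0 ?cmod_ge0 // exprMn !hnorm_sqr.
by rewrite ipZl ipZr mulrA mulJ cmod_sqr cReM /= mul0r subr0.
Qed.

Lemma hnormN x : N (- x) = N x.
Proof. by rewrite -scaleN1r hnormZ cmodN cmod1 mul1r. Qed.

Lemma hnormD_sqr x y : N (x + y) ^+ 2 = N x ^+ 2 + 2 * Re (ip x y) + N y ^+ 2.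
Proof. by rewrite !hnorm_sqr !ipE (ipC x y) !ReImE; ring. Qed.

Lemma cauchy_schwarz x y : cmod (ip x y) <= N x * N y.
Proof.
have [->|y0] := eqVneq y 0; first by rewrite ip0r cmod0 hnorm0 mulr0.
have ny : 0 < N y by rewrite hnorm_gt0.
set s := ip x y; have := hnorm_ge0 (x - (s / (N y ^+ 2)%:C) *: y).
set v := x - _; have : 0 <= N v ^+ 2 by rewrite sqr_ge0.
rewrite hnormD_sqr hnormN ipNr ipZr hnormZ cReN -/s cmodM cmodV cmod_real => h _.
have E : Re ((s / (N y ^+ 2)%:C)^* * s) = cmod s ^+ 2 / N y ^+ 2.
  by rewrite conjM mulrAC (mulrC s^*) mulJ -fmorphV /= cmod_sqr; ring.
move: h; rewrite E ger0_norm ?sqr_ge0 //.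
have -> : (cmod s / N y ^+ 2 * N y) ^+ 2 = cmod s ^+ 2 / N y ^+ 2.
  by field; rewrite gt_eqF.
move=> h; have : cmod s ^+ 2 / N y ^+ 2 <= N x ^+ 2 by lra.
rewrite ler_pdivrMr ?exprn_gt0 // -exprMn.
by rewrite ler_pXn2r ?nnegrE ?mulr_ge0 ?hnorm_ge0 ?cmod_ge0.
Qed.

Lemma hnormD x y : N (x + y) <= N x + N y.
Proof.
rewrite -(@ler_pXn2r _ 2) ?nnegrE ?addr_ge0 ?hnorm_ge0 // hnormD_sqr sqrrD -[N x * N y *+ 2]mulr_natl.
by rewrite lerD2r lerD2l ler_pM2l // (le_trans (Re_le _)) // cauchy_schwarz.
Qed.

Lemma hnormB x y : N (x - y) <= N x + N y.
Proof. by rewrite -(hnormN y) hnormD. Qed.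

Lemma parallelogram x y : N (x - y) ^+ 2 = 2 * N x ^+ 2 + 2 * N y ^+ 2 - N (x + y) ^+ 2.
Proof. by rewrite !hnormD_sqr ipNr cReN hnormN; ring. Qed.

Lemma hconv_cauchy u x : hconv ip u x -> hcauchy ip u.
Proof.
move=> ux e e0; have e2 : 0 < e / 2 by lra.
have [n hn] := ux _ e2; exists n => p q /hn hp /hn hq.
rewrite -(subrKA x) (_ : x - u q = - (u q - x)); last by rewrite opprB.
by have := hnormB (u p - x) (u q - x); lra.
Qed.

Definition hclosed M := forall u x, (forall n, M (u n)) -> hconv ip u x -> M x.

Hypothesis complete : forall u, hcauchy ip u -> exists l, hconv ip u l.

(** A minimising sequence is Cauchy by the parallelogram law, since the midpoint of two of its terms
    is no closer to [x] than the infimum allows. *)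
Lemma projection M x : Defs.subspace M -> hclosed M ->
  exists2 m, M m & forall y, M y -> ip (x - m) y = 0.
Proof.
move=> [M0 Ml] Mc.
pose S := [set r | exists2 m, M m & r = N (x - m) ^+ 2].
have iS : has_inf S.
  split; first by exists (N (x - 0) ^+ 2), 0.
  by exists 0 => _ [m _ ->]; exact: sqr_ge0.
set d := inf S.
have dle m : M m -> d <= N (x - m) ^+ 2.
  by move=> Mm; apply: ge_inf; [case: iS|exists m].
have ex n : exists m, M m /\ N (x - m) ^+ 2 < d + n.+1%:R^-1.
  have n0 : 0 < n.+1%:R^-1 :> R by rewrite invr_gt0.
  by have [_ [m Mm ->] h] := inf_adherent n0 iS; exists m.
have [u hu] := choice ex.
have Mu n : M (u n) by case: (hu n).
have MB m1 m2 : M m1 -> M m2 -> M (m1 - m2).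
  by move=> h1 h2; rewrite addrC -scaleN1r; apply: Ml.
have MZ a m : M m -> M (a *: m) by move=> h; rewrite -[_ *: _]addr0; apply: Ml.
have uc : hcauchy ip u.
  move=> e e0; have e2 : 0 < e ^+ 2 / 4 by rewrite divr_gt0 // exprn_gt0.
  have [k _ /(_ k (leqnn k)) /= hk] := near_infty_natSinv_lt (PosNum e2).
  exists k => p q kp kq; rewrite -(@ltr_pXn2r _ 2) ?nnegrE ?hnorm_ge0 ?(ltW e0) //.
  have -> : u p - u q = (x - u q) - (x - u p) by rewrite opprB [RHS]addrC subrKA.
  have mid : M (2^-1 *: (u p + u q)).
    by apply: MZ; have := Ml 1 (u p) (u q) (Mu p) (Mu q); rewrite scale1r.
  have := dle _ mid.
  have E : N ((x - u q) + (x - u p)) ^+ 2 = 4 * N (x - 2^-1 *: (u p + u q)) ^+ 2.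
    have -> : (x - u q) + (x - u p) = 2 *: (x - 2^-1 *: (u p + u q)).
      rewrite scalerBr scalerA divff // scale1r scaler_nat mulr2n opprD.
      by rewrite [LHS]addrACA [- u q - u p]addrC.
    rewrite hnormZ exprMn; congr (_ * _).
    by rewrite (_ : 2 = 2%:C) ?cmod_real ?ger0_norm //; [ring|rewrite rmorphMn].
  rewrite (parallelogram (x - u q)) E.
  have [_ h1] := hu p; have [_ h2] := hu q.
  have v1 : p.+1%:R^-1 <= k.+1%:R^-1 :> R by rewrite lef_pV2 ?posrE // ler_nat.
  have v2 : q.+1%:R^-1 <= k.+1%:R^-1 :> R by rewrite lef_pV2 ?posrE // ler_nat.
  move: h1 h2 v1 v2 hk; move: (p.+1%:R^-1) (q.+1%:R^-1) (k.+1%:R^-1) => a1 a2 a3.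
  by move: (N _ ^+ 2) (N (x - u p) ^+ 2) (N (x - u q) ^+ 2) => n1 n2 n3; clear; lra.
have [m um] := complete uc; have Mm := Mc u m Mu um.
exists m => // y My.
have dm : N (x - m) ^+ 2 <= d.
  suff : N (x - m) <= Num.sqrt d.
    have d0 : 0 <= d by apply: lb_le_inf; [case: iS|move=> _ [m1 _ ->]; exact: sqr_ge0].
    by move=> h; rewrite -[X in _ <= X]sqr_sqrtr // ler_pXn2r ?nnegrE ?hnorm_ge0 ?sqrtr_ge0.
  apply/ler_addgt0Pr => e e0.
  have e2 : 0 < e / 2 by lra.
  have [k1 hk1] := um _ e2.
  have e4 : 0 < (e / 2) ^+ 2 by rewrite exprn_gt0.
  have [k2 _ hk2] := near_infty_natSinv_lt (PosNum e4).
  have h1 := hk1 (maxn k1 k2) (leq_maxl _ _); have h2 := hk2 (maxn k1 k2) (leq_maxr _ _).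
  have [_ h3] := hu (maxn k1 k2).
  have d0 : 0 <= d by apply: lb_le_inf; [case: iS|move=> _ [m1 _ ->]; exact: sqr_ge0].
  have h4 : N (x - u (maxn k1 k2)) <= Num.sqrt d + e / 2.
    rewrite -(@ler_pXn2r _ 2) ?nnegrE ?hnorm_ge0 ?addr_ge0 ?sqrtr_ge0 ?(ltW e2) //.
    rewrite sqrrD (sqr_sqrtr d0); have := mulr_ge0 (sqrtr_ge0 d) (ltW e2).
    move: h2 h3 => /=; rewrite mulr2n; move: (_%:R^-1) (N _ ^+ 2) (_ * (e / 2)) ((e / 2) ^+ 2).
    by move=> t1 t2 t3 t4; clear; lra.
  have := hnormD (x - u (maxn k1 k2)) (u (maxn k1 k2) - m); rewrite subrKA; lra.
apply/eqP; rewrite -cmod_eq0; apply/negPn/negP => n0.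
have y0 : y != 0 by apply: contraNneq n0 => ->; rewrite ip0r cmod0.
have ny : 0 < N y by rewrite hnorm_gt0.
set s := ip (x - m) y in n0.
(* Moving [m] along [y] by this multiple lowers the squared distance by [|s|^2 / |y|^2], against
   minimality. *)
have := dle (m + (s / (N y ^+ 2)%:C) *: y).
rewrite opprD addrA hnormD_sqr hnormN ipNr ipZr hnormZ cReN -/s cmodM cmodV cmod_real.
have -> : Re ((s / (N y ^+ 2)%:C)^* * s) = cmod s ^+ 2 / N y ^+ 2.
  by rewrite conjM mulrAC (mulrC s^*) mulJ -fmorphV /= cmod_sqr; ring.
rewrite ger0_norm ?sqr_ge0 //.
have -> : (cmod s / N y ^+ 2 * N y) ^+ 2 = cmod s ^+ 2 / N y ^+ 2.
  by field; rewrite gt_eqF.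
have : 0 < cmod s ^+ 2 / N y ^+ 2 by rewrite divr_gt0 ?exprn_gt0 // lt_def n0 cmod_ge0.
move=> p0 h; have {}h := h ltac:(rewrite addrC; exact: Ml); lra.
Qed.

Lemma total_subspace M : Defs.subspace M -> hclosed M ->
  (forall x, (forall y, M y -> ip x y = 0) -> x = 0) -> forall x, M x.
Proof.
move=> Ms Mc h x; have [m Mm hm] := projection x Ms Mc.
by rewrite (_ : x = m) //; apply/eqP; rewrite -subr_eq0; apply/eqP/h.
Qed.

Lemma riesz (l : H -> C) (K : R) : (forall a x y, l (a *: x + y) = a * l x + l y) ->
  (forall x, cmod (l x) <= K * N x) -> exists z, forall x, l x = ip x z.
Proof.
move=> ll lK; have l0 : l 0 = 0.
  by apply: (addrI (l 0)); have := ll 1 0 0; rewrite scale1r mul1r addr0 => <-; rewrite addr0.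
have lZ a x : l (a *: x) = a * l x by have := ll a x 0; rewrite !addr0 l0 addr0.
have lB x y : l (x - y) = l x - l y.
  by have := ll (-1) y x; rewrite scaleN1r mulN1r addrC => ->; rewrite addrC.
have Ks : Defs.subspace [set x | l x = 0].
  by split=> // a x y /= h1 h2; rewrite ll h1 h2 mulr0 addr0.
have Kc : hclosed [set x | l x = 0].
  move=> u x /= u0 ux; apply/eqP; rewrite -cmod_eq0; apply/negPn/negP => n0.
  have p0 : 0 < cmod (l x) by rewrite lt_def n0 cmod_ge0.
  have K1 : 0 < `|K| + 1 by rewrite ltr_pwDr.
  have [n /(_ n (leqnn n)) hn] := ux _ (divr_gt0 p0 K1).
  have := lK (u n - x); rewrite lB u0 sub0r cmodN.
  have : K * N (u n - x) <= (`|K| + 1) * N (u n - x).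
    by rewrite ler_wpM2r ?hnorm_ge0 //; have := ler_norm K; lra.
  move: hn; rewrite ltr_pdivlMr // mulrC; lra.
have [lz|] := pselect (forall x, l x = 0).
  by exists 0 => x; rewrite ip0r.
move=> /existsNP[x0 /eqP x00].
have [m lm hm] := projection x0 Ks Kc; set v := x0 - m.
have lv : l v = l x0 by rewrite lB lm subr0.
have v0 : v != 0 by apply: contraNneq x00 => v0; rewrite -lv v0 l0.
have nv : ip v v != 0 by rewrite ip_self; apply/eqP => /(congr1 (@complex.Re R))/= /eqP; rewrite sqrf_eq0 hnorm_eq0 (negPf v0).
exists ((l v / ip v v)^* *: v) => x.
have := hm (l v *: x - l x *: v); rewrite /= lB !lZ mulrC subrr => /(_ erefl).
rewrite -/v ipBr !ipZr => /eqP; rewrite subr_eq0 => /eqP /(congr1 (@conjc R)).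
rewrite !conjM !conjcK -!ipC => E.
by rewrite mulrAC E mulfK.
Qed.

End Hilbert.

(** * The boundary triple of an admissible pair *)

Section VectorCalculus.
Variables (R : realType) (H : lmodType R[i]) (ip : H -> H -> R[i]).
Local Notation C := R[i].
Local Notation N := (hnorm ip).
Hypothesis hip : inner_product ip.
Implicit Types (x y : H) (z w a : C) (u v : C -> H) (T : H -> H).

Lemma bounded_opP T : bounded_op ip T ->
  (forall a x y, T (a *: x + y) = a *: T x + T y) /\
  exists2 M : R, 0 < M & forall x, N (T x) <= M * N x.
Proof.
move=> [Tl [M hM]]; split => //; exists (`|M| + 1); first by rewrite ltr_pwDr.
move=> x; apply: le_trans (hM x) _; rewrite ler_wpM2r ?hnorm_ge0 //.
by have := ler_norm M; lra.
Qed.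

Lemma bounded_op_linear T : bounded_op ip T ->
  [/\ T 0 = 0, forall a x, T (a *: x) = a *: T x,
      forall x y, T (x + y) = T x + T y & forall x y, T (x - y) = T x - T y].
Proof.
move=> [Tl _]; have T0 : T 0 = 0.
  by apply: (addrI (T 0)); have := Tl 1 0 0; rewrite !scale1r addr0 => <-; rewrite addr0.
split=> //.
- by move=> a x; have := Tl a x 0; rewrite T0 !addr0.
- by move=> x y; have := Tl 1 x y; rewrite !scale1r.
- by move=> x y; have := Tl (-1) y x; rewrite !scaleN1r !(addrC (- _)).
Qed.

Definition vcont u z := forall e : R, 0 < e -> exists2 d : R, 0 < d &
  forall w, cmod (w - z) < d -> N (u w - u z) < e.

Lemma vcontD u v z : vcont u z -> vcont v z -> vcont (fun w => u w + v w) z.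
Proof.
move=> cu cv e e0; have e2 : 0 < e / 2 by lra.
have [d1 d10 h1] := cu _ e2; have [d2 d20 h2] := cv _ e2.
exists (Num.min d1 d2); first by rewrite lt_min d10.
move=> w; rewrite lt_min => /andP[/h1 k1 /h2 k2]; rewrite opprD addrACA.
by apply: le_lt_trans (hnormD hip _ _) _; lra.
Qed.

Lemma vcont_op T u z : bounded_op ip T -> vcont u z -> vcont (T \o u) z.
Proof.
move=> bT cu e e0; have [_ [M M0 hM]] := bounded_opP bT.
have [d d0 hd] := cu _ (divr_gt0 e0 M0); exists d => // w /hd.
rewrite ltr_pdivlMr // mulrC; apply: le_lt_trans.
by have [_ _ _ TB] := bounded_op_linear bT; rewrite /= -TB.
Qed.

Lemma vcont_ip x u z : vcont u z -> ccont (fun w => ip (u w) x) z.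
Proof.
move=> cu e e0; have K0 : 0 < N x + 1 by rewrite ltr_wpDl ?hnorm_ge0.
have [d d0 hd] := cu _ (divr_gt0 e0 K0); exists d => // w /hd; rewrite ltr_pdivlMr //.
apply: le_lt_trans; rewrite -ipBl //; apply: le_trans (cauchy_schwarz hip _ _) _.
by rewrite ler_wpM2l ?hnorm_ge0 // lerDl.
Qed.

Definition vderiv u z x := exists q, [/\ vcont q z, q z = x &
  forall w, u w - u z = (w - z) *: q w].

Lemma vderiv_op T u z x : bounded_op ip T -> vderiv u z x -> vderiv (T \o u) z (T x).
Proof.
move=> bT [q [cq <- hq]]; exists (T \o q); split => //; first exact: vcont_op.
by move=> w /=; have [_ TZ _ TB] := bounded_op_linear bT; rewrite -TB hq TZ.
Qed.

Lemma vderiv_ip u z x y : vderiv u z x -> cderiv (fun w => ip (u w) y) z (ip x y).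
Proof.
move=> [q [cq <- hq]]; exists (fun w => ip (q w) y); split => //.
  exact: vcont_ip.
by move=> w; rewrite -ipBl // hq ipZl.
Qed.

(* Such [u] is bounded near [z], whence the quotient on the right is continuous. *)
Lemma vderiv_resolvent T u v z : bounded_op ip T -> vcont v z ->
  (forall w, u w - u z = (w - z) *: (T (u w) + v w)) ->
  vcont u z /\ vderiv u z (T (u z) + v z).
Proof.
move=> bT cv hu; have [_ [M M0 hM]] := bounded_opP bT.
suff cu : vcont u z.
  split => //; exists (fun w => T (u w) + v w); split => //.
  by apply: vcontD => //; exact: vcont_op.
move=> e e0; have [d d0 hd] := cv 1 ltr01.
set A := N (u z); set B := N (v z); have A0 : 0 <= A by exact: hnorm_ge0.
have B0 : 0 <= B by exact: hnorm_ge0.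
(* From D <= t (M (A + D) + B + 1) with [t * M <= 1 / 2], half of [D] is absorbed and [D <= t * K]
   remains. *)
pose K := 2 * (M * A + B + 1); have K0 : 0 < K.
  by rewrite mulr_gt0 // ltr_pwDr // addr_ge0 // mulr_ge0 // ltW.
exists (Num.min d (Num.min (1 / (2 * M)) (e / K))).
  by rewrite !lt_min d0 !divr_gt0 // mulr_gt0.
move=> w; rewrite !lt_min => /and3P[/hd h1 h2 h3].
set t := cmod (w - z) in h2 h3; set D := N (u w - u z).
have D0 : 0 <= D by exact: hnorm_ge0.
have t0 : 0 <= t by exact: cmod_ge0.
have uw : N (u w) <= A + D by have := hnormD hip (u w - u z) (u z); rewrite subrK addrC.
have vw : N (v w) <= B + 1.
  have := hnormD hip (v w - v z) (v z); rewrite subrK -/B; lra.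
have : D <= t * (M * (A + D) + (B + 1)).
  rewrite {1}/D hu hnormZ // ler_wpM2l //; apply: le_trans (hnormD hip _ _) _.
  apply: lerD vw; apply: le_trans (hM _) _; rewrite ler_wpM2l //; exact: ltW.
have h4 : t * M <= 1 / 2.
  by move: h2; rewrite ltr_pdivlMr ?mulr_gt0 // => h2; lra.
have h5 : t * K < e by rewrite -ltr_pdivlMr.
have := ler_wpM2r D0 h4; move: h5; rewrite /K.
have -> : t * (M * (A + D) + (B + 1)) = t * M * D + t * (M * A + B + 1) by ring.
have -> : t * (2 * (M * A + B + 1)) = 2 * (t * (M * A + B + 1)) by ring.
by move: (t * _ * D) (t * _) => s1 s2; lra.
Qed.

End VectorCalculus.

(** * Eigenvectors, boundary functions and completeness for an admissible pair *)

Section AdmissiblePair.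
Variables (R : realType) (H : lmodType R[i]) (ip : H -> H -> R[i]).
Local Notation C := R[i].
Local Notation N := (hnorm ip).
Variables (dom : set H) (D V : H -> H) (phi0 : H) (phi : C -> H).
Hypothesis sep : separable_hilbert ip.
Hypothesis adm : admissible ip dom D V.
Hypothesis ker0 : ker_op dom D phi0.
Hypothesis phi0_neq0 : phi0 != 0.
Hypothesis phiE : forall lam, phi lam - lam *: V (phi lam) = phi0.
Implicit Types (x y : H) (z w l m a : C).

Let hip : inner_product ip. Proof. by case: sep. Qed.
Let complete : forall u, hcauchy ip u -> exists l : H, hconv ip u l.
Proof. by case: sep => _ []. Qed.
Let Vb : bounded_op ip V.
Proof. by case: adm => _ [_ [_ [_ [[]]]]]. Qed.
Let VL := bounded_op_linear Vb.
Let domV x : dom (V x). Proof. by case: adm => _ [_ [_ [_ [_ [_ []]]]]]. Qed.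
Let DV x : D (V x) = x. Proof. by case: adm => _ [_ [_ [_ [_ [_ []]]]]]. Qed.
Let dom_sub : Defs.subspace dom. Proof. by case: adm => [[[]]]. Qed.
Let Dl a x y : dom x -> dom y -> D (a *: x + y) = a *: D x + D y.
Proof. by case: adm => [[[_ h] _] _]; exact: h. Qed.

Let dom0 : dom 0. Proof. by case: dom_sub. Qed.
Let domZD a x y : dom x -> dom y -> dom (a *: x + y).
Proof. by case: dom_sub => _ h; exact: h. Qed.
Let domD x y : dom x -> dom y -> dom (x + y).
Proof. by move=> dx dy; have := domZD 1 dx dy; rewrite scale1r. Qed.
Let D_D x y : dom x -> dom y -> D (x + y) = D x + D y.
Proof. by move=> dx dy; have := Dl 1 dx dy; rewrite !scale1r. Qed.
Let domZ a x : dom x -> dom (a *: x).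
Proof. by move=> dx; have := domZD a dx dom0; rewrite addr0. Qed.
Let D0 : D 0 = 0.
Proof. by apply: (addrI (D 0)); rewrite -D_D // !addr0. Qed.
Let DZ a x : dom x -> D (a *: x) = a *: D x.
Proof. by move=> dx; have := Dl a dx dom0; rewrite D0 !addr0. Qed.
Let domB x y : dom x -> dom y -> dom (x - y).
Proof. by move=> dx dy; apply: domD => //; rewrite -scaleN1r; exact: domZ. Qed.
Let DB x y : dom x -> dom y -> D (x - y) = D x - D y.
Proof.
move=> dx dy; have dz : dom (-1 *: y) := domZ _ dy.
by rewrite -[- y]scaleN1r D_D // DZ // scaleN1r.
Qed.

Lemma ker_phi0 x : dom x -> D x = 0 -> exists c : C, x = c *: phi0.
Proof.
move=> dx Dx; case: adm => _ [_ [[p [[dp Dp] [p0 hp]]] _]].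
have [c cE] := hp _ ker0; have [c' c'E] := hp x (conj dx Dx).
have c0 : c != 0 by apply: contraNneq phi0_neq0 => c0; rewrite cE c0 scale0r.
by exists (c' / c); rewrite cE scalerA divfK // -c'E.
Qed.

(** For nonzero [l], [I - l V] is [- l] times [V - l^-1], which is invertible because the spectrum
    of [V] is reduced to 0. *)
Lemma resolvent_exists l : exists S, bounded_op ip S /\
  forall x, S (x - l *: V x) = x /\ S x - l *: V (S x) = x.
Proof.
have [V0 VZ VD VB] := VL.
have [->|l0] := eqVneq l 0.
  exists id; split; last by move=> x; rewrite !scale0r !subr0.
  by split=> //; exists 1 => x; rewrite mul1r.
have sp : spectrum_bounded ip V = [set 0] by case: adm => _ [_ [_ [_ [_ []]]]].
have : ~ spectrum_bounded ip V l^-1.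
  by rewrite sp /= => /eqP; rewrite invr_eq0 (negPf l0).
move=> /contrapT [S [Sb SE]]; have [S0 SZ SD SB] := bounded_op_linear Sb.
exists (fun x => S (- l^-1 *: x)); split.
  have [Sl [M M0 hM]] := bounded_opP Sb; split.
    by move=> a x y; rewrite !SZ Sl scalerDr !scalerA mulrC.
  exists (M * cmod (- l^-1)) => x; apply: le_trans (hM _) _.
  by rewrite hnormZ // mulrA.
move=> x; split.
  have -> : - l^-1 *: (x - l *: V x) = V x - l^-1 *: x.
    by rewrite scalerBr scalerA mulNr mulVf // scaleN1r opprK addrC scaleNr.
  by have [] := SE x.
have [_ h] := SE (- l^-1 *: x); set s := S _ in h *.
have : - l *: (V s - l^-1 *: s) = x.
  by rewrite h scalerA mulrNN mulfV // scale1r.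
by rewrite scalerBr scalerA mulNr mulfV // scaleN1r opprK scaleNr addrC.
Qed.

Let res := projT1 (choice resolvent_exists).
Let res_bounded l : bounded_op ip (res l).
Proof. by rewrite /res; case: choice => /= S /(_ l) []. Qed.
Let resK l x : res l (x - l *: V x) = x.
Proof. by rewrite /res; case: choice => /= S /(_ l) [_ /(_ x) []]. Qed.
Let Kres l x : res l x - l *: V (res l x) = x.
Proof. by rewrite /res; case: choice => /= S /(_ l) [_ /(_ x) []]. Qed.

Lemma dom_phi l : dom (phi l).
Proof.
have -> : phi l = l *: V (phi l) + phi0 by rewrite -(phiE l) addrC subrK.
by apply: domZD => //; case: ker0.
Qed.

Lemma D_phi l : D (phi l) = l *: phi l.
Proof.
have [d0 k0] := ker0.
have {1}-> : phi l = l *: V (phi l) + phi0 by rewrite -(phiE l) addrC subrK.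
by rewrite Dl // k0 addr0 DV.
Qed.

Lemma phi_neq0 l : phi l != 0.
Proof.
have [V0 _ _ _] := VL; apply: contraNneq phi0_neq0 => p0.
by rewrite -(phiE l) p0 V0 scaler0 subr0.
Qed.

(** Since [D V = I], the vector [x - l V x] lies in [ker D] and is a multiple of [phi0]; applying
    the inverse of [I - l V] turns [phi0] into [phi l]. *)
Lemma eigenvector x l : dom x -> D x = l *: x -> exists c : C, x = c *: phi l.
Proof.
have [V0 VZ VD VB] := VL; move=> dx Dx.
have [c cE] : exists c : C, x - l *: V x = c *: phi0.
  apply: ker_phi0; first by apply: domB => //; exact: domZ.
  by rewrite DB ?DZ // ?DV ?Dx ?subrr //; exact: domZ.
exists c; rewrite -(resK l x) cE -(phiE l).
have [_ SZ _ _] := bounded_op_linear (res_bounded l).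
by rewrite SZ resK.
Qed.

Let RV l := res l \o V.
Let RV_bounded l : bounded_op ip (RV l).
Proof.
have [V1 [M M0 hM]] := bounded_opP Vb.
have [S1 [K K0 hK]] := bounded_opP (res_bounded l); split.
  by move=> a x y; rewrite /RV /= V1 S1.
exists (K * M) => x; apply: le_trans (hK _) _; rewrite -mulrA ler_wpM2l //.
exact: ltW.
Qed.

(** The resolvent identity, with the vector at the moving point [w] on the right, in the form that
    [vderiv_resolvent] takes. *)
Lemma phi_sub l w : phi w - phi l = (w - l) *: RV l (phi w).
Proof.
have [V0 VZ VD VB] := VL; have [_ SZ _ _] := bounded_op_linear (res_bounded l).
rewrite -[LHS](resK l) VB -SZ; congr (res l _).
have := phiE w; rewrite -{1}(phiE l) => /eqP; rewrite subr_eq => /eqP {1}->.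
rewrite scalerBr scalerBl opprB; move: (phi l) (l *: V _) (w *: _) (l *: _) => x1 x2 x3 x4.
by rewrite [_ + x3 - x1]addrAC [x1 - x4 - x1]addrAC subrr sub0r (addrC (- x4)) subrKA.
Qed.

Let psi l := RV l (phi l).

Lemma vderiv_phi l : vcont ip phi l /\ vderiv ip phi l (psi l).
Proof.
have c0 : vcont ip (fun=> 0) l by move=> e e0; exists 1 => // w _; rewrite subrr hnorm0.
have := vderiv_resolvent hip (RV_bounded l) c0 (u := phi); rewrite addr0; apply.
by move=> w; rewrite addr0 phi_sub.
Qed.

(** [psi] obeys the same kind of difference equation as [phi], with an additional continuous term.
    This second derivative makes the derivatives of the boundary functions holomorphic. *)
Lemma vderiv_psi l : exists x, vderiv ip psi l x.
Proof.
have [R0 RZ RD RB] := bounded_op_linear (RV_bounded l).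
have [V0 VZ VD VB] := VL; have [_ SZ SD _] := bounded_op_linear (res_bounded l).
exists (RV l (psi l) + RV l (RV l (phi l))).
refine (proj2 (vderiv_resolvent (v := fun w => RV l (RV l (phi w))) hip (RV_bounded l) _ _)).
  apply: (vcont_op (RV_bounded l) (u := fun w => RV l (phi w))).
  by apply: vcont_op => //; have [] := vderiv_phi l.
move=> w; have E : psi w = RV l (phi w) + (w - l) *: RV l (psi w).
  rewrite /RV /= -SZ -SD -[LHS](resK l); congr (res l _).
  have {1}-> : psi w = V (phi w) + w *: V (psi w).
    by have := Kres w (V (phi w)); rewrite -/(psi w) => {1}<-; rewrite subrK.
  by rewrite scalerBl addrA.
by rewrite {1}E {2}/psi addrAC -RB phi_sub RZ scalerDr addrC.
Qed.

Let adjoint_exists x : exists z : H, forall y, ip (V y) x = ip y z.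
Proof.
have [V1 [M M0 hM]] := bounded_opP Vb.
apply: (@riesz _ _ _ hip complete _ (M * N x)).
  by move=> a y z; rewrite V1 ipZDl.
move=> y; apply: le_trans (cauchy_schwarz hip _ _) _.
by rewrite mulrAC ler_wpM2r // hnorm_ge0.
Qed.

(** [a] and [b] are the two boundary values of [phi l] in a boundary triple whose first component
    vanishes on the self-adjoint restriction. The derivatives are recorded as functions because
    logarithmic derivatives are formed from them. *)
Definition boundary_data (a a' b b' : C -> C) : Prop :=
  [/\ (forall z, cderiv a z (a' z) /\ exists d, cderiv a' z d),
      (forall z, cderiv b z (b' z) /\ exists d, cderiv b' z d),
      (forall l m, (l - m^*) * ip (phi l) (phi m) = b l * (a m)^* - a l * (b m)^*),
      (forall z, Im z != 0 -> a z != 0) /\ (forall z, a z = 0 -> b z != 0) &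
      exists K : R, forall z, Im z != 0 ->
        cmod (a z)^-1 <= K * (1 + cmod z) ^+ 2 * (1 + `|Im z|^-1)].

(** * Green's formula and estimates for a fixed self-adjoint restriction *)

Section BoundaryTriple.
Variables (dA : set H) (mu : C) (Rm : H -> H).
Hypothesis dA_dom : dA `<=` dom.
Hypothesis sa : self_adjoint ip dA D.
Hypothesis Rb : bounded_op ip Rm.
Hypothesis RmE : forall x, dA (Rm x) /\ D (Rm x) - mu *: Rm x = x.

Let symm x y : dA x -> dA y -> ip (D x) y = ip x (D y).
Proof. by case: sa => _ [_ h]; exact: h. Qed.
Let dAl a x y : dA x -> dA y -> dA (a *: x + y).
Proof. by case: sa => [[[[_ h] _] _] _]; exact: h. Qed.
Let dAZ a x : dA x -> dA (a *: x).
Proof.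
by move=> hx; rewrite -[_ *: _]addr0; apply: dAl => //; case: sa => [[[[h _] _] _] _].
Qed.

Let e := phi mu.
Let n := (N e ^+ 2)%:C.
Let n_neq0 : n != 0.
Proof. by rewrite /n -cmod_gt0 cmod_real normr_gt0 sqrf_eq0 hnorm_eq0 // phi_neq0. Qed.
(** [phi l - (l - mu) Rm (phi l)] is an eigenvector of [D] at [mu], hence a multiple of [e]; this is
    its coefficient, read off by pairing with [e]. *)
Let alpha l := (ip (phi l) e - (l - mu) * ip (Rm (phi l)) e) / n.
(** The symmetry of [D] on [reg l] and [reg m] leaves a term in [alpha l] times the conjugate of
    [alpha m], with factor [n] times the difference of [mu] and its conjugate; half of that term
    goes into each [beta]. *)
Let beta l := (l - mu^*) * ip (phi l) e - (mu - mu^*) / 2 * n * alpha l.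
Let reg l := phi l - alpha l *: e.

Lemma reg_domain l : dA (reg l) /\ D (reg l) = l *: phi l - (alpha l * mu) *: e.
Proof.
have [RA RE] := RmE (phi l).
have dR : dom (Rm (phi l)) by exact: dA_dom.
have [c cE] : exists c : C, phi l - (l - mu) *: Rm (phi l) = c *: e.
  apply: eigenvector; first by apply: domB; [exact: dom_phi|exact: domZ].
  rewrite DB ?DZ ?D_phi //; [|exact: dom_phi|exact: domZ].
  have -> : D (Rm (phi l)) = phi l + mu *: Rm (phi l) by move/eqP: RE; rewrite subr_eq => /eqP.
  rewrite scalerDr opprD addrA -scalerBl opprB addrCA subrr addr0.
  by rewrite scalerBr !scalerA mulrC.
have ac : alpha l = c.
  rewrite /alpha -ipZl // -ipBl // cE ipZl // ip_self // -/n mulfK //.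
have rE : reg l = (l - mu) *: Rm (phi l).
  by rewrite /reg ac -cE opprB addrC subrK.
split; first by rewrite rE; exact: dAZ.
rewrite /reg DB ?DZ ?D_phi ?scalerA //; try exact: dom_phi.
by apply: domZ; exact: dom_phi.
Qed.

Lemma green l m :
  (l - m^*) * ip (phi l) (phi m) = beta l * (alpha m)^* - alpha l * (beta m)^*.
Proof.
have [a1 d1] := reg_domain l; have [a2 d2] := reg_domain m.
have := symm a1 a2; rewrite d1 d2 /reg /beta.
rewrite !(ipBl hip, ipBr hip, ipZl hip, ipZr hip) (ip_self hip e) -/n.
move: (alpha l) (alpha m) => x y'.
rewrite !(conjM, conjB, conjV) (ipC hip (phi m) e) conjcK.
have -> : n^* = n by rewrite /n; apply: complex_ext; rewrite /= ?oppr0.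
have -> : (2 : C)^* = 2 by apply: complex_ext; rewrite /= ?addr0 ?oppr0.
move: (ip (phi l) (phi m)) (ip (phi l) e) (ip (phi m) e)^* => s p q.
move: y'^* mu^* m^* => y v k h.
apply/eqP; rewrite -subr_eq0; apply/eqP.
have -> : (l - k) * s - (((l - v) * p - (mu - v) / 2 * n * x) * y -
    x * ((k - mu) * q - (v - mu) / 2 * n * y)) =
    (l * (s - y * p) - x * mu * (q - y * n)) -
    (k * s - y * v * p - x * (k * q - y * v * n)) by field.
by rewrite h subrr.
Qed.

(** If [alpha l] vanished, [phi l] would lie in the self-adjoint domain and be an eigenvector with a
    nonreal eigenvalue. *)
Lemma alpha_neq0 l : Im l != 0 -> alpha l != 0.
Proof.
apply: contraNneq => al; have [h1 h2] := reg_domain l; have := symm h1 h1.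
rewrite h2 /reg al mul0r !scale0r !subr0 ipZl // ipZr // => /eqP.
rewrite -subr_eq0 -mulrBl mulf_eq0 => /orP[/eqP/(congr1 (@complex.Im R))|].
  by rewrite !ReImE /= => h; apply/eqP; lra.
by rewrite ip_self // => /eqP/(congr1 (@complex.Re R))/= /eqP; rewrite sqrf_eq0 hnorm_eq0 // (negPf (phi_neq0 _)).
Qed.

(** If both vanished at [l], necessarily real, Green's formula would make [phi l] orthogonal to
    [phi m] for real [m] arbitrarily close to [l], against continuity of [phi]. *)
Lemma alpha_beta_neq0 l : alpha l = 0 -> beta l != 0.
Proof.
move=> al; apply/eqP => bl.
have Il : Im l = 0 by apply/eqP/negPn/negP => /alpha_neq0; rewrite al eqxx.
have [c _] := vderiv_phi l; have cf := vcont_ip hip (phi l) c.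
have p0 : ip (phi l) (phi l) != 0.
  by rewrite ip_self // -cmod_gt0 cmod_real normr_gt0 sqrf_eq0 hnorm_eq0 // phi_neq0.
have [d d0 hd] := ccont_neq0 cf p0.
have := hd (l + (d / 2)%:C); rewrite addrC addKr cmod_real gtr0_norm ?divr_gt0 //.
move=> /(_ ltac:(lra)); have := green l (l + (d / 2)%:C).
rewrite al bl !mul0r subrr => /eqP; rewrite mulf_eq0 => /orP[/eqP/(congr1 (@complex.Re R))|/eqP g].
  by rewrite !ReImE /=; lra.
rewrite (ipC hip (phi l) (phi (l + (d / 2)%:C))) g cmod_conj cmod0 => h; have := divr_ge0 (cmod_ge0 (ip (phi l) (phi l))) (ler0n R 2).
by rewrite leNgt h.
Qed.

(** [reg l] solves [(D - l) r = (l - mu) alpha l e], so self-adjointness bounds it by the norm of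
    the right-hand side over |Im l|. Hence the norm of [phi l] is controlled by |alpha l|, while
    [phi0 = phi l - l V (phi l)] bounds it below. *)
Lemma alphaV_le : exists K : R, forall l, Im l != 0 ->
  cmod (alpha l)^-1 <= K * (1 + cmod l) ^+ 2 * (1 + `|Im l|^-1).
Proof.
have [_ [M M0 hM]] := bounded_opP Vb.
have p0 : 0 < N phi0 by rewrite hnorm_gt0.
have e0 : 0 < N e by rewrite hnorm_gt0 // phi_neq0.
exists ((1 + M) * (1 + cmod mu) * N e / N phi0) => l Il.
have al := alpha_neq0 Il; set A := cmod (alpha l).
have A0 : 0 < A by rewrite /A cmod_gt0.
have y0 : 0 < `|Im l| by rewrite normr_gt0.
have [r1 r2] := reg_domain l.
have rb : `|Im l| * N (reg l) <= cmod (l - mu) * (A * N e).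
  have [->|rn] := eqVneq (reg l) 0.
    by rewrite (hnorm0 hip) mulr0 !mulr_ge0 ?cmod_ge0 ?hnorm_ge0.
  have rp : 0 < N (reg l) by rewrite hnorm_gt0.
  rewrite -(ler_pM2r rp) -mulrA -expr2.
  have Dr : D (reg l) = l *: reg l + (l - mu) *: (alpha l *: e).
    rewrite r2 /reg scalerBr scalerBl addrA subrK; congr (_ - _).
    by rewrite !scalerA mulrC.
  have := symm r1 r1; rewrite Dr; move: (reg l) rp => r rp.
  set x := (l - mu) *: (alpha l *: e).
  rewrite ipDl // ipDr // (ipZl hip l) (ipZr hip l) (ip_self hip r) (ipC hip x r); set q := ip x r.
  move=> /(congr1 (@complex.Im R)); rewrite !ReImE /= => h.
  have hq : `|Im l| * N r ^+ 2 = `|Im q|.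
    have -> : Im q = - (Im l * N r ^+ 2) by lra.
    by rewrite normrN normrM (ger0_norm (sqr_ge0 (N r))).
  rewrite hq; apply: le_trans (normIm_le _) _; apply: le_trans (cauchy_schwarz hip _ _) _.
  by rewrite /x !hnormZ.
have pl : N (phi l) <= A * N e * (1 + cmod (l - mu) / `|Im l|).
  have -> : phi l = reg l + alpha l *: e by rewrite /reg subrK.
  apply: le_trans (hnormD hip _ _) _; rewrite hnormZ // -/A mulrDr mulr1 addrC lerD2l.
  by rewrite mulrA ler_pdivlMr // mulrC [_ * cmod _]mulrC.
have p1 : N phi0 <= (1 + cmod l * M) * N (phi l).
  rewrite -(phiE l); apply: le_trans (hnormB hip _ _) _; rewrite hnormZ // mulrDl mul1r lerD2l -mulrA.
  by rewrite ler_wpM2l ?cmod_ge0.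
rewrite cmodV -/A -(ler_pM2l A0) mulfV ?gt_eqF //.
have l0 := cmod_ge0 l; have m0 := cmod_ge0 mu.
have q1 : 1 + cmod l * M <= (1 + M) * (1 + cmod l).
  by have := M0; lra.
have q2 : 1 + cmod (l - mu) / `|Im l| <= (1 + cmod mu) * (1 + cmod l) * (1 + `|Im l|^-1).
  have i0 : 0 < `|Im l|^-1 by rewrite invr_gt0.
  have t1 : cmod (l - mu) <= (1 + cmod mu) * (1 + cmod l).
    by apply: le_trans (cmodB _ _) _; have := mulr_ge0 m0 l0; lra.
  have t2 : 1 <= (1 + cmod mu) * (1 + cmod l) by have := mulr_ge0 m0 l0; lra.
  by rewrite mulrDr mulr1; apply: lerD => //; rewrite ler_pM2r.
rewrite -(ler_pM2l p0) mulr1; apply: le_trans p1 _.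
have -> : N phi0 * (A * ((1 + M) * (1 + cmod mu) * N e / N phi0 * (1 + cmod l) ^+ 2 * (1 + `|Im l|^-1)))
  = ((1 + M) * (1 + cmod l)) * (A * N e * ((1 + cmod mu) * (1 + cmod l) * (1 + `|Im l|^-1))).
  by field; rewrite !gt_eqF.
apply: ler_pM => //; first by rewrite addr_ge0 // mulr_ge0 // ltW.
  exact: hnorm_ge0.
apply: le_trans pl _; rewrite ler_wpM2l // mulr_ge0 ?hnorm_ge0 //; exact: ltW.
Qed.

Let alpha' l := (ip (psi l) e - (ip (Rm (phi l)) e + (l - mu) * ip (Rm (psi l)) e)) / n.

Let cderiv_eq (f : C -> C) z k k' : cderiv f z k -> k = k' -> cderiv f z k'.
Proof. by move=> h <-. Qed.

Let cderiv_sub_cst c z : cderiv (fun w => w - c) z 1.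
Proof. by apply: cderiv_eq (cderivB (cderiv_id z) (cderiv_cst c z)) _; rewrite subr0. Qed.

Lemma cderiv_alpha l : cderiv alpha l (alpha' l) /\ exists d, cderiv alpha' l d.
Proof.
have [_ dp] := vderiv_phi l; have [x ds] := vderiv_psi l.
have c0 := cderiv_cst n^-1 l; split.
  apply: cderiv_eq (cderivM (cderivB (vderiv_ip hip e dp)
    (cderivM (cderiv_sub_cst mu l) (vderiv_ip hip e (vderiv_op Rb dp)))) c0) _.
  by rewrite mulr0 addr0 mul1r.
eexists; apply: cderivM c0; apply: cderivB (vderiv_ip hip e ds) _.
apply: cderivD (vderiv_ip hip e (vderiv_op Rb dp)) _.
exact: cderivM (cderiv_sub_cst mu l) (vderiv_ip hip e (vderiv_op Rb ds)).
Qed.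

Let beta' l := ip (phi l) e + (l - mu^*) * ip (psi l) e - (mu - mu^*) / 2 * n * alpha' l.

Lemma cderiv_beta l : cderiv beta l (beta' l) /\ exists d, cderiv beta' l d.
Proof.
have [_ dp] := vderiv_phi l; have [x ds] := vderiv_psi l.
have [da [d da']] := cderiv_alpha l; split.
  apply: cderiv_eq (cderivB (cderivM (cderiv_sub_cst mu^* l) (vderiv_ip hip e dp))
    (cderivZ _ da)) _.
  by rewrite mul1r.
eexists; apply: cderivB (cderivZ _ da'); apply: cderivD (vderiv_ip hip e dp) _.
exact: cderivM (cderiv_sub_cst mu^* l) (vderiv_ip hip e ds).
Qed.

Lemma orthogonal_dense x : (forall y, dA y -> ip y x = 0) -> x = 0.
Proof.
move=> h; apply/eqP; rewrite -(hnorm_eq0 hip); apply/negPn/negP => n0.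
have p0 : 0 < N x by rewrite lt_def n0 hnorm_ge0.
have [[_ dn] _] := sa; have [y [dy xy]] := dn x _ p0.
have := cauchy_schwarz hip (x - y) x; rewrite ipBl // (h y dy) subr0 ip_self // cmod_real.
rewrite ger0_norm ?sqr_ge0 // expr2 ler_pM2r //; by rewrite leNgt xy.
Qed.

Let Vs := projT1 (choice adjoint_exists).
Let VsE x y : ip (V y) x = ip y (Vs x).
Proof. by rewrite /Vs; case: choice => /= f /(_ x). Qed.

(* On the orthogonal complement of the [phi l] the adjoint [V^*] is a
   symmetric right inverse of [D]; being quasinilpotent it vanishes there. *)
Lemma phi_total x : (forall l, ip x (phi l) = 0) -> x = 0.
Proof.
pose P x := forall l, ip x (phi l) = 0; have phi_0 : phi 0 = phi0.
  by rewrite -(phiE 0) scale0r subr0.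
have [V0 VZ VD VB] := VL.
have Pphi x1 : P x1 -> ip phi0 x1 = 0.
  by move=> h; rewrite (ipC hip x1) -phi_0 h; apply: complex_ext; rewrite /= ?oppr0.
have PZD a x1 x2 : P x1 -> P x2 -> P (a *: x1 + x2).
  by move=> h1 h2 l; rewrite ipZDl // h1 h2 mulr0 addr0.
have Vs_P x1 : P x1 -> P (Vs x1).
  move=> h; suff hl l : ip (V (phi l)) x1 = 0.
    by move=> l; rewrite (ipC hip (phi l)) -VsE hl; apply: complex_ext; rewrite /= ?oppr0.
  (* [m V (phi m) = phi m - phi0] is orthogonal to [x1]; at 0 the factor cannot be divided out, and
     continuity of [phi] takes over. *)
  have hn m : m != 0 -> ip (V (phi m)) x1 = 0.
    move=> m0; apply: (mulfI m0); rewrite mulr0 -ipZl //.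
    have -> : m *: V (phi m) = phi m - phi0 by rewrite -(phiE m) opprB addrC subrK.
    by rewrite ipBl // Pphi // (ipC hip x1) h subr0; apply: complex_ext; rewrite /= ?oppr0.
  have [->|] := eqVneq l 0; last exact: hn.
  apply/eqP/negPn/negP => n0.
  have [c _] := vderiv_phi 0.
  have [d d0 hd] := ccont_neq0 (vcont_ip hip x1 (vcont_op Vb c)) n0.
  have := hd (d / 2)%:C; rewrite subr0 cmod_real gtr0_norm ?divr_gt0 // => /(_ ltac:(lra)).
  rewrite /= (hn (d / 2)%:C) ?cmod0; last by rewrite -cmod_gt0 cmod_real normr_gt0 gt_eqF ?divr_gt0.
  by rewrite ltNge divr_ge0 ?cmod_ge0.
(* [V (D y) - y] is a multiple of [phi0], to which [x1] is orthogonal, so [Vs x1] passes the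
   membership test for the domain of a self-adjoint operator. *)
have Vs_D x1 : P x1 -> dA (Vs x1) /\ D (Vs x1) = x1.
  move=> h; have key y : dA y -> ip (D y) (Vs x1) = ip y x1.
    move=> dy; rewrite -VsE.
    have [c cE] : exists c : C, V (D y) - y = c *: phi0.
      by apply: ker_phi0; [apply: domB => //; exact: dA_dom|rewrite DB ?DV ?subrr //; exact: dA_dom].
    have -> : V (D y) = c *: phi0 + y by rewrite -cE subrK.
    by rewrite ipZDl // Pphi // mulr0 add0r.
  have dV : dA (Vs x1) by case: sa => _ [sa1 _]; apply/sa1; exists x1.
  split => //; apply/eqP; rewrite -subr_eq0; apply/eqP/orthogonal_dense => y dy.
  by rewrite ipBr // -symm // key // subrr.
have Vs_sym x1 x2 : P x1 -> P x2 -> ip (Vs x1) x2 = ip x1 (Vs x2).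
  by move=> /Vs_D[d1 e1] /Vs_D[d2 e2]; rewrite -{1}e2 -symm // e1.
have Vs_l a x1 x2 : Vs (a *: x1 + x2) = a *: Vs x1 + Vs x2.
  apply/eqP; rewrite -subr_eq0; apply/eqP/orthogonal_dense => y _.
  by rewrite ipBr // ipDr // ipZr // -!VsE ipDr // ipZr // subrr.
have [_ [M M0 hM]] := bounded_opP Vb.
have Vs_le x1 : N (Vs x1) <= M * N x1.
  have [->|v0] := eqVneq (Vs x1) 0; first by rewrite hnorm0 // mulr_ge0 ?hnorm_ge0 // ltW.
  have vp : 0 < N (Vs x1) by rewrite hnorm_gt0.
  rewrite -(ler_pM2l vp) -expr2 hnorm_sqr // -VsE.
  apply: le_trans (Re_le _) _; apply: le_trans (cauchy_schwarz hip _ _) _.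
  by rewrite mulrA (mulrC _ M) ler_wpM2r ?hnorm_ge0.
(* The inverse of [I - t V] bounds [I - t Vs] from below: write [x1] as [(I - t V) y] and move [V]
   across the inner product. *)
have below (t : R) : exists2 s : R, 0 < s & forall x1, N x1 <= s * N (x1 - t%:C *: Vs x1).
  have [_ [s s0 hs]] := bounded_opP (res_bounded t%:C); exists s => // x1.
  have [->|n0] := eqVneq x1 0; first by rewrite hnorm0 // mulr_ge0 ?hnorm_ge0 // ltW.
  have np : 0 < N x1 by rewrite hnorm_gt0.
  rewrite -(ler_pM2r np) -expr2 hnorm_sqr // -{1}(Kres t%:C x1); set y := res _ _.
  rewrite ipBl // ipZl // VsE.
  have -> : ip y x1 - t%:C * ip y (Vs x1) = ip y (x1 - t%:C *: Vs x1).
    by rewrite ipBr // ipZr // (_ : (t%:C)^* = t%:C) //; apply: complex_ext; rewrite /= ?oppr0.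
  apply: le_trans (Re_le _) _; apply: le_trans (cauchy_schwarz hip _ _) _.
  by rewrite [_ * N x1]mulrAC ler_wpM2r ?hnorm_ge0 // /y hs.
move=> Px; apply/eqP/negPn/negP => x0.
(* The supremum [B] of this set is the squared norm of [Vs] on [P]. *)
pose S := [set r | exists2 y, P y /\ N y <= 1 & r = N (Vs y) ^+ 2].
have hS : has_sup S.
  split; first by exists (N (Vs 0) ^+ 2), 0 => //; split; [move=> l; exact: ip0l|rewrite hnorm0].
  exists (M ^+ 2) => _ [y [_ y1] ->]; rewrite ler_pXn2r ?nnegrE ?hnorm_ge0 ?(ltW M0) //.
  by apply: le_trans (Vs_le y) _; rewrite ler_piMr // ltW.
set B := sup S.
have SB y : P y -> N y <= 1 -> N (Vs y) ^+ 2 <= B.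
  by move=> h1 h2; apply: sup_upper_bound hS _ _; exists y.
have VsZ a y : Vs (a *: y) = a *: Vs y.
  have Vs0 : Vs 0 = 0 by apply: (addrI (Vs 0)); have := Vs_l 1 0 0; rewrite !scale1r addr0 => <-; rewrite addr0.
  by have := Vs_l a y 0; rewrite Vs0 !addr0.
have P0 : P 0 by move=> l; exact: ip0l.
have PZ a y : P y -> P (a *: y) by move=> h; rewrite -[_ *: _]addr0; exact: PZD.
have SB' y : P y -> N (Vs y) ^+ 2 <= B * N y ^+ 2.
  move=> h; have [->|n0] := eqVneq y 0.
    by have := VsZ 0 y; rewrite !scale0r => ->; rewrite hnorm0 // expr0n mulr0.
  have np : 0 < N y by rewrite hnorm_gt0.
  have := SB ((N y)^-1%:C *: y) (PZ _ _ h); rewrite VsZ !hnormZ // cmod_real ger0_norm ?invr_ge0 ?hnorm_ge0 //.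
  rewrite mulVf ?gt_eqF // lexx => /(_ isT); rewrite exprMn exprVn mulrC ler_pdivrMr ?exprn_gt0 //.
have VsN0 : 0 < N (Vs x).
  rewrite hnorm_gt0 //; apply: contraNneq x0 => v0.
  by have [_ <-] := Vs_D x Px; rewrite v0 D0.
have xp : 0 < N x by rewrite hnorm_gt0.
have B0 : 0 < B.
  have := SB' x Px; rewrite -ler_pdivrMr ?exprn_gt0 //; apply: lt_le_trans.
  by rewrite divr_gt0 // exprn_gt0.
(* The inverse of the norm of [Vs] on [P]. A symmetric operator has its norm, or minus its norm, as
   an approximate eigenvalue, so lower bounds at both [t] and [- t] are contradictory. *)
pose t := (Num.sqrt B)^-1.
have t0 : 0 < t by rewrite invr_gt0 sqrtr_gt0.
have tB : t ^+ 2 * B = 1 by rewrite /t exprVn sqr_sqrtr ?(ltW B0) // mulVf // gt_eqF.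
have [s1 s10 h1] := below t; have [s2 s20 h2] := below (- t).
(* The two lower bounds give [(s1 s2)^-2 |y|^2 <= |y - t^2 Vs^2 y|^2 <= |y|^2 - t^2 |Vs y|^2]. So
   [q < 1] bounds [t^2 |Vs y|^2] on the unit ball, where its supremum is [t^2 B = 1]. *)
pose q := 1 - (s1 * s2) ^- 2.
have s0 : 0 < s1 * s2 by rewrite mulr_gt0.
have q1 : q < 1 by rewrite gtrBl invr_gt0 exprn_gt0.
have bound y : P y -> t ^+ 2 * N (Vs y) ^+ 2 <= q * N y ^+ 2.
  move=> Py; have PV := Vs_P y Py.
  have uE : (y - t%:C *: Vs y) - (- t)%:C *: Vs (y - t%:C *: Vs y) = y - (t ^+ 2)%:C *: Vs (Vs y).
    have -> : y - t%:C *: Vs y = - t%:C *: Vs y + y by rewrite scaleNr addrC.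
    rewrite Vs_l rmorphN /= !scaleNr opprK scalerDr addrC -!addrA.
    rewrite scalerN scalerA -expr2 -rmorphXn /=.
    by rewrite addNKr addrC.
  have := le_trans (h1 y) (ler_wpM2l (ltW s10) (h2 (y - t%:C *: Vs y))).
  rewrite uE mulrA => h3.
  have h4 : N (y - (t ^+ 2)%:C *: Vs (Vs y)) ^+ 2 <= N y ^+ 2 - t ^+ 2 * N (Vs y) ^+ 2.
    rewrite (hnormD_sqr hip) hnormN // ipNr // ipZr // hnormZ // cmod_real ger0_norm ?sqr_ge0 //.
    have -> : ip y (Vs (Vs y)) = (N (Vs y) ^+ 2)%:C by rewrite -Vs_sym // ip_self.
    have t20 : 0 <= t ^+ 2 by rewrite sqr_ge0.
    have := ler_wpM2l t20 (SB' _ PV); rewrite (mulrA _ B) tB mul1r => h5.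
    have := ler_wpM2l t20 h5; rewrite exprMn.
    have -> : Re (- ((t ^+ 2)%:C^* * (N (Vs y) ^+ 2)%:C)) = - (t ^+ 2 * N (Vs y) ^+ 2).
      by rewrite !ReImE /=; ring.
    have -> : t ^+ 2 ^+ 2 * N (Vs (Vs y)) ^+ 2 = t ^+ 2 * (t ^+ 2 * N (Vs (Vs y)) ^+ 2) by ring.
    by move: (t ^+ 2 * (t ^+ 2 * _)) (t ^+ 2 * _) (N y ^+ 2) => s3 s4 s5; lra.
  have h5 : N y ^+ 2 <= (s1 * s2) ^+ 2 * (N y ^+ 2 - t ^+ 2 * N (Vs y) ^+ 2).
    apply: le_trans (ler_wpM2l (sqr_ge0 _) h4); rewrite -exprMn.
    by rewrite ler_pXn2r ?nnegrE ?mulr_ge0 ?hnorm_ge0 // ltW.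
  rewrite -ler_pdivrMl ?exprn_gt0 // in h5.
  by rewrite /q mulrBl mul1r lerBrDr -lerBrDl.
have Bq : B <= q * B.
  apply: ge_sup; first by case: hS.
  move=> _ [y [Py y1] ->].
  have q0 : 0 <= q.
    rewrite -(pmulr_lge0 _ (exprn_gt0 2 xp)); apply: le_trans (bound x Px).
    by rewrite mulr_ge0 ?sqr_ge0.
  have -> : N (Vs y) ^+ 2 = t ^+ 2 * N (Vs y) ^+ 2 * B by rewrite mulrAC tB mul1r.
  rewrite ler_pM2r //.
  apply: le_trans (bound y Py) _; rewrite ler_piMr //.
  by rewrite -(expr1n _ 2) ler_pXn2r ?nnegrE ?hnorm_ge0.
by move: Bq; rewrite leNgt gtr_pMl // q1.
Qed.

Lemma boundary_functions : exists a a' b b' : C -> C, boundary_data a a' b b'.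
Proof.
exists alpha, alpha', beta, beta'; split.
- exact: cderiv_alpha.
- exact: cderiv_beta.
- exact: green.
- by split; [exact: alpha_neq0|exact: alpha_beta_neq0].
- exact: alphaV_le.
Qed.

End BoundaryTriple.

Lemma boundary_triple : exists a a' b b' : C -> C, boundary_data a a' b b'.
Proof.
case: adm => _ [_ [_ [[dA [dAd [sa [mu [Rm [[Rb _] [RmE _]]]]]]] _]]].
exact: boundary_functions dAd sa Rb RmE.
Qed.

Lemma phi_complete x : (forall l, ip x (phi l) = 0) -> x = 0.
Proof.
case: adm => _ [_ [_ [[dA [dAd [sa [mu [Rm [[Rb _] [RmE _]]]]]]] _]]].
exact: phi_total dAd sa x.
Qed.

Lemma gen_fourier_entire x z : exists d, cderiv (gen_fourier ip phi x) z d.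
Proof.
have [_ dp] := vderiv_phi (z^*); have := cderiv_sharp (vderiv_ip hip x dp).
set d := (X in cderiv _ _ X) => h; exists d.
rewrite (_ : gen_fourier ip phi x = sharp (fun w => ip (phi w) x)) //.
by apply/funext => w; rewrite /gen_fourier /sharp -ipC.
Qed.

(** [y] is the adjoint of [V] applied to [phi0]. The identity produces a nonzero constant from two
    transforms, which is what [regular_criterion] needs. *)
Lemma gen_fourier_shift : exists y, forall z,
  gen_fourier ip phi phi0 z = (N phi0 ^+ 2)%:C + z * gen_fourier ip phi y z.
Proof.
have [y hy] := adjoint_exists phi0; exists y => z; rewrite /gen_fourier.
have {1}-> : phi (z^*) = z^* *: V (phi (z^*)) + phi0.
  by rewrite -[X in _ + X](phiE (z^*)) addrC subrK.
rewrite ipDr // ipZr // conjcK ip_self // addrC; congr (_ + _ * _).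
by rewrite (ipC hip (V _)) hy -ipC.
Qed.


End AdmissiblePair.

(** * The ratio of a boundary function to its reflection *)

Section Ratio.
Variable R : realType.
Local Notation C := R[i].
Implicit Types (f g : C -> C) (z w : C).

Lemma sharpE f z : sharp f (z^*) = (f z)^*.
Proof. by rewrite /sharp conjcK. Qed.

Lemma conj_real z : Im z = 0 -> z^* = z.
Proof. by case: z => x y /= ->; rewrite oppr0. Qed.

Lemma cderiv_ccont f : (forall z, exists d, cderiv f z d) -> forall z, ccont f z.
Proof. by move=> df z; have [d /cderiv_cont] := df z. Qed.

Lemma sharp_entire f : (forall z, exists d, cderiv f z d) ->
  forall z, exists d, cderiv (sharp f) z d.
Proof. by move=> df z; have [d /cderiv_sharp h] := df (z^*); eexists; exact: h. Qed.

Lemma eq_at_limit f g z c : (forall t : R, 0 < t -> f (z + t%:C * c) = g (z + t%:C * c)) ->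
  ccont f z -> ccont g z -> f z = g z.
Proof.
move=> h cf cg; apply/eqP; rewrite -subr_eq0; apply/negPn/negP => n0.
have [d d0 hd] := ccont_neq0 (ccontB cf cg) n0.
have c0 : 0 < cmod c + 1 by rewrite ltr_wpDl ?cmod_ge0.
pose t := d / (cmod c + 1) / 2; have t0 : 0 < t by rewrite !divr_gt0.
have := hd (z + t%:C * c); rewrite addrC addKr cmodM cmod_real gtr0_norm // addrC h // subrr cmod0.
have tc : t * cmod c < d.
  rewrite /t; have -> : d / (cmod c + 1) / 2 * cmod c = d * (cmod c / (2 * (cmod c + 1))).
    by field; rewrite gt_eqF.
  rewrite gtr_pMr // ltr_pdivrMr ?mulr_gt0 //; have := cmod_ge0 c; lra.
by move=> /(_ tc); rewrite ltNge divr_ge0 ?cmod_ge0.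
Qed.

Lemma eq_off_real f g : (forall z, Im z != 0 -> f z = g z) ->
  (forall z, ccont f z) -> (forall z, ccont g z) -> forall z, f z = g z.
Proof.
move=> h cf cg z; have [z0|/h//] := eqVneq (Im z) 0.
apply: (@eq_at_limit f g z 'i) => // t t0; apply: h.
by rewrite !ReImE /= z0; apply/eqP; lra.
Qed.

Variables (a a' b b' : C -> C) (K : R).
Hypothesis da : forall z, cderiv a z (a' z) /\ exists d, cderiv a' z d.
Hypothesis db : forall z, cderiv b z (b' z) /\ exists d, cderiv b' z d.
Hypothesis ab : forall z, b z * sharp a z = a z * sharp b z.
Hypothesis a_neq0 : forall z, Im z != 0 -> a z != 0.
Hypothesis b_neq0 : forall z, a z = 0 -> b z != 0.
Hypothesis aV : forall z, Im z != 0 ->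
  cmod (a z)^-1 <= K * (1 + cmod z) ^+ 2 * (1 + `|Im z|^-1).

Let Im_zero z : a z = 0 -> Im z = 0.
Proof. by move=> az; apply/eqP/negPn/negP => /a_neq0; rewrite az eqxx. Qed.

Let sharp_a z : (sharp a z == 0) = (a z == 0).
Proof.
apply/eqP/eqP => h.
  have h1 : a (z^*) = 0 by apply: conj_inj; rewrite -[LHS]/(sharp a z) h; apply: complex_ext; rewrite /= ?oppr0.
  have := Im_zero h1; rewrite cImJ => /eqP; rewrite oppr_eq0 => /eqP /conj_real zz.
  by rewrite -zz.
by rewrite /sharp (conj_real (Im_zero h)) h; apply: complex_ext; rewrite /= ?oppr0.
Qed.

Let sharp_b z : a z = 0 -> sharp b z != 0.
Proof.
move=> az; have := b_neq0 az; rewrite /sharp (conj_real (Im_zero az)).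
by rewrite -!cmod_gt0 cmod_conj.
Qed.

(* This is [G'/G] for the zero-free entire function [G = a / a^# = b / b^#]. *)
Let p z := if a z == 0 then b' z / b z - sharp b' z / sharp b z
           else a' z / a z - sharp a' z / sharp a z.

Let ca := cderiv_ccont (fun z => ex_intro _ _ (da z).1).
Let cb := cderiv_ccont (fun z => ex_intro _ _ (db z).1).

Let ds f f' z : (forall z, cderiv f z (f' z)) -> cderiv (sharp f) z (sharp f' z).
Proof. by move=> h; exact: cderiv_sharp. Qed.

Let dlog f f' z : (forall z, cderiv f z (f' z) /\ exists d, cderiv f' z d) ->
  f z != 0 -> sharp f z != 0 ->
  exists d, cderiv (fun w => f' w / f w - sharp f' w / sharp f w) z d.
Proof.
move=> df f0 s0; have [d hd] := (df z).2; have [e he] := sharp_entire (fun z => (df z).2) z.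
eexists; apply: cderivB; first exact: cderiv_div hd (df z).1 f0.
exact: (cderiv_div he (ds z (fun z => (df z).1)) s0).
Qed.

(** Obtained by differentiating the identity [ab]; it identifies the two branches of [p] near a zero
    of [a]. *)
Let logE z : a z != 0 -> b z != 0 -> sharp b z != 0 ->
  a' z / a z - sharp a' z / sharp a z = b' z / b z - sharp b' z / sharp b z.
Proof.
move=> a0 b0 sb0; have sa0 : sharp a z != 0 by rewrite sharp_a.
have dsa := ds z (fun z => (da z).1); have dsb := ds z (fun z => (db z).1).
have h1 := cderivM (db z).1 dsa; have h2 := cderivM (da z).1 dsb.
have E : (fun w => b w * sharp a w) = (fun w => a w * sharp b w) by apply/funext => w; rewrite ab.
rewrite E in h1; have := cderiv_uniq h1 h2 => h.
suff : b' z / b z + sharp a' z / sharp a z = a' z / a z + sharp b' z / sharp b z.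
  by move=> h3; apply/eqP; rewrite subr_eq addrAC eq_sym subr_eq h3.
have -> : b' z / b z + sharp a' z / sharp a z =
    (b' z * sharp a z + b z * sharp a' z) / (b z * sharp a z) by field; rewrite b0 sa0.
by rewrite h ab; field; rewrite a0 sb0.
Qed.

Let p_entire z : exists d, cderiv p z d.
Proof.
have [a0|a0] := eqVneq (a z) 0.
  have b0 := b_neq0 a0; have sb0 := sharp_b a0.
  have [d hd] := dlog db b0 sb0.
  have [r1 r10 h1] := ccont_neq0 (cb z) b0.
  have cs : ccont (sharp b) z by exact: cderiv_cont (ds z (fun z => (db z).1)).
  have [r2 r20 h2] := ccont_neq0 cs sb0.
  have r0 : 0 < Num.min r1 r2 by rewrite lt_min r10.
  exists d; apply: (cderiv_near r0 _ hd) => w; rewrite lt_min => /andP[/h1 w1 /h2 w2].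
  have b0w : b w != 0 by rewrite -cmod_gt0; apply: le_lt_trans w1; rewrite divr_ge0 ?cmod_ge0.
  have s0w : sharp b w != 0 by rewrite -cmod_gt0; apply: le_lt_trans w2; rewrite divr_ge0 ?cmod_ge0.
  by rewrite /p; case: eqVneq => [//|aw]; rewrite logE.
have sa0 : sharp a z != 0 by rewrite sharp_a.
have [d hd] := dlog da a0 sa0; have [r r0 h] := ccont_neq0 (ca z) a0.
exists d; apply: (cderiv_near r0 _ hd) => w /h hw.
have aw : a w != 0 by rewrite -cmod_gt0; apply: le_lt_trans hw; rewrite divr_ge0 ?cmod_ge0.
by rewrite /p (negPf aw).
Qed.

(** Reflection turns [a / sharp a] into its inverse, so the logarithmic derivative changes sign.
    This carries bounds to the lower half-plane and makes [p 0] imaginary. *)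
Let p_conj z : p (z^*) = - (p z)^*.
Proof.
have az : (a (z^*) == 0) = (a z == 0).
  rewrite -sharp_a -!cmod_eq0; congr (_ == _).
  by rewrite /sharp cmod_conj conjcK.
by rewrite /p az; case: ifP => _; rewrite /sharp conjB !conjM !conjV !conjcK opprB.
Qed.

Let p_bound : exists2 c : R, 0 <= c & forall z, Im z != 0 ->
  cmod (p z) <= c * (1 + cmod z) ^+ 2 * (`|Im z| ^- 2 + `|Im z| ^- 3).
Proof.
have up z : 0 < Im z -> Im z != 0 by move=> h; rewrite gt_eqF.
have [c1 [c10 h1]] : exists c : R, 0 <= c /\ forall z, 0 < Im z ->
    cmod (a' z / a z) <= c * (1 + cmod z) ^+ 2 * ((Im z) ^- 2 + (Im z) ^- 3).
  apply: (@log_derivative_bound _ a a' K) => z z0.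
  - exact: (da z).1.
  - exact: (da z).2.
  - by apply: a_neq0; exact: up.
  - by have := aV (up z z0); rewrite gtr0_norm.
have [c2 [c20 h2]] : exists c : R, 0 <= c /\ forall z, 0 < Im z ->
    cmod (sharp a' z / sharp a z) <= c * (1 + cmod z) ^+ 2 * ((Im z) ^- 2 + (Im z) ^- 3).
  apply: (@log_derivative_bound _ _ _ K) => z z0.
  - exact: (ds z (fun z => (da z).1)).
  - exact: (sharp_entire (fun z => (da z).2) z).
  - by rewrite sharp_a a_neq0 // up.
  - have z1 : Im (z^*) != 0 by rewrite cImJ oppr_eq0 up.
    have := aV z1; rewrite cmod_conj cImJ normrN gtr0_norm //.
    by rewrite /sharp -conjV cmod_conj.
have pu z : 0 < Im z -> cmod (p z) <= (c1 + c2) * (1 + cmod z) ^+ 2 * (`|Im z| ^- 2 + `|Im z| ^- 3).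
  move=> z0; rewrite /p (negPf (a_neq0 (up z z0))); apply: le_trans (cmodB _ _) _.
  by rewrite gtr0_norm // !mulrDl; exact: lerD (h1 z z0) (h2 z z0).
exists (c1 + c2); first exact: addr_ge0.
move=> z; rewrite neq_lt => /orP[z0|z0]; last exact: pu.
have /pu : 0 < Im (z^*) by rewrite cImJ oppr_gt0.
by rewrite p_conj cmodN !cmod_conj cImJ normrN.
Qed.

Lemma ratio_exponential : exists (c : C) (t : R), cmod c = 1 /\
  forall z, a z = c * cexp ('i * t%:C * z) * sharp a z /\
            b z = c * cexp ('i * t%:C * z) * sharp b z.
Proof.
have [k k0 hk] := p_bound; have pc := real_singular_liouville k0 p_entire hk.
have p0 : p 0 = 'i * (Im (p 0))%:C.
  have := p_conj 0; rewrite [LHS]pc.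
  move=> /(congr1 (@complex.Re R)); rewrite !ReImE => h.
  by apply: complex_ext; rewrite !ReImE /= ?mul0r ?mulr0 ?mul1r ?subrr ?add0r ?addr0 //; lra.
set t := Im (p 0) in p0; set q := 'i * t%:C in p0.
have qJ : conjc (q : C) = - q by apply: complex_ext; rewrite /q !ReImE /=; ring.
have up z : 0 < Im z -> Im z != 0 by move=> h; rewrite gt_eqF.
have sa0 z : Im z != 0 -> sharp a z != 0 by move=> /a_neq0; rewrite sharp_a.
pose f z := a z / sharp a z * cexp (- (q * z)).
have df z : 0 < Im z -> cderiv f z 0.
  move=> /up z0; have := cderivM (cderiv_div (da z).1 (ds z (fun z => (da z).1)) (sa0 z z0))
    (cderiv_comp (cderivN (cderivZ q (cderiv_id z))) (cderiv_cexp _)).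
  set u := (X in cderiv _ _ X); have -> // : u = 0.
  have := pc z; rewrite p0 {1}/p (negPf (a_neq0 z0)) => e.
  rewrite /u -e; field; by rewrite a_neq0 // sa0.
set c : C := f 'i.
have fc z : 0 < Im z -> f z = c.
  move=> z0; apply: (@half_plane_const _ f (Num.min (Im z) 1)).
  - by move=> w wz; apply: df; apply: lt_le_trans wz; rewrite lt_min z0 ltr01.
  - by rewrite ge_min lexx.
  - by rewrite /= ge_min lexx orbT.
have ua z : 0 < Im z -> a z = c * cexp (q * z) * sharp a z.
  move=> z0; rewrite -(fc z z0) /f -(mulrA (a z / _)) -cexpD addNr cexp0 mulr1 divfK //.
  exact: sa0 (up z z0).
have ub z : 0 < Im z -> b z = c * cexp (q * z) * sharp b z.
  move=> z0; apply: (mulIf (sa0 z (up z z0))); rewrite ab {1}(ua z z0); ring.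
have cc g : (forall z, ccont g z) -> forall z, ccont (fun w => c * cexp (q * w) * g w) z.
  move=> cg z; apply: ccontM (cg z); apply: ccontM (ccont_cst _ _) _.
  apply: cderiv_cont (cderiv_comp (cderivZ q (cderiv_id z)) (cderiv_cexp _)).
have cs g g' : (forall z, cderiv g z (g' z)) -> forall z, ccont (sharp g) z.
  by move=> dg z; exact: cderiv_cont (ds z dg).
have csa := cs _ _ (fun z => (da z).1); have csb := cs _ _ (fun z => (db z).1).
have real_case g z : (forall z, ccont g z) -> (forall z, ccont (sharp g) z) ->
    (forall z, 0 < Im z -> g z = c * cexp (q * z) * sharp g z) -> Im z = 0 ->
    g z = c * cexp (q * z) * sharp g z.
  move=> cg csg ug z0; apply: (@eq_at_limit g (fun z => c * cexp (q * z) * sharp g z) z 'i) => //.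
    by move=> s s0; apply: ug; rewrite !ReImE /= z0; lra.
  exact: cc.
(* At 0 the identity reads [g 0 = c conj (g 0)], which gives the modulus once [g 0] is nonzero; [a]
   and [b] do not both vanish there. *)
have c1 : cmod c = 1.
  have one g : (forall z, ccont g z) -> (forall z, ccont (sharp g) z) ->
      (forall z, 0 < Im z -> g z = c * cexp (q * z) * sharp g z) -> g 0 != 0 -> cmod c = 1.
    move=> cg csg ug g0; have := real_case g 0 cg csg ug erefl.
    rewrite mulr0 cexp0 mulr1 /sharp (conj_real (erefl : Im (0 : C) = 0)) => /(congr1 (@cmod R)).
    rewrite cmodM cmod_conj => h; apply: (@mulIf _ (cmod (g 0))); first by rewrite cmod_eq0.
    by rewrite mul1r -h.
  have [a0|a0] := eqVneq (a 0) 0; last exact: (one a).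
  by apply: (one b) => //; exact: b_neq0.
have cJ : c * c^* = 1 by rewrite mulJ -cmod_sqr c1 expr1n.
exists c, t; split => // z; rewrite -/q.
(* Conjugate the identity at the conjugate point; [c] and the exponential are inverse to their
   reflections. *)
have low g : (forall z, 0 < Im z -> g z = c * cexp (q * z) * sharp g z) -> Im z < 0 ->
    g z = c * cexp (q * z) * sharp g z.
  move=> ug z0; have /ug : 0 < Im (z^*) by rewrite cImJ oppr_gt0.
  have E : conjc (c * cexp (q * z^*) * (g z)^* : C) = c^* * cexp (- (q * z)) * g z.
    rewrite [LHS]conjM conjM cexp_conj conjcK; congr (_ * cexp _ * _).
    by rewrite [LHS]conjM conjcK qJ mulNr.
  rewrite sharpE => h; rewrite /sharp h E.
  transitivity (c * c^* * (cexp (q * z) * cexp (- (q * z))) * g z); last by ring.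
  by rewrite cJ -cexpD subrr cexp0 !mul1r.
have [z0|z0|z0] := ltgtP (Im z) 0; first by split; apply: low.
  by split; [exact: ua|exact: ub].
by split; apply: real_case.
Qed.

End Ratio.

(** * De Branges spaces *)

Section HardyClosure.
Variable R : realType.
Local Notation C := R[i].
Local Notation mu := (@lebesgue_measure R).
Implicit Types (F G f g : C -> C) (z w q : C).

Lemma hardy_dominated F G M : hardy F M ->
  (forall z, 0 <= Im z -> exists k, cderiv G z k) ->
  (forall z, 0 <= Im z -> cmod (G z) <= cmod (F z)) -> hardy G M.
Proof.
move=> hF dG GF; split => // y y0; apply: le_trans (hF.2 y y0).
have c f : (forall z, 0 <= Im z -> exists k, cderiv f z k) -> forall x, ccont f (x +i* y).
  by move=> df x; have [k /cderiv_cont] := df (x +i* y) y0.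
apply: ge0_integral_le (le_refl _).
- by apply: measurable_line; exact: c dG.
- by apply: measurable_line; exact: c hF.1.
- by move=> x; exact: cmod20.
- by move=> x; rewrite -!cmod_sqr ler_pXn2r ?nnegrE ?cmod_ge0 // GF.
Qed.

Lemma hardyZ F M c : hardy F M -> hardy (fun z => c * F z) (cmod2 c * M).
Proof.
move=> hF; split.
  by move=> z /hF.1[k hk]; exists (c * k); exact: cderivZ.
move=> y y0; have := integral_cstM (cmod20 c) (hardy_measurable hF y0)
  (fun x => cmod20 _) (hF.2 y y0).
by under eq_integral do rewrite -cmod2M.
Qed.

Lemma hardy_limit (f : nat -> C -> C) g M : (forall n, hardy (f n) M) ->
  (forall z, 0 <= Im z -> exists k, cderiv g z k) ->
  (forall z, 0 <= Im z -> forall e : R, 0 < e -> exists n0, forall n, (n0 <= n)%N ->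
     cmod (f n z - g z) < e) -> hardy g M.
Proof.
move=> hf dg fg; split => // y y0.
apply: (@fatou_le _ (fun n x => cmod2 (f n (x +i* y)))).
- by move=> n; exact: hardy_measurable (hf n) y0.
- by move=> n x; exact: cmod20.
- move=> x; have c : (fun n => cmod (f n (x +i* y))) @ \oo --> cmod (g (x +i* y)).
    apply/cvgrPdist_lt => e e0; have [n0 hn] := fg (x +i* y) y0 e e0.
    exists n0 => // n /= /hn; apply: le_lt_trans; rewrite distrC.
    apply/ler_normlP; split.
      by rewrite opprB lerBlDr cmodBC -{1}(subrK (f n (x +i* y)) (g _)) cmodD.
    by rewrite lerBlDr -{1}(subrK (g (x +i* y)) (f n _)) cmodD.
  under eq_fun do rewrite -cmod_sqr expr2.
  by rewrite -cmod_sqr expr2; exact: cvgM.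
- by move=> n; exact: (hf n).2.
Qed.

(** The hypothesis says nothing on the real axis itself; continuity up to it and Fatou's lemma along
    the heights [1 / (n + 1)] extend the bound. *)
Lemma hardy_of_H2 g : in_H2_upper g ->
  (forall z, 0 <= Im z -> exists k, cderiv g z k) -> exists M, hardy g M.
Proof.
move=> [_ [M hM]] dg; exists M; split => // y; rewrite le_eqVlt => /predU1P[<-|]; last exact: hM.
have cg x y1 : 0 <= y1 -> ccont g (x +i* y1).
  by move=> y10; have [k /cderiv_cont] := dg (x +i* y1) y10.
apply: (@fatou_le _ (fun n x => cmod2 (g (x +i* n.+1%:R^-1)))).
- by move=> n; apply: measurable_line => x; apply: cg; rewrite invr_ge0.
- by move=> n x; exact: cmod20.
- move=> x; have /pcont_vertical/pcont_cmod2 c := cg x 0 (lexx 0).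
  exact: (cvg_comp _ _ (@cvg_harmonic R) c).
- by move=> n; apply: hM; rewrite invr_gt0.
Qed.

Lemma H2_of_hardy g M : hardy g M -> in_H2_upper g.
Proof.
move=> [dg hM]; split; first by move=> z z0; apply/cdiff_atP/dg; exact: ltW.
by exists M => y y0; apply: hM; exact: ltW.
Qed.

(** For [q] below the axis this is [hardy_bounded_quotient]. For [q] above it, [q] is exchanged for
    its conjugate: [g] is bounded near [q], and away from [q] the ratio of the two linear factors is
    bounded. *)
Lemma hardy_removable g q (B : R) : Im q != 0 ->
  (forall z, 0 <= Im z -> exists k, cderiv g z k) ->
  (forall z, 0 <= Im z -> cmod (g z * (z - q)) <= B) -> exists M, hardy g M.
Proof.
move=> q0 dg gB.
have B0 : 0 <= B by apply: le_trans (gB 0 (lexx _)); exact: cmod_ge0.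
have lower v B1 : 0 < Im v -> (forall z, 0 <= Im z -> cmod (g z * (z - v^*)) <= B1) ->
    exists M, hardy g M.
  move=> v0 hB; have dG z : 0 <= Im z -> exists k, cderiv (fun z => g z * (z - v^*)) z k.
    move=> /dg[k hk]; eexists; apply: cderivM hk _.
    exact: cderivB (cderiv_id _) (cderiv_cst _ _).
  eexists; apply: hardy_dominated (hardy_bounded_quotient v0 dG hB) dg _ => z z0.
  rewrite mulfK // subr_eq0; apply/eqP => e; move: z0; rewrite e cImJ oppr_ge0 leNgt.
  by rewrite v0.
move: q0; rewrite neq_lt => /orP[q0|q0].
  by apply: (lower (q^*) B); [rewrite cImJ oppr_gt0|rewrite conjcK].
have cq : ccont g q by have [k /cderiv_cont] := dg q (ltW q0).
have [d d0 hd] := ccont_bounded cq.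
have J : cmod (q - q^*) = 2 * Im q.
  have -> : q - q^* = (2 * Im q)%:C * 'i by apply: complex_ext; rewrite !ReImE /=; ring.
  by rewrite cmodM cmod_i mulr1 cmod_real gtr0_norm // mulr_gt0.
(* The first summand serves inside the disc of radius [d] about [q], the second outside it, where
   the ratio of the linear factors is at most [1 + 2 * Im q / d]. *)
apply: (lower q ((cmod (g q) + 1) * (d + 2 * Im q) + B * (1 + 2 * Im q / d)) q0) => z z0.
have zq : cmod (z - q^*) <= cmod (z - q) + 2 * Im q.
  by rewrite -J; have := cmodD (z - q) (q - q^*); rewrite subrKA.
have t1 : 0 <= (cmod (g q) + 1) * (d + 2 * Im q).
  by rewrite mulr_ge0 ?addr_ge0 ?cmod_ge0 ?mulr_ge0 // ltW.
have t2 : 0 <= B * (1 + 2 * Im q / d).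
  by rewrite mulr_ge0 ?addr_ge0 ?divr_ge0 ?mulr_ge0 // ltW.
have [zd|zd] := ltP (cmod (z - q)) d.
  apply: (@le_trans _ _ ((cmod (g q) + 1) * (d + 2 * Im q))); last by rewrite lerDl.
  rewrite cmodM; apply: ler_pM; rewrite ?cmod_ge0 //; first exact: hd.
  by apply: le_trans zq _; rewrite lerD2r ltW.
apply: (@le_trans _ _ (B * (1 + 2 * Im q / d))); last by rewrite lerDr.
have zp : 0 < cmod (z - q) by apply: lt_le_trans zd.
have -> : g z * (z - q^*) = g z * (z - q) * ((z - q^*) / (z - q)).
  by field; rewrite -cmod_gt0.
rewrite cmodM; apply: ler_pM; rewrite ?cmod_ge0 //; first exact: gB.
rewrite cmodM cmodV ler_pdivrMr //; apply: le_trans zq _.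
have -> : (1 + 2 * Im q / d) * cmod (z - q) = cmod (z - q) + 2 * Im q * (cmod (z - q) / d) by ring.
by rewrite lerD2l ler_peMr ?mulr_ge0 ?(ltW q0) // ler_pdivlMr // mul1r.
Qed.

(** Cauchy-Schwarz with a free weight in place of square roots; callers choose [t] to suit. *)
Lemma L2_pairing (f g : R -> C) (M N : R) :
  (forall t, pcont f t) -> (forall t, pcont g t) ->
  (\int[mu]_(x in setT) (cmod2 (f x))%:E <= M%:E)%E ->
  (\int[mu]_(x in setT) (cmod2 (g x))%:E <= N%:E)%E ->
  cintg setT (fun x => f x * (g x)^*) /\
  forall t : R, 0 < t -> cmod (cint setT (fun x => f x * (g x)^*)) <= (t * M + N / t) / 2.
Proof.
move=> cf cg hM hN.
have mf := measurable_cmod2 cf; have mg := measurable_cmod2 cg.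
pose h t x := 2^-1 * (t * cmod2 (f x) + t^-1 * cmod2 (g x)).
have h0 t x : 0 < t -> 0 <= h t x.
  by move=> t0; rewrite mulr_ge0 // addr_ge0 // mulr_ge0 ?cmod20 ?invr_ge0 ?ltW.
have mh0 t : measurable_fun setT (fun x => t * cmod2 (f x) + t^-1 * cmod2 (g x)).
  by apply: measurable_funD; exact: measurable_cstM.
have mh t : measurable_fun setT (h t) by exact: measurable_cstM.
have hh (t : R) : 0 < t -> (\int[mu]_(x in setT) (h t x)%:E <= ((t * M + N / t) / 2)%:E)%E.
  move=> t0; rewrite mulrC (mulrC N); apply: integral_cstM => //.
    by move=> x; rewrite addr_ge0 // mulr_ge0 ?cmod20 ?invr_ge0 ?ltW.
  apply: integral_le_add; try exact: measurable_cstM.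
  - by move=> x; rewrite mulr_ge0 ?cmod20 // ltW.
  - by move=> x; rewrite mulr_ge0 ?cmod20 // invr_ge0 ltW.
  - by apply: integral_cstM => //; [exact: ltW|move=> x; exact: cmod20].
  - by apply: integral_cstM => //; [rewrite invr_ge0 ltW|move=> x; exact: cmod20].
have bd (t x : R) : 0 < t -> cmod (f x * (g x)^*) <= h t x.
  move=> t0; rewrite cmodM cmod_conj; apply: le_trans (amgm _ _ t0) _.
  by rewrite !cmod_sqr /h mulrC (mulrC (cmod2 (g x))).
have ci : cintg setT (fun x => f x * (g x)^*).
  apply: (@dominated_cintg _ _ (h 1)).
  - move=> t; have h1 : ccont (fun w : C => f (Re w)) (t +i* 0).
      move=> e /(cf t)[d d0 hd]; exists d => // w /= wd; apply: hd.
      by apply: le_lt_trans wd; rewrite -[t]/(Re (t +i* 0)) -cReB normRe_le.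
    have h2 : ccont (fun w : C => g (Re w)) (t +i* 0).
      move=> e /(cg t)[d d0 hd]; exists d => // w /= wd; apply: hd.
      by apply: le_lt_trans wd; rewrite -[t]/(Re (t +i* 0)) -cReB normRe_le.
    exact: (pcont_horizontal (ccontM h1 (ccont_conj h2))).
  - by apply: (nonneg_integrable (mh 1) _ (hh 1 ltr01)) => t; exact: h0.
  - by move=> t; exact: bd.
split => // t t0; apply: (@cmod_cint_le_ext _ _ _ (h t)) => //.
- by move=> x; exact: h0.
- exact: hh.
- by move=> x _; exact: bd.
Qed.

End HardyClosure.

(** * From a kernel identity to a de Branges space *)

Section DeBranges.
Variables (R : realType) (H : lmodType R[i]) (ip : H -> H -> R[i]).
Local Notation C := R[i].
Local Notation mu := (@lebesgue_measure R).
Local Notation N := (hnorm ip).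
Variables (E : C -> C) (X : C -> H).
Hypothesis hip : inner_product ip.
Hypothesis complete : forall u, hcauchy ip u -> exists l : H, hconv ip u l.
Hypothesis dE : forall z, exists d, cderiv E z d.
Hypothesis dX : forall x z, exists d, cderiv (fun z => ip x (X z)) z d.
Hypothesis kernelE : forall w z, 2 * pi%:C * 'i * (w^* - z) * ip (X w) (X z) =
  E z * (E w)^* - sharp E z * (sharp E w)^*.
Hypothesis X_neq0 : forall z, X z != 0.
Hypothesis X_total : forall x, (forall z, ip x (X z) = 0) -> x = 0.
Hypothesis E_real : forall t : R, E t%:C != 0.
Implicit Types (f g : C -> C) (z w : C) (x y : H).

Let F x z := ip x (X z).

Let pi2i : 2 * pi%:C * 'i != 0 :> C.
Proof.
rewrite -cmod_gt0 !cmodM cmod_i mulr1 cmod_real gtr0_norm ?pi_gt0 // mulr_gt0 ?pi_gt0 //.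
by rewrite cmod_gt0 pnatr_eq0.
Qed.

Let pi2iJ : (2 * pi%:C * 'i : C)^* = - (2 * pi%:C * 'i).
Proof. by apply: complex_ext; rewrite !ReImE /=; ring. Qed.

(** On the diagonal the kernel identity reads 4 pi Im z |X z|^2 = |E z|^2 - |E (conj z)|^2. *)
Lemma kernel_biehler z : 0 < Im z -> cmod (E (z^*)) < cmod (E z).
Proof.
move=> z0; have := kernelE z z; rewrite ip_self // !mulJ => /(congr1 (@complex.Re R)).
have -> : z^* - z = - (2 * Im z)%:C * 'i by apply: complex_ext; rewrite !ReImE /=; ring.
rewrite !ReImE /= -!cmod_sqr => h.
rewrite -(cmod_conj (E _)) -[X in cmod X]/(sharp E z) -(@ltr_pXn2r _ 2) ?nnegrE ?cmod_ge0 //.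
rewrite -subr_gt0 -h; set k := (X in 0 < X).
have -> : k = 4 * pi * Im z * N (X z) ^+ 2 by rewrite /k; ring.
by rewrite mulr_gt0 ?exprn_gt0 ?hnorm_gt0 // mulr_gt0 // mulr_gt0 // pi_gt0.
Qed.

Let E_neq0 z : 0 <= Im z -> E z != 0.
Proof.
case: z => a b /=; rewrite le_eqVlt => /predU1P[<-|b0]; first exact: E_real.
have := @kernel_biehler (a +i* b) b0; rewrite -cmod_gt0.
by apply: le_lt_trans; exact: cmod_ge0.
Qed.

Let sharpE_le z : 0 <= Im z -> cmod (sharp E z) <= cmod (E z).
Proof.
rewrite /sharp cmod_conj le_eqVlt => /predU1P[z0|/kernel_biehler/ltW//].
by rewrite conj_real.
Qed.

Let dquot f z : (forall z, exists d, cderiv f z d) -> 0 <= Im z ->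
  exists k, cderiv (fun z => f z / E z) z k.
Proof.
move=> df z0; have [d hd] := df z; have [d' hd'] := dE z.
by eexists; exact: cderiv_div hd hd' (E_neq0 z0).
Qed.

(** Equivalent to [in_deBranges], but with the Hardy bounds stated up to the real axis. *)
Let space f := [/\ (forall z, exists d, cderiv f z d),
  exists M, hardy (fun z => f z / E z) M & exists M, hardy (fun z => sharp f z / E z) M].

Lemma in_deBrangesP f : in_deBranges E f <-> space f.
Proof.
split=> [[ef [h1 h2]]|[df [M hM] [K hK]]].
  have df z : exists d, cderiv f z d by apply/cdiff_atP; exact: ef.
  split=> //; apply: hardy_of_H2 => // z; [exact: dquot|].
  by apply: dquot; exact: sharp_entire.
split; first by move=> z; apply/cdiff_atP; exact: df.
by split; [exact: H2_of_hardy hM|exact: H2_of_hardy hK].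
Qed.

Let spaceZD c f g : space f -> space g -> space (fun z => c * f z + g z).
Proof.
move=> [df [M1 h1] [M2 h2]] [dg [K1 k1] [K2 k2]].
have dh z : exists d, cderiv (fun z => c * f z + g z) z d.
  have [d hd] := df z; have [d' hd'] := dg z; eexists; exact: cderivD (cderivZ c hd) hd'.
split => //.
  eexists; apply: hardy_dominated (hardyD (hardyZ c h1) k1) _ _ => z z0; first exact: dquot.
  by rewrite mulrA -mulrDl.
eexists; apply: hardy_dominated (hardyD (hardyZ (c^*) h2) k2) _ _ => z z0.
  by apply: dquot => //; exact: sharp_entire.
by rewrite mulrA -mulrDl /sharp conjD conjM.
Qed.

Let line f : R -> C := fun t => f (t +i* 0) / E (t +i* 0).
Let pairE f g := cint setT (fun t => line f t * (line g t)^*).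

Let line_pcont f t : (forall z, exists d, cderiv f z d) -> pcont (line f) t.
Proof.
move=> df; have [k /cderiv_cont] := dquot df (lexx (Im (t +i* 0))).
exact: pcont_horizontal.
Qed.

Let space_line f : space f -> exists2 M : R, 0 <= M &
  (\int[mu]_(t in setT) (cmod2 (line f t))%:E <= M%:E)%E.
Proof.
by move=> [_ [M hM] _]; exists M; [exact: hardy_ge0 hM|exact: (hM.2 0 (lexx 0))].
Qed.

Let pairing f g (M K : R) : space f -> space g ->
  (\int[mu]_(t in setT) (cmod2 (line f t))%:E <= M%:E)%E ->
  (\int[mu]_(t in setT) (cmod2 (line g t))%:E <= K%:E)%E ->
  cintg setT (fun t => line f t * (line g t)^*) /\
  forall s : R, 0 < s -> cmod (pairE f g) <= (s * M + K / s) / 2.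
Proof. by move=> [df _ _] [dg _ _]; apply: L2_pairing => t; exact: line_pcont. Qed.

Let pairE_cintg f g : space f -> space g -> cintg setT (fun t => line f t * (line g t)^*).
Proof.
move=> sf sg; have [M _ hM] := space_line sf; have [K _ hK] := space_line sg.
exact: (pairing sf sg hM hK).1.
Qed.

Let lineZD c f g t : line (fun z => c * f z + g z) t = c * line f t + line g t.
Proof. by rewrite /line mulrDl mulrA. Qed.

Let pairEl c f g k : space f -> space g -> space k ->
  pairE (fun z => c * f z + g z) k = c * pairE f k + pairE g k.
Proof.
move=> sf sg sk; have mT : @measurable _ (measurableTypeR R) setT by [].
have i1 := pairE_cintg sf sk; have i2 := pairE_cintg sg sk.
rewrite /pairE -cintZ // -cintD //; last exact: cintgZ.
by apply: eq_cint => t _; rewrite lineZD mulrDl mulrA.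
Qed.

Let pairEC f g : space f -> space g -> pairE g f = (pairE f g)^*.
Proof.
move=> sf sg; have mT : @measurable _ (measurableTypeR R) setT by [].
rewrite /pairE -cint_conj //; last exact: pairE_cintg.
by apply: eq_cint => t _; rewrite [RHS]conjM conjcK mulrC.
Qed.

Lemma kernel_conj w z :
  2 * pi%:C * 'i * (z^* - w) * (ip (X w) (X z))^* =
  (E z)^* * E w - (sharp E z)^* * sharp E w.
Proof.
move: (kernelE w z) pi2iJ; move: (2 * pi%:C * 'i : C) => c h cJ.
by have := congr1 (@conjc R) h; rewrite conjB !conjM cJ conjB !conjcK => <-; ring.
Qed.

(** After division by [E] the numerator of the kernel is bounded, since |sharp E| <= |E| on the
    closed half-plane, and the denominator vanishes only at a nonreal point, so [hardy_removable]
    applies. *)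
Let kernel_space w : Im w != 0 -> space (F (X w)).
Proof.
move=> w0; have dF z : exists d, cderiv (F (X w)) z d by exact: dX.
pose B := cmod (2 * pi%:C * 'i : C)^-1 * (cmod (E w) + cmod (sharp E w)).
split => //.
  apply: (@hardy_removable _ _ (w^*) B).
  - by rewrite cImJ oppr_eq0.
  - by move=> z; exact: dquot.
  - move=> z z0; have Ez := E_neq0 z0.
    have -> : F (X w) z / E z * (z - w^*) =
        - ((2 * pi%:C * 'i)^-1 * ((E w)^* - sharp E z / E z * (sharp E w)^*)).
      have k : ip (X w) (X z) * (w^* - z) = (2 * pi%:C * 'i)^-1 * (E z * (E w)^* - sharp E z * (sharp E w)^*).
        by rewrite -kernelE -(mulrA (2 * pi%:C * 'i)) mulKf // mulrC.
      transitivity (- (ip (X w) (X z) * (w^* - z)) / E z); first by rewrite /F; ring.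
      by rewrite k; move: pi2i; move: (2 * pi%:C * 'i : C) => c c0; field; rewrite Ez c0.
    rewrite cmodN cmodM /B ler_wpM2l ?cmod_ge0 //; apply: le_trans (cmodB _ _) _.
    rewrite cmod_conj lerD2l cmodM cmod_conj ler_piMl ?cmod_ge0 // cmodM cmodV.
    by rewrite ler_pdivrMr ?cmod_gt0 // mul1r sharpE_le.
apply: (@hardy_removable _ _ w B) => //.
- by move=> z; apply: dquot; exact: sharp_entire.
- move=> z z0; have Ez := E_neq0 z0.
  have -> : sharp (F (X w)) z / E z * (z - w) =
      (2 * pi%:C * 'i)^-1 * (sharp E z / E z * E w - sharp E w).
    have k : (ip (X w) (X (z^*)))^* * (z - w) = (2 * pi%:C * 'i)^-1 * (sharp E z * E w - E z * sharp E w).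
      have := kernel_conj w (z^*); rewrite conjcK -[(E (z^*))^*]/(sharp E z) sharpE conjcK => <-.
      by rewrite -(mulrA (2 * pi%:C * 'i)) mulKf // mulrC.
    transitivity ((ip (X w) (X (z^*)))^* * (z - w) / E z); first by rewrite /F /sharp; ring.
    by rewrite k; move: pi2i; move: (2 * pi%:C * 'i : C) => c c0; field; rewrite Ez c0.
  rewrite cmodM /B ler_wpM2l ?cmod_ge0 //; apply: le_trans (cmodB _ _) _.
  rewrite lerD2r cmodM ler_piMl ?cmod_ge0 // cmodM cmodV.
  by rewrite ler_pdivrMr ?cmod_gt0 // mul1r sharpE_le.
Qed.

(** On the real line the conjugated kernel splits into Cauchy kernels: up to [2 pi i] the pairing is
    [E w] times the Cauchy integral of [f / E] at [w], minus [sharp E w] times the conjugate of that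
    of [sharp f / E] at the conjugate of [w]. The sign of [Im w] decides which one vanishes; the
    other yields [f w]. *)
Let reproducing f w : space f -> Im w != 0 -> pairE f (F (X w)) = f w.
Proof.
move=> [df [M hM] [K hK]] w0; have mT : @measurable _ (measurableTypeR R) setT by [].
pose k1 t := f (t +i* 0) / E (t +i* 0) / (t +i* 0 - w).
pose k2 t := sharp f (t +i* 0) / E (t +i* 0) / (t +i* 0 - w^*).
have -> : pairE f (F (X w)) = cint setT (fun t => (2 * pi%:C * 'i)^-1 *
    (E w * k1 t - sharp E w * (k2 t)^*)).
  apply: eq_cint => t _; rewrite /line /k1 /k2; set p : C := t +i* 0.
  have pJ : p^* = p by rewrite conj_real.
  have Ep : E p != 0 by exact: (@E_neq0 p (lexx 0)).
  have EJ : (E p)^* != 0 by rewrite -cmod_gt0 cmod_conj cmod_gt0.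
  have pw : p - w != 0.
    by apply: contraNneq w0 => /(congr1 (@complex.Im R)); rewrite !ReImE /= => h; apply/eqP; lra.
  have kc := kernel_conj w p; rewrite pJ in kc.
  have sE : sharp E p = (E p)^* by rewrite /sharp pJ.
  have sf : sharp f p = (f p)^* by rewrite /sharp pJ.
  rewrite sE conjcK in kc.
  have -> : (F (X w) p / E p)^* =
      ((E p)^* * E w - E p * sharp E w) / (2 * pi%:C * 'i * (p - w)) / (E p)^*.
    rewrite conjM conjV -kc /F; congr (_ / _).
    by rewrite mulrC mulKf // mulf_neq0 ?pi2i.
  rewrite sf !conjM !conjV conjB !conjcK pJ.
  by move: pi2i; move: (2 * pi%:C * 'i : C) => c c0; field; rewrite EJ Ep pw c0.
have cc (g : R -> C) c : cintg setT g -> cintg setT (fun t => c * g t).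
  by move=> h; exact: cintgZ.
have val : cintg setT k1 /\ cintg setT k2 ->
  cint setT (fun t => (2 * pi%:C * 'i)^-1 * (E w * k1 t - sharp E w * (k2 t)^*)) =
  (2 * pi%:C * 'i)^-1 * (E w * cint setT k1 - sharp E w * (cint setT k2)^*).
  move=> [i1 i2]; have i3 := cintg_conj mT i2.
  rewrite cintZ //; last by apply: cintgB => //; exact: cc.
  by rewrite cintB // ?cintZ ?cint_conj //; exact: cc.
move: w0; rewrite neq_lt => /orP[w0|w0].
  have w1 : 0 < Im (w^*) by rewrite cImJ oppr_gt0.
  have [i1 e1] := hardy_lower hM w0; have [i2 e2] := hardy_cauchy hK w1.
  rewrite val ?e1 ?e2; last by split.
  have Ew : sharp E w != 0 by rewrite /sharp -cmod_gt0 cmod_conj cmod_gt0 E_neq0 // ltW.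
  have -> : (2 * pi%:C * 'i * (sharp f (w^*) / E (w^*)))^* = - (2 * pi%:C * 'i) * (f w / sharp E w).
    by rewrite [LHS]conjM pi2iJ [X in _ * X = _]conjM conjV /sharp !conjcK.
  by move: pi2i; move: (2 * pi%:C * 'i : C) => c c0; field; rewrite Ew c0.
have w1 : Im (w^*) < 0 by rewrite cImJ oppr_lt0.
have [i1 e1] := hardy_cauchy hM w0; have [i2 e2] := hardy_lower hK w1.
rewrite val ?e1 ?e2; last by split.
have Ew : E w != 0 by rewrite E_neq0 // ltW.
have -> : (0 : C)^* = 0 by apply: complex_ext; rewrite /= ?oppr0.
by move: pi2i; move: (2 * pi%:C * 'i : C) => c c0; field; rewrite Ew c0.
Qed.

Let F_lin a x y : F (a *: x + y) = fun z => a * F x z + F y z.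
Proof. by apply/funext => z; rewrite /F ipZDl. Qed.

(* The good vectors form a closed subspace containing the total family [X w]. *)
Let good x := space (F x) /\ forall y, space (F y) -> pairE (F y) (F x) = ip y x.

Let good_X w : Im w != 0 -> good (X w).
Proof. by move=> w0; split; [exact: kernel_space|move=> y sy; exact: reproducing]. Qed.

Let goodZD a x y : good x -> good y -> good (a *: x + y).
Proof.
move=> [sx hx] [sy hy]; have s : space (F (a *: x + y)) by rewrite F_lin; exact: spaceZD.
split=> // k sk; rewrite (pairEC s sk) F_lin pairEl // conjD [(a * _)^*]conjM -!pairEC // hx // hy //.
by rewrite ipDr // ipZr.
Qed.

Let good_subspace : Defs.subspace good.
Proof.
split; last exact: goodZD.
have i0 : Im ('i : C) != 0 by rewrite /= oner_neq0.
by have := goodZD (-1) (good_X i0) (good_X i0); rewrite scaleN1r addNr.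
Qed.

Let good_norm x : good x ->
  (\int[mu]_(t in setT) (cmod2 (line (F x) t))%:E = (N x ^+ 2)%:E)%E.
Proof.
move=> [s h]; have [i1 _] := pairE_cintg s s.
have e1 : (fun t => Re (line (F x) t * (line (F x) t)^*)) = fun t => cmod2 (line (F x) t).
  by apply/funext => t; rewrite mulJ.
have := congr1 (@complex.Re R) (h x s); rewrite ip_self //= /Rintegral => e2.
have e3 : (\int[mu]_(t in setT) (Re (line (F x) t * (line (F x) t)^*))%:E =
    \int[mu]_(t in setT) (cmod2 (line (F x) t))%:E)%E.
  by apply: eq_integral => t _; rewrite mulJ.
rewrite e1 in i1; rewrite e3 in e2.
by rewrite -[LHS]fineK ?e2 //; exact: (integrable_fin_num measurableT i1).
Qed.

(** The constant is now the norm of [x], so bounded sequences of vectors have uniform Hardy bounds,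
    which pass to limits. *)
Let good_hardy x : good x -> hardy (fun z => F x z / E z) (N x ^+ 2) /\
  hardy (fun z => sharp (F x) z / E z) (N x ^+ 2).
Proof.
move=> gx; have n := good_norm gx; have [[_ [M hM] [K hK]] _] := gx; split.
  by apply: (hardy_line_le hM); rewrite -n.
apply: (hardy_line_le hK); rewrite -n; apply: ge0_integral_le (le_refl _).
- exact: hardy_measurable hK (lexx 0).
- exact: hardy_measurable hM (lexx 0).
- by move=> t; exact: cmod20.
- move=> t; rewrite -!cmod_sqr /sharp (conj_real (erefl : Im (t +i* 0) = 0)).
  by rewrite !cmodM cmod_conj.
Qed.

Let pointwise u x v (e : R) : hconv ip u x -> 0 < e ->
  exists n0, forall n, (n0 <= n)%N -> cmod (F (u n) v - F x v) < e.
Proof.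
move=> ux e0; have k0 : 0 < N (X v) + 1 by rewrite ltr_wpDl ?hnorm_ge0.
have [n0 hn] := ux _ (divr_gt0 e0 k0); exists n0 => n /hn; rewrite ltr_pdivlMr //.
apply: le_lt_trans; rewrite /F -ipBl //; apply: le_trans (cauchy_schwarz hip _ _) _.
by rewrite ler_wpM2l ?hnorm_ge0 // lerDl.
Qed.

Let hardy_closed u x (K : R) : hconv ip u x ->
  (forall n, hardy (fun z => F (u n) z / E z) K /\ hardy (fun z => sharp (F (u n)) z / E z) K) ->
  hardy (fun z => F x z / E z) K /\ hardy (fun z => sharp (F x) z / E z) K.
Proof.
move=> ux hu; split.
  apply: (hardy_limit (fun n => (hu n).1)) => z z0; first by apply: dquot => // w; exact: dX.
  have Ep : 0 < cmod (E z) by rewrite cmod_gt0 E_neq0.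
  move=> e e0; have [n0 hn] := pointwise z ux (mulr_gt0 e0 Ep); exists n0 => n /hn h.
  by rewrite -mulrBl cmodM cmodV ltr_pdivrMr.
apply: (hardy_limit (fun n => (hu n).2)) => z z0.
  by apply: dquot => //; apply: sharp_entire => w; exact: dX.
have Ep : 0 < cmod (E z) by rewrite cmod_gt0 E_neq0.
move=> e e0; have [n0 hn] := pointwise (z^*) ux (mulr_gt0 e0 Ep); exists n0 => n /hn h.
by rewrite -mulrBl cmodM cmodV ltr_pdivrMr // /sharp -conjB cmod_conj.
Qed.

Let good_closed : hclosed ip good.
Proof.
move=> u x gu ux.
have [n1 hn1] := ux 1 ltr01.
(* Dropping the first [n1] terms bounds all norms by [N x + 1]. *)
pose v n := u (n + n1)%N.
have vx : hconv ip v x.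
  by move=> e /ux[n0 hn]; exists n0 => n nn; apply: hn; apply: leq_trans nn (leq_addr _ _).
have sx : space (F x).
  have [] := @hardy_closed v x ((N x + 1) ^+ 2) vx.
    move=> n; have [h1 h2] := good_hardy (gu (n + n1)%N).
    have le1 : N (v n) ^+ 2 <= (N x + 1) ^+ 2.
      rewrite ler_pXn2r ?nnegrE ?addr_ge0 ?hnorm_ge0 //.
      have := hnormD hip (v n - x) x; rewrite subrK => h3; apply: le_trans h3 _.
      by rewrite addrC lerD2l ltW // hn1 // leq_addl.
    by split; [case: h1|case: h2] => d hd; split => // y y0; apply: le_trans (hd y y0) _; rewrite lee_fin.
  by move=> h1 h2; split; [move=> z; exact: dX|eexists; exact: h1|eexists; exact: h2].
split => // y sy; apply/eqP; rewrite -subr_eq0 -cmod_eq0; apply/negPn/negP => n0.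
set D := cmod _ in n0; have D0 : 0 < D by rewrite lt_def n0 cmod_ge0.
have [M M0 hM] := space_line sy.
(* Chosen so that the final estimate [D <= e * (M + 1) / 2 + N y * e] falls strictly short of
   [D]. *)
pose e := D / (M + 1 + 2 * N y + 1).
have k0 : 0 < M + 1 + 2 * N y + 1 by have := hnorm_ge0 ip y; lra.
have e0 : 0 < e by rewrite divr_gt0.
have [n2 hn2] := hconv_cauchy hip ux e0; have [n3 hn3] := ux e e0.
pose n := maxn n2 n3; have nn2 : (n2 <= n)%N := leq_maxl _ _; have nn3 : (n3 <= n)%N := leq_maxr _ _.
have [sn hn] := gu n.
have dlt : hconv ip (fun m => u (m + n2)%N - u n) (x - u n).
  move=> e' /ux[m0 hm]; exists m0 => m mm; rewrite opprB subrKA.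
  by apply: hm; apply: leq_trans mm (leq_addr _ _).
have [h1 _] : hardy (fun z => F (x - u n) z / E z) (e ^+ 2) /\ hardy (fun z => sharp (F (x - u n)) z / E z) (e ^+ 2).
  apply: (hardy_closed dlt) => m.
  have g : good (u (m + n2)%N - u n).
    by rewrite addrC -scaleN1r; apply: goodZD.
  have [g1 g2] := good_hardy g.
  have le1 : N (u (m + n2)%N - u n) ^+ 2 <= e ^+ 2.
    by rewrite ler_pXn2r ?nnegrE ?hnorm_ge0 ?(ltW e0) // ltW // hn2 // leq_addl.
  by split; [case: g1|case: g2] => d hd; split => // t t0; apply: le_trans (hd t t0) _; rewrite lee_fin.
have sd : space (F (x - u n)).
  by rewrite addrC -scaleN1r F_lin; exact: spaceZD.
have [_ hp] := pairing sy sd hM (h1.2 0 (lexx 0)).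
have E1 : pairE (F y) (F x) = pairE (F y) (F (x - u n)) + ip y (u n).
  rewrite -hn // (pairEC sx sy) (pairEC sd sy) (pairEC sn sy).
  have -> : F x = fun z => 1 * F (x - u n) z + F (u n) z by rewrite -F_lin scale1r subrK.
  by rewrite pairEl // mul1r conjD.
have : D <= e * (M + 1) / 2 + N y * e.
  rewrite /D E1 -addrA -ipBr //; apply: le_trans (cmodD _ _) _; apply: lerD.
    have := hp e e0; have -> : (e * M + e ^+ 2 / e) / 2 = e * (M + 1) / 2 by field; rewrite gt_eqF.
    by [].
  apply: le_trans (cauchy_schwarz hip _ _) _; rewrite ler_wpM2l ?hnorm_ge0 // ltW //.
  exact: hn3.
have De : D = e * (M + 1 + 2 * N y + 1) by rewrite /e divfK // gt_eqF.
rewrite {1}De leNgt => /negP; apply.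
have lin (a b c : R) : 0 < a -> 0 <= b -> 0 <= c -> a * (b + 1) / 2 + c * a < a * (b + 1 + 2 * c + 1).
  move=> a0 b0 c0; have := mulr_ge0 (ltW a0) b0; have := mulr_ge0 (ltW a0) c0; lra.
by apply: lin => //; exact: hnorm_ge0.
Qed.

(** The transform of a vector orthogonal to all good vectors vanishes off the real axis, hence
    everywhere by continuity. *)
Let kernel_space_total x : good x.
Proof.
apply: (total_subspace hip complete good_subspace good_closed) => {}x hx; apply: X_total => z.
apply: (@eq_off_real _ (F x) (fun=> 0)) => [w w0|w|w].
- exact: hx (good_X w0).
- by have [d /cderiv_cont] := dX x w.
- exact: ccont_cst.
Qed.

Lemma deBranges_isometry x : in_deBranges E (fun z => ip x (X z)) /\
  deBranges_norm2 E (fun z => ip x (X z)) = (N x ^+ 2)%:E.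
Proof.
have g := kernel_space_total x; split; last exact: good_norm g.
by apply/in_deBrangesP; case: g.
Qed.

Lemma deBranges_hardy x : hardy (fun z => ip x (X z) / E z) (N x ^+ 2) /\
  hardy (fun z => sharp (fun z => ip x (X z)) z / E z) (N x ^+ 2).
Proof. exact: good_hardy (kernel_space_total x). Qed.

(** Pairing with [f] is a bounded functional on [H], represented by some [x]; testing it on the
    kernels [X w] identifies [f] with the transform of [x] off the real axis. *)
Lemma deBranges_surjective f : in_deBranges E f -> exists x, f = (fun z => ip x (X z)).
Proof.
move=> /in_deBrangesP sf; have [M M0 hM] := space_line sf.
have sF y : space (F y) by have [] := kernel_space_total y.
have [x hx] : exists x : H, forall y, pairE (F y) f = ip y x.
  apply: (@riesz _ _ _ hip complete _ ((1 + M) / 2)).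
    by move=> a y z; rewrite F_lin pairEl.
  move=> y; have [->|y0] := eqVneq y 0.
    have -> : F 0 = fun z => -1 * F 0 z + F 0 z by rewrite -F_lin scaler0 addr0.
    by rewrite pairEl // mulN1r addNr cmod0 hnorm0 // mulr0.
  have ny : 0 < N y by rewrite hnorm_gt0.
  have nF := good_norm (kernel_space_total y).
  have [_ hp] := @pairing (F y) f (N y ^+ 2) M (sF y) sf ltac:(by rewrite nF) hM.
  (* This weight makes the bound linear in [N y]. *)
  have := hp (N y)^-1; rewrite invr_gt0 => /(_ ny).
  have -> // : ((N y)^-1 * N y ^+ 2 + M / (N y)^-1) / 2 = (1 + M) / 2 * N y.
  by field; rewrite gt_eqF.
exists x; apply/funext => z; apply: (@eq_off_real _ f (F x)) => [w w0|w|w].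
- by apply: conj_inj; rewrite -(reproducing sf w0) -(pairEC sf (kernel_space w0)) hx /F -ipC.
- by case: sf => df _ _; have [d /cderiv_cont] := df w.
- by have [d /cderiv_cont] := dX x w.
Qed.

(** [1 / ((z + i) E)] is dominated by a multiple of [(p / E - z q / E) / (z + i)]; dividing by
    [z + i] absorbs the factor [z], because |z| and 1 are at most |z + i| on the half-plane. *)
Lemma regular_criterion p q (M K k : R) : hardy (fun z => p z / E z) M ->
  hardy (fun z => q z / E z) K ->
  (forall z, 0 <= Im z -> 1 <= k * cmod (p z - z * q z)) -> regular_HB E.
Proof.
move=> hp hq hk.
have ni (z : C) : 0 <= Im z -> z + 'i != 0.
  by move=> z0; apply/eqP => /(congr1 (@complex.Im R)); rewrite !ReImE /=; lra.
have di z : cderiv (fun z : C => z + 'i) z (1 + 0) by exact: cderivD (cderiv_id _) (cderiv_cst _ _).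
have le1 (z : C) : 0 <= Im z -> 1 <= cmod (z + 'i) /\ cmod z <= cmod (z + 'i).
  move=> z0; split; first by apply: le_trans (Im_le _); rewrite !ReImE /= lerDr.
  rewrite -(@ler_pXn2r _ 2) ?nnegrE ?cmod_ge0 // !cmod_sqr /cmod2 !ReImE /= addr0 lerD2l.
  by rewrite ler_pXn2r ?nnegrE //; lra.
have h1 : hardy (fun z => p z / E z / (z + 'i)) M.
  apply: (hardy_dominated hp) => z z0.
    by have [d hd] := hp.1 z z0; eexists; exact: cderiv_div hd (di z) (ni z z0).
  rewrite cmodM cmodV ler_pdivrMr ?cmod_gt0 ?ni //.
  by rewrite ler_peMr ?cmod_ge0 //; case: (le1 z z0).
have h2 : hardy (fun z => - z * (q z / E z) / (z + 'i)) K.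
  apply: (hardy_dominated hq) => z z0.
    have [d hd] := hq.1 z z0; eexists; apply: (cderiv_div _ (di z) (ni z z0)).
    exact: cderivM (cderivN (cderiv_id z)) hd.
  rewrite cmodM cmodV ler_pdivrMr ?cmod_gt0 ?ni // cmodM cmodN mulrC.
  by rewrite ler_wpM2l ?cmod_ge0 //; case: (le1 z z0).
apply: (@H2_of_hardy _ _ (cmod2 k%:C * (2 * M + 2 * K))).
apply: hardy_dominated (hardyZ k%:C (hardyD h1 h2)) _ _ => z z0.
  have [d hd] := dE z; eexists; apply: cderivV; first exact: cderivM (di z) hd.
  by rewrite mulf_neq0 ?ni ?E_neq0.
have E0 := E_neq0 z0; have i0 := ni z z0.
have -> : p z / E z / (z + 'i) + - z * (q z / E z) / (z + 'i) =
    (p z - z * q z) * ((z + 'i) * E z)^-1 by field; rewrite E0 i0.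
rewrite [leRHS]cmodM [cmod (_ * _^-1)]cmodM mulrA ler_peMl ?cmod_ge0 //.
apply: le_trans (hk z z0) _; rewrite cmod_real ler_wpM2r ?cmod_ge0 //; exact: ler_norm.
Qed.

End DeBranges.

(** * The Hermite-Biehler function of an admissible pair *)

Theorem theorem4p2 (R : realType) (H : lmodType R[i]) (ip : H -> H -> R[i])
    (dom : set H) (D V : H -> H) (phi0 : H) (phi : R[i] -> H) :
  separable_hilbert ip ->
  admissible ip dom D V ->
  ker_op dom D phi0 -> phi0 != 0 ->
  (forall lam : R[i], phi lam - lam *: V (phi lam) = phi0) ->
  exists E : R[i] -> R[i],
    hermite_biehler E /\ regular_HB E /\ (forall t : R, E t%:C != 0) /\
    exists alpha : R,
      (forall x : H,
         in_deBranges E (fun z => exp_ialpha alpha z * gen_fourier ip phi x z) /\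
         deBranges_norm2 E (fun z => exp_ialpha alpha z * gen_fourier ip phi x z)
           = ((hnorm ip x) ^+ 2)%:E) /\
      (forall f : R[i] -> R[i], in_deBranges E f ->
         exists x : H, f = (fun z => exp_ialpha alpha z * gen_fourier ip phi x z)).
Proof.
move=> sep adm ker0 phi0_neq0 phiE.
have hip : inner_product ip by case: sep.
have complete : forall u, hcauchy ip u -> exists l : H, hconv ip u l by case: sep => _ [].
have [a [a' [b [b' [da db green [a0 b0] [K aV]]]]]] := boundary_triple sep adm ker0 phi0_neq0 phiE.
have ab z : b z * sharp a z = a z * sharp b z.
  have := green z (z^*); rewrite conjcK subrr mul0r => /eqP.
  by rewrite eq_sym subr_eq0 => /eqP.
have [c [t [c1 ceq]]] := ratio_exponential da db ab a0 b0 aV.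
pose alpha := t / 2; pose k : R[i] := sqrtc c.
have kk : k ^+ 2 = c by exact: sqr_sqrtc.
have k1 : cmod k = 1.
  by apply/eqP; rewrite -(@eqrXn2 _ 2) ?cmod_ge0 // expr1n -cmodX kk c1.
have kJ : k * k^* = 1 by rewrite mulJ -cmod_sqr k1 expr1n.
pose e := exp_ialpha (R := R) alpha.
have eE z : e z * e z = cexp ('i * t%:C * z).
  have tE : t%:C = alpha%:C + alpha%:C :> R[i] by rewrite [in LHS](splitr t) rmorphD.
  by rewrite /e /exp_ialpha -cexpD tE; congr cexp; ring.
have eJ z : (e (z^*))^* = (e z)^-1.
  rewrite /e /exp_ialpha cexp_conj -cexpN; congr cexp.
  by apply: complex_ext; rewrite !ReImE /=; ring.
have e_neq0 z : e z != 0 by exact: cexp_neq0.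
have de z : exists d, cderiv e z d.
  by eexists; exact: cderiv_comp (cderivZ _ (cderiv_id z)) (cderiv_cexp _).
have k0 : k != 0 by rewrite -cmod_gt0 k1.
have kV : k^* = k^-1 by apply: (mulfI k0); rewrite kJ divff.
(* [A] and [B] are real entire functions *)
pose A z := k * e z * sharp a z; pose B z := k * e z * sharp b z.
have realE f : (forall z, f z = c * cexp ('i * t%:C * z) * sharp f z) ->
    forall z, (k * e (z^*) * sharp f (z^*))^* = k * e z * sharp f z.
  move=> fE z; rewrite !conjM eJ sharpE conjcK kV {1}fE -kk -eE.
  by field; rewrite k0 e_neq0.
have AJ z : (A (z^*))^* = A z by apply: realE => w; case: (ceq w).
have BJ z : (B (z^*))^* = B z by apply: realE => w; case: (ceq w).
(* [A - i B] contributes [2 i] to the kernel identity; [s * s = pi] completes it to [2 pi i]. *)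
pose s : R[i] := (Num.sqrt pi)%:C.
have ss : s * s = pi%:C by rewrite -rmorphM /= -expr2 sqr_sqrtr // pi_ge0.
have sJ : s^* = s by rewrite conj_real.
have s0 : s != 0 by rewrite -cmod_gt0 cmod_real normr_gt0 gt_eqF // sqrtr_gt0 pi_gt0.
pose E z := s * (A z - 'i * B z).
have iJ : ('i : R[i])^* = - 'i by apply: complex_ext; rewrite /= ?oppr0.
have conjE1 (u v : R[i]) : (s * (u - 'i * v))^* = s * (u^* + 'i * v^*).
  by rewrite conjM conjB conjM sJ iJ mulNr opprK.
have conjE2 (u v : R[i]) : (s * (u + 'i * v))^* = s * (u^* - 'i * v^*).
  by rewrite conjM conjD conjM sJ iJ mulNr.
have sharpEE z : sharp E z = s * (A z + 'i * B z).
  by rewrite /sharp /E conjE1 AJ BJ.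
have dsh f f' : (forall z, cderiv f z (f' z) /\ exists d, cderiv f' z d) ->
    forall z, exists d, cderiv (fun z => k * e z * sharp f z) z d.
  move=> df z; have [d hd] := de z; eexists; apply: cderivM (cderivZ k hd) _.
  exact: (cderiv_sharp (df (z^*)).1).
have dA := dsh _ _ da; have dB := dsh _ _ db.
have dE z : exists d, cderiv E z d.
  have [d1 h1] := dA z; have [d2 h2] := dB z.
  by eexists; exact: cderivZ (cderivB h1 (cderivZ _ h2)).
(* The vector representing evaluation at [z] on [exp(i alpha z) W H]. *)
pose X z := (e z)^* *: phi (z^*).
have FE x z : ip x (X z) = e z * gen_fourier ip phi x z.
  by rewrite /X ipZr // conjcK.
have dX x z : exists d, cderiv (fun z => ip x (X z)) z d.
  have [d1 h1] := de z; have [d2 h2] := gen_fourier_entire sep adm phiE x z.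
  rewrite (_ : (fun z => ip x (X z)) = fun z => e z * gen_fourier ip phi x z); last exact/funext/FE.
  by eexists; exact: cderivM h1 h2.
have X_neq0 z : X z != 0.
  rewrite scaler_eq0 negb_or (phi_neq0 adm phi0_neq0 phiE) andbT.
  by rewrite -cmod_gt0 cmod_conj cmod_gt0.
have X_total x : (forall z, ip x (X z) = 0) -> x = 0.
  move=> h; apply: (phi_complete sep adm ker0 phi0_neq0 phiE) => l.
  have := h (l^*); rewrite FE => /eqP; rewrite mulf_eq0 (negPf (e_neq0 _)) /gen_fourier conjcK.
  by move/eqP.
(* At a real point [A] and [B] are real, so a zero of [E] is a common zero of both, hence of [a] and
   [b], which is excluded. *)
have E_real (r : R) : E r%:C != 0.
  have rJ : (r%:C)^* = r%:C by rewrite conj_real.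
  have Ar : (A r%:C)^* = A r%:C by rewrite -[in LHS]rJ AJ.
  have Br : (B r%:C)^* = B r%:C by rewrite -[in LHS]rJ BJ.
  apply/eqP => /eqP; rewrite mulf_eq0 (negPf s0) /= => /eqP h.
  have IA : Im (A r%:C) = 0 by have := congr1 (@complex.Im R) Ar; rewrite cImJ; lra.
  have IB : Im (B r%:C) = 0 by have := congr1 (@complex.Im R) Br; rewrite cImJ; lra.
  have real_zero (u v : R[i]) : Im u = 0 -> Im v = 0 -> u - 'i * v = 0 -> u = 0 /\ v = 0.
    move=> Iu Iv uv; have Ru := congr1 (@complex.Re R) uv; have Rv := congr1 (@complex.Im R) uv.
    rewrite !ReImE Iu Iv /= in Ru Rv.
    by split; apply: complex_ext; rewrite ?Iu ?Iv //=; lra.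
  have [A0 B0] := real_zero _ _ IA IB h.
  have z0 f : k * e r%:C * sharp f r%:C = 0 -> f r%:C = 0.
    move/eqP; rewrite !mulf_eq0 (negPf k0) (negPf (e_neq0 _)) /= /sharp rJ.
    by rewrite -cmod_eq0 cmod_conj cmod_eq0 => /eqP.
  by have := b0 _ (z0 _ A0); rewrite (z0 _ B0) eqxx.
have kernelE w z : 2 * pi%:C * 'i * (w^* - z) * ip (X w) (X z) =
    E z * (E w)^* - sharp E z * (sharp E w)^*.
  rewrite !sharpEE /E conjE1 conjE2 -ss.
  have g := green (w^*) (z^*); rewrite conjcK in g.
  have Aw : (A w)^* = k^-1 * (e w)^* * a (w^*) by rewrite /A !conjM kV /sharp conjcK.
  have Bw : (B w)^* = k^-1 * (e w)^* * b (w^*) by rewrite /B !conjM kV /sharp conjcK.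
  have -> : 2 * (s * s) * 'i * (w^* - z) * ip (X w) (X z) =
      2 * (s * s) * 'i * ((e w)^* * e z) * ((w^* - z) * ip (phi (w^*)) (phi (z^*))).
    by rewrite /X ipZl // ipZr // conjcK; ring.
  rewrite g Aw Bw /A /B -[(a (z^*))^*]/(sharp a z) -[(b (z^*))^*]/(sharp b z).
  have i2 : 'i * 'i = -1 :> R[i] by rewrite -expr2 sqr_i.
  by field.
exists E; split; [split|split; [|split]] => //.
- by move=> z; apply/cdiff_atP; exact: dE.
- exact: kernel_biehler hip kernelE X_neq0.
- have [y hy] := gen_fourier_shift sep adm phiE.
  have hh := deBranges_hardy hip complete dE dX kernelE X_neq0 X_total E_real.
  have N0 : 0 < hnorm ip phi0 ^+ 2 by rewrite exprn_gt0 // hnorm_gt0.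
  have ce z : cmod (e z) = expR (- alpha * Im z).
    by rewrite cmod_cexp !ReImE /=; congr expR; ring.
  have diff z : ip phi0 (X z) - z * ip y (X z) = (hnorm ip phi0 ^+ 2)%:C * e z.
    by rewrite !FE hy; ring.
  have unit_le (r : R) : 0 <= r -> 1 <= (hnorm ip phi0 ^+ 2)^-1 * (hnorm ip phi0 ^+ 2 * expR r).
    by move=> r0; rewrite mulKf ?gt_eqF // -expR0 ler_expR.
  (* The exponential in [diff] has modulus [exp(- alpha Im z)], at least 1 on the upper half-plane
     if [alpha <= 0]. Otherwise the reflected functions are used, whose exponential is taken at the
     conjugate point. *)
  have [al|al] := leP alpha 0.
    apply: (regular_criterion hip dE kernelE X_neq0 E_real (hh phi0).1 (hh y).1
      (k := (hnorm ip phi0 ^+ 2)^-1)) => z z0.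
    rewrite diff cmodM cmod_real ger0_norm ?sqr_ge0 // ce; apply: unit_le.
    by rewrite mulr_ge0 // oppr_ge0.
  apply: (regular_criterion hip dE kernelE X_neq0 E_real (hh phi0).2 (hh y).2
    (k := (hnorm ip phi0 ^+ 2)^-1)) => z z0.
  have -> : sharp (fun z => ip phi0 (X z)) z - z * sharp (fun z => ip y (X z)) z =
      ((hnorm ip phi0 ^+ 2)%:C * e (z^*))^*.
    by rewrite -diff conjB conjM conjcK.
  rewrite cmod_conj cmodM cmod_real ger0_norm ?sqr_ge0 // ce; apply: unit_le.
  by rewrite cImJ mulrNN mulr_ge0 // ltW.
exists alpha.
have FE' x : (fun z => exp_ialpha alpha z * gen_fourier ip phi x z) = fun z => ip x (X z).
  by apply/funext => z; rewrite FE.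
split=> [x|f /(deBranges_surjective hip complete dE dX kernelE X_neq0 X_total E_real)[x ->]].
  rewrite FE'; exact: deBranges_isometry.
by exists x; rewrite FE'.
Qed.
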